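(* Let $(M^3,g)$ be a Ricci soliton derived from the ansatz described in the context, with $\rho$ constant. Then $\bar\psi=C$ is constant and either (i) $C=0$, in which case $M$ is locally isometric to a Riemannian product $N^2\times\mathbb{R}$, where $N^2$ is a $2$-dimensional gradient Ricci soliton; or (ii) $C\neq0$, in which case $M$ either has constant curvature or is locally isometric to the geometry $\mathrm{Nil}$.
   Context: Ricci soliton: $(M,g)$ such that $-2\,\mathrm{Ricci}(g)=\mathcal L_Eg+2Ag$ for some vector field $E$ and constant $A$; it is a gradient soliton if $E=\mathrm{grad}\,F$ for some function $F$. The ansatz. Let $(N,h)$ be a Riemannian surface with Gaussian curvature $K^N$ and volume form $\mu^N$, let $A$ be a constant, and let $\bar\psi,\bar\lambda,\bar\rho,\bar\nu:N\to\mathbb R$ be functions with $\bar\psi\ge0$ (and $\bar\lambda,\bar\rho,\bar\nu$ smooth and positive) satisfying (1) $K^N+\frac12(\Delta^N\ln(\bar\lambda^2\bar\nu)-|\mathrm{grad}\ln\bar\rho|^2)+\frac{A-\bar\psi}{\bar\lambda^2}=0$; (2a) $\Delta^N\ln(\bar\rho^2\bar\nu\bar\psi^{-1/2})+|\mathrm{grad}\ln\bar\rho|^2-\frac14|\mathrm{grad}\ln\bar\psi|^2+\frac12h(\mathrm{grad}\ln\bar\psi,\mathrm{grad}\ln\bar\nu)+\frac{\bar\psi+A}{\bar\lambda^2}=0$ (vacuous whenever $\bar\psi\equiv0$); (2b) $\bar\lambda^2\{\Delta^N\ln\bar\rho-h(\mathrm{grad}\ln\bar\rho,\mathrm{grad}\ln\bar\nu)+\frac{\bar\psi+A}{\bar\lambda^2}\}$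 is constant; (u) $\nabla d\ln\bar\nu+2\,d\ln\bar\lambda\odot d\ln\bar\nu-(d\ln\bar\rho)^2=\alpha h$ for some function $\alpha:N\to\mathbb R$. Let $M=N\times(-\delta,\delta)$ for some $\delta>0$, $\varphi:M\to N$ the canonical projection, $\bar\sigma=\sqrt{2\bar\psi}/\bar\lambda^2$, $\bar\Omega=\bar\sigma\mu^N$, $\tilde\Omega=\varphi^*\bar\Omega$, $\rho=\bar\rho\circ\varphi$, $\lambda=\bar\lambda\circ\varphi$; let $\theta$ be a $1$-form on $M$, everywhere non-vanishing on $\ker d\varphi$, with $d\theta+d\ln\rho\wedge\theta=\tilde\Omega$; and let $g=\varphi^*h/\lambda^2+\theta^2$. Then $(M,g)$ is a Ricci soliton with constant $A$. Here $\omega\odot\eta=\frac12(\omega\otimes\eta+\eta\otimes\omega)$, $\omega^2=\omega\otimes\omega$, $\omega\wedge\eta=\omega\otimes\eta-\eta\otimes\omega$, $\Delta^N=\mathrm{Tr}\,\nabla d$. The geometry $\mathrm{Nil}$ is the $3$-dimensional geometry given by the metric $dy_1^2+dy_2^2+(y_1\,dy_2+dy_3)^2$ on $\mathbb R^3$.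
   Formalization: In (ii), ''locally isometric to the geometry Nil'' is taken up to a constant positive factor on the Nil metric, the same at all points of M; with the metric exactly as given the claim fails (flat N, λ=ρ=1, ψ=C, A=3C, ν=exp(-C|x|²) gives the Nil metric divided by 2C). *)

(* Defs.v *)
From HB Require Import structures.
From mathcomp Require Import all_boot all_order all_algebra.
From mathcomp Require Import all_classical all_reals all_analysis.

Set Implicit Arguments.
Unset Strict Implicit.
Unset Printing Implicit Defensive.

Import Order.TTheory GRing.Theory Num.Theory.
Import numFieldNormedType.Exports.

Local Open Scope classical_set_scope.
Local Open Scope ring_scope.

(* Vectors of R^n, tangent vectors and covectors are all row vectors, given by
   their components; indices start at 0. *)

Definition pd (R : realType) (n : nat) (a : 'I_n) (f : 'rV[R]_n -> R) :
    'rV[R]_n -> R :=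
  fun u => 'D_(delta_mx 0 a) f u.

Definition pds (R : realType) (n : nat) (s : seq 'I_n) (f : 'rV[R]_n -> R) :
    'rV[R]_n -> R :=
  foldr (@pd R n) f s.

(* C^infinity on U, for U open: all iterated partial derivatives exist and are
   continuous at the points of U. *)
Definition smooth_on (R : realType) (n : nat) (U : set 'rV[R]_n)
    (f : 'rV[R]_n -> R) : Prop :=
  forall (s : seq 'I_n) (u : 'rV[R]_n), U u ->
    {for u, continuous (pds s f)} /\
    (forall a : 'I_n, derivable (pds s f) u (delta_mx 0 a)).

Definition smooth_mx_on (R : realType) (n p q : nat) (U : set 'rV[R]_n)
    (B : 'rV[R]_n -> 'M[R]_(p, q)) : Prop :=
  forall (k : 'I_p) (l : 'I_q), smooth_on U (fun u => B u k l).

Definition dif (R : realType) (n : nat) (f : 'rV[R]_n -> R) (u : 'rV[R]_n) :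
    'rV[R]_n :=
  \row_a pd a f u.

(* 'J f u has the entry d(f_b)/d(u_a) in row a and column b, so it acts on
   tangent vectors by v |-> v *m 'J f u. *)
Definition pull1 (R : realType) (m n : nat) (f : 'rV[R]_m -> 'rV[R]_n)
    (w : 'rV[R]_n -> 'rV[R]_n) (u : 'rV[R]_m) : 'rV[R]_m :=
  w (f u) *m ('J f u)^T.

Definition pull2 (R : realType) (m n : nat) (f : 'rV[R]_m -> 'rV[R]_n)
    (B : 'rV[R]_n -> 'M[R]_n) (u : 'rV[R]_m) : 'M[R]_m :=
  'J f u *m B (f u) *m ('J f u)^T.

Definition tens (R : realType) (n : nat) (v w : 'rV[R]_n) : 'M[R]_n := v^T *m w.

Definition odot (R : realType) (n : nat) (v w : 'rV[R]_n) : 'M[R]_n :=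
  2^-1 *: (tens v w + tens w v).

Definition form_wedge (R : realType) (n : nat) (v w : 'rV[R]_n) : 'M[R]_n :=
  tens v w - tens w v.

Definition extd (R : realType) (n : nat) (w : 'rV[R]_n -> 'rV[R]_n)
    (u : 'rV[R]_n) : 'M[R]_n :=
  \matrix_(a, b) (pd a (fun y => w y 0 b) u - pd b (fun y => w y 0 a) u).

(* Below, g is the matrix of components of a metric in a chart. *)

Definition inner (R : realType) (n : nat) (B : 'M[R]_n) (v w : 'rV[R]_n) : R :=
  (v *m B *m w^T) 0 0.

Definition grad (R : realType) (n : nat) (g : 'rV[R]_n -> 'M[R]_n)
    (f : 'rV[R]_n -> R) (u : 'rV[R]_n) : 'rV[R]_n :=
  dif f u *m invmx (g u).

Definition gradprod (R : realType) (n : nat) (g : 'rV[R]_n -> 'M[R]_n)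
    (f k : 'rV[R]_n -> R) (u : 'rV[R]_n) : R :=
  inner (g u) (grad g f u) (grad g k u).

(* nabla_a d_b = sum_c (christoffel g c a b) d_c *)
Definition christoffel (R : realType) (n : nat) (g : 'rV[R]_n -> 'M[R]_n)
    (c a b : 'I_n) (u : 'rV[R]_n) : R :=
  2^-1 * \sum_d invmx (g u) c d *
    (pd a (fun y => g y b d) u + pd b (fun y => g y a d) u
     - pd d (fun y => g y a b) u).

Definition hess (R : realType) (n : nat) (g : 'rV[R]_n -> 'M[R]_n)
    (f : 'rV[R]_n -> R) (u : 'rV[R]_n) : 'M[R]_n :=
  \matrix_(a, b) (pd a (pd b f) u - \sum_c christoffel g c a b u * pd c f u).

Definition laplacian (R : realType) (n : nat) (g : 'rV[R]_n -> 'M[R]_n)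
    (f : 'rV[R]_n -> R) (u : 'rV[R]_n) : R :=
  \tr (invmx (g u) *m hess g f u).

(* R(d_a, d_b) d_c = sum_d (riemann g d c a b) d_d *)
Definition riemann (R : realType) (n : nat) (g : 'rV[R]_n -> 'M[R]_n)
    (d c a b : 'I_n) (u : 'rV[R]_n) : R :=
  pd a (christoffel g d b c) u - pd b (christoffel g d a c) u
  + \sum_e (christoffel g d a e u * christoffel g e b c u
            - christoffel g d b e u * christoffel g e a c u).

(* Ricci(Y, Z) = Tr (X |-> R(X, Y) Z) *)
Definition ricci (R : realType) (n : nat) (g : 'rV[R]_n -> 'M[R]_n)
    (u : 'rV[R]_n) : 'M[R]_n :=
  \matrix_(b, c) \sum_a riemann g a c a b u.

(* g(R(v, w) w, v) / (|v|^2 |w|^2 - g(v, w)^2) *)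
Definition sectional (R : realType) (n : nat) (g : 'rV[R]_n -> 'M[R]_n)
    (u v w : 'rV[R]_n) : R :=
  inner (g u)
    (\row_d \sum_a \sum_b \sum_c v 0 a * w 0 b * w 0 c * riemann g d c a b u) v
  / (inner (g u) v v * inner (g u) w w - inner (g u) v w ^+ 2).

Definition gauss (R : realType) (g : 'rV[R]_2 -> 'M[R]_2) (u : 'rV[R]_2) : R :=
  sectional g u (delta_mx 0 0) (delta_mx 0 1).

Definition lie (R : realType) (n : nat) (g : 'rV[R]_n -> 'M[R]_n)
    (E : 'rV[R]_n -> 'rV[R]_n) (u : 'rV[R]_n) : 'M[R]_n :=
  \matrix_(a, b) \sum_c
    (E u 0 c * pd c (fun y => g y a b) u
     + g u c b * pd a (fun y => E y 0 c) u
     + g u a c * pd b (fun y => E y 0 c) u).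

(* An atlas is a family of local parametrizations par i, each of interest only
   on dom i. The underlying set of the manifold is the union of the images of
   the parametrizations, possibly smaller than the type mpoint. *)
Record atlas (R : realType) (n : nat) := Atlas {
  mpoint : Type;
  chart : Type;
  dom : chart -> set 'rV[R]_n;
  par : chart -> 'rV[R]_n -> mpoint }.

Definition carrier (R : realType) (n : nat) (N : atlas R n) : set (mpoint N) :=
  [set x | exists (i : chart N) (u : 'rV[R]_n), dom i u /\ par i u = x].
Arguments carrier {R n} N _.

(* tau is a change of coordinates from the chart i to the chart j on the open
   set W. *)
Definition transition (R : realType) (n : nat) (N : atlas R n) (i j : chart N)
    (W : set 'rV[R]_n) (tau : 'rV[R]_n -> 'rV[R]_n) : Prop :=
  [/\ open W, W `<=` dom i, smooth_mx_on W tau &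
      forall u, W u -> dom j (tau u) /\ par j (tau u) = par i u].

Definition mopen (R : realType) (n : nat) (N : atlas R n)
    (X : set (mpoint N)) : Prop :=
  X `<=` carrier N /\
  forall i : chart N, open [set u | dom i u /\ X (par i u)].

(* In atlas_changes, applying the clause to (i, j) and to (j, i) shows that
   overlaps are open and that coordinate changes are diffeomorphisms. *)
Record is_manifold (R : realType) (n : nat) (N : atlas R n) : Prop := {
  atlas_open : forall i : chart N, open (dom i);
  atlas_inj : forall (i : chart N) (u v : 'rV[R]_n),
    dom i u -> dom i v -> par i u = par i v -> u = v;
  atlas_changes : forall (i j : chart N) (u v : 'rV[R]_n),
    dom i u -> dom j v -> par i u = par j v ->
    exists (W : set 'rV[R]_n) (tau : 'rV[R]_n -> 'rV[R]_n),
      W u /\ transition i j W tau;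
  atlas_hausdorff : forall x y : mpoint N,
    carrier N x -> carrier N y -> x <> y ->
    exists X Y : set (mpoint N),
      [/\ mopen X, mopen Y, X x, Y y & X `&` Y = set0];
  atlas_second_countable : exists B : nat -> set (mpoint N),
    (forall k, mopen (B k)) /\
    (forall (X : set (mpoint N)) (x : mpoint N), mopen X -> X x ->
       exists k, B k x /\ B k `<=` X) }.

(* Tensor fields, given by their components in every chart. *)
Definition covector_field (R : realType) (n : nat) (N : atlas R n) :=
  chart N -> 'rV[R]_n -> 'rV[R]_n.
Definition vector_field (R : realType) (n : nat) (N : atlas R n) :=
  chart N -> 'rV[R]_n -> 'rV[R]_n.
Definition tensor2 (R : realType) (n : nat) (N : atlas R n) :=
  chart N -> 'rV[R]_n -> 'M[R]_n.

Definition loc (R : realType) (n : nat) (N : atlas R n) (f : mpoint N -> R)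
    (i : chart N) : 'rV[R]_n -> R :=
  fun u => f (par i u).

Definition is_smooth (R : realType) (n : nat) (N : atlas R n)
    (f : mpoint N -> R) : Prop :=
  forall i : chart N, smooth_on (dom i) (loc f i).

Definition is_covector_field (R : realType) (n : nat) (N : atlas R n)
    (w : covector_field N) : Prop :=
  (forall i, smooth_mx_on (dom i) (w i)) /\
  (forall i j W tau, transition i j W tau ->
     forall u, W u -> w i u = pull1 tau (w j) u).

Definition is_vector_field (R : realType) (n : nat) (N : atlas R n)
    (E : vector_field N) : Prop :=
  (forall i, smooth_mx_on (dom i) (E i)) /\
  (forall i j W tau, transition i j W tau ->
     forall u, W u -> E j (tau u) = E i u *m 'J tau u).

Definition is_tensor2 (R : realType) (n : nat) (N : atlas R n)
    (B : tensor2 N) : Prop :=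
  (forall i, smooth_mx_on (dom i) (B i)) /\
  (forall i j W tau, transition i j W tau ->
     forall u, W u -> B i u = pull2 tau (B j) u).

Definition is_metric (R : realType) (n : nat) (N : atlas R n)
    (g : tensor2 N) : Prop :=
  is_tensor2 g /\
  forall i u, dom i u ->
    (g i u)^T = g i u /\ forall v, v != 0 -> 0 < inner (g i u) v v.

Definition is_riemannian (R : realType) (n : nat) (N : atlas R n)
    (g : tensor2 N) : Prop :=
  is_manifold N /\ is_metric g.

(* A 2-form with values 1 or -1 on orthonormal frames; its existence amounts to
   orientability, and its choice to that of an orientation. *)
Definition is_volume_form (R : realType) (N : atlas R 2) (h mu : tensor2 N) :
    Prop :=
  is_tensor2 mu /\
  forall i u, dom i u ->
    (mu i u)^T = - mu i u /\ (mu i u 0 1) ^+ 2 = \det (h i u).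

Definition soliton_eq (R : realType) (n : nat) (N : atlas R n) (g : tensor2 N)
    (A : R) (E : vector_field N) : Prop :=
  forall i u, dom i u ->
    - 2 *: ricci (g i) u = lie (g i) (E i) u + (2 * A) *: g i u.

Definition is_ricci_soliton (R : realType) (n : nat) (N : atlas R n)
    (g : tensor2 N) (A : R) : Prop :=
  exists E : vector_field N, is_vector_field E /\ soliton_eq g A E.

Definition is_gradient_soliton (R : realType) (n : nat) (N : atlas R n)
    (g : tensor2 N) : Prop :=
  exists (A : R) (F : mpoint N -> R),
    is_smooth F /\ soliton_eq g A (fun i => grad (g i) (loc F i)).

Definition has_constant_curvature (R : realType) (n : nat) (N : atlas R n)
    (g : tensor2 N) : Prop :=
  exists k : R, forall (i : chart N) (u v w : 'rV[R]_n),
    dom i u -> row_free (col_mx v w) -> sectional (g i) u v w = k.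

(* Every point has an open neighbourhood W isometric, by a diffeomorphism f with
   inverse f', to an open subset V of the second manifold; W and V are taken
   inside charts i and j. *)
Definition locally_isometric (R : realType) (n : nat)
    (M : atlas R n) (g : tensor2 M) (M' : atlas R n) (g' : tensor2 M') : Prop :=
  forall x : mpoint M, carrier M x ->
  exists (i : chart M) (j : chart M') (u : 'rV[R]_n) (W V : set 'rV[R]_n)
         (f f' : 'rV[R]_n -> 'rV[R]_n),
    [/\ par i u = x /\ W u,
        open W /\ W `<=` dom i,
        open V /\ V `<=` dom j,
        smooth_mx_on W f /\ smooth_mx_on V f' &
        [/\ forall y, W y -> V (f y) /\ f' (f y) = y,
            forall z, V z -> W (f' z) /\ f (f' z) = z &
            forall y, W y -> g i y = pull2 f (g' j) y]].

(* The product of N with the open subset J of R; the last coordinate is the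
   parameter in J, and the projection on N reads lsubmx in charts. *)
Definition prod_atlas (R : realType) (n : nat) (N : atlas R n) (J : set R) :
    atlas R (n + 1) :=
  @Atlas R (n + 1) (mpoint N * R) (chart N)
    (fun i w => dom i (lsubmx w) /\ J (rsubmx w 0 0))
    (fun i w => (par i (lsubmx w), rsubmx w 0 0)).

Definition pull_proj (R : realType) (n : nat) (N : atlas R n) (J : set R)
    (B : tensor2 N) : tensor2 (prod_atlas N J) :=
  fun i => pull2 (m := n + 1) (n := n) (@lsubmx R 1 n 1) (B i).

Definition dt (R : realType) (n : nat) : 'rV[R]_(n + 1) :=
  row_mx 0 (const_mx 1).

Definition prod_line_metric (R : realType) (n : nat) (N : atlas R n)
    (g : tensor2 N) : tensor2 (prod_atlas N setT) :=
  fun i w => pull_proj (J := setT) g i w + tens (dt R n) (dt R n).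

Definition euclid (R : realType) (n : nat) : atlas R n :=
  @Atlas R n 'rV[R]_n unit (fun _ => setT) (fun _ u => u).

Definition dy (R : realType) (k : 'I_3) : 'rV[R]_3 := delta_mx 0 k.

Definition nil_metric (R : realType) : tensor2 (euclid R 3) := fun _ y =>
  let eta := y 0 0 *: dy R 1 + dy R 2%:R in
  tens (dy R 0) (dy R 0) + tens (dy R 1) (dy R 1) + tens eta eta.

(* Nil is a homogeneous geometry in Thurston's sense, so it does not single out
   one of the homothetic metrics c * nil_metric: the factor c > 0 is free. *)
Definition locally_nil (R : realType) (M : atlas R 3) (g : tensor2 M) : Prop :=
  exists c : R, 0 < c /\
    locally_isometric g (M' := euclid R 3) (fun i y => c *: nil_metric i y).

Definition cylinder (R : realType) (N : atlas R 2) (delta : R) : atlas R 3 :=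
  prod_atlas N `](- delta), delta[.

Definition cylinder_metric (R : realType) (N : atlas R 2) (h : tensor2 N)
    (delta : R) (lambda : mpoint N -> R)
    (theta : covector_field (cylinder N delta)) : tensor2 (cylinder N delta) :=
  fun i w =>
    (loc (N := cylinder N delta) (fun p => lambda p.1) i w ^+ 2)^-1 *:
      pull_proj (J := `](- delta), delta[) h i w
    + tens (theta i w) (theta i w).

(* Since ln psi is only defined where psi > 0, ansatz_2a is imposed exactly at
   the points where psi > 0. *)
Record base_equations (R : realType) (N : atlas R 2) (h : tensor2 N) (A : R)
    (psi lambda rho nu : mpoint N -> R) : Prop := {
  ansatz_1 : forall (i : chart N) (u : 'rV[R]_2), dom i u ->
    gauss (h i) u
    + 2^-1 * (laplacian (h i) (loc (fun x => ln (lambda x ^+ 2 * nu x)) i) u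
              - gradprod (h i) (loc (fun x => ln (rho x)) i)
                               (loc (fun x => ln (rho x)) i) u)
    + (A - loc psi i u) / loc lambda i u ^+ 2 = 0;
  ansatz_2a : forall (i : chart N) (u : 'rV[R]_2), dom i u ->
    0 < loc psi i u ->
    laplacian (h i)
      (loc (fun x => ln (rho x ^+ 2 * nu x * psi x `^ (- 2^-1))) i) u
    + gradprod (h i) (loc (fun x => ln (rho x)) i)
                     (loc (fun x => ln (rho x)) i) u
    - 4^-1 * gradprod (h i) (loc (fun x => ln (psi x)) i)
                            (loc (fun x => ln (psi x)) i) u
    + 2^-1 * gradprod (h i) (loc (fun x => ln (psi x)) i)
                            (loc (fun x => ln (nu x)) i) u
    + (loc psi i u + A) / loc lambda i u ^+ 2 = 0;
  ansatz_2b : exists B : R, forall (i : chart N) (u : 'rV[R]_2), dom i u ->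
    loc lambda i u ^+ 2 *
      (laplacian (h i) (loc (fun x => ln (rho x)) i) u
       - gradprod (h i) (loc (fun x => ln (rho x)) i)
                        (loc (fun x => ln (nu x)) i) u
       + (loc psi i u + A) / loc lambda i u ^+ 2) = B;
  ansatz_u : exists alpha : mpoint N -> R,
    forall (i : chart N) (u : 'rV[R]_2), dom i u ->
    hess (h i) (loc (fun x => ln (nu x)) i) u
    + 2 *: odot (dif (loc (fun x => ln (lambda x)) i) u)
                (dif (loc (fun x => ln (nu x)) i) u)
    - tens (dif (loc (fun x => ln (rho x)) i) u)
           (dif (loc (fun x => ln (rho x)) i) u)
    = loc alpha i u *: h i u }.

Definition sigma (R : realType) (N : atlas R 2) (psi lambda : mpoint N -> R)
    (x : mpoint N) : R :=
  Num.sqrt (2 * psi x) / lambda x ^+ 2.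

(* lsubmx v = 0 expresses that v lies in the kernel of the differential of the
   projection. *)
Record is_connection_form (R : realType) (N : atlas R 2) (mu : tensor2 N)
    (delta : R) (psi lambda rho : mpoint N -> R)
    (theta : covector_field (cylinder N delta)) : Prop := {
  theta_form : is_covector_field theta;
  theta_vertical : forall (i : chart (cylinder N delta)) (w : 'rV[R]_3),
    dom i w -> forall v : 'rV[R]_(2 + 1), lsubmx v = 0 -> v != 0 ->
    (theta i w *m v^T) 0 0 != 0;
  theta_curvature : forall (i : chart (cylinder N delta)) (w : 'rV[R]_3),
    dom i w ->
    extd (theta i) w
    + form_wedge (dif (loc (N := cylinder N delta) (fun p => ln (rho p.1)) i) w)
            (theta i w)
    = pull_proj (J := `](- delta), delta[)
        (fun j u => loc (sigma psi lambda) j u *: mu j u) i w }.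

Record ansatz (R : realType) (N : atlas R 2) (h mu : tensor2 N) (A delta : R)
    (psi lambda rho nu : mpoint N -> R)
    (theta : covector_field (cylinder N delta)) : Prop := {
  ansatz_surface : is_riemannian h;
  ansatz_volume : is_volume_form h mu;
  ansatz_delta : 0 < delta;
  ansatz_psi : forall x, carrier N x -> 0 <= psi x;
  ansatz_lambda : is_smooth lambda /\ forall x, carrier N x -> 0 < lambda x;
  ansatz_rho : is_smooth rho /\ forall x, carrier N x -> 0 < rho x;
  ansatz_nu : is_smooth nu /\ forall x, carrier N x -> 0 < nu x;
  ansatz_equations : base_equations h A psi lambda rho nu;
  ansatz_theta : is_connection_form mu psi lambda rho theta }.

(* Main.v *)
(* Put H = h / lambda^2 and f = ln nu. As rho is constant, (2b) reads
   psi + A = constant, so psi = C. By the behaviour of curvature and Hessian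
   under conformal changes, (1) and (u) become
     K^H = C - A - (Delta^H f) / 2  and  Hess^H f = (Delta^H f) / 2 H.
   If C = 0 these say that H is a gradient soliton with potential f, and theta
   is closed, so theta = dF locally and (projection, F) is an isometry onto
   N x R.
   If C != 0, (2a) gives Delta^H f = - (C + A), so K^H = (3 C - A) / 2 and
   Hess^H f is a constant multiple of H. By the Ricci identity K^H grad f = 0;
   where K^H != 0, f is therefore constant and A = - C. In that case an
   orthonormal coframe (e1, e2) of H with connection form w satisfies
   d theta = sqrt (2 C) e1 /\ e2 and d w = - 2 C e1 /\ e2, and the structure
   equations of (e1, e2, theta) are those of constant curvature C / 2.
   If K^H = 0, rotating (e1, e2) by a primitive of w gives closed forms dy1,
   dy2, and theta - sqrt (2 C) y1 dy2 is closed: these are Nil coordinates up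
   to the scale sqrt (2 C). *)
From HB Require Import structures.
Require Import Defs.
From mathcomp Require Import all_boot all_order all_algebra.
From mathcomp Require Import all_classical all_reals all_analysis.
From mathcomp Require Import ring lra.

Set Implicit Arguments.
Unset Strict Implicit.
Unset Printing Implicit Defensive.

Import Order.TTheory GRing.Theory Num.Theory.
Import numFieldNormedType.Exports.

Local Open Scope classical_set_scope.
Local Open Scope ring_scope.

(** * Calculus in several variables *)

Section PartialDerivatives.
Context {R : realType} {n : nat}.
Implicit Types (f g : 'rV[R]_n -> R) (U V : set 'rV[R]_n) (u v p : 'rV[R]_n).

(** Curvature and Hessian are defined by coordinate formulas. They are computed through orthonormal
    coframes: uniqueness of the Levi-Civita connection identifies the Christoffel symbols with any
    antisymmetric connection matrix that solves the first structure equation, after which the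
    remaining identities are algebraic. The coframe of [H] is a triangular factor of its matrix and
    is oriented by [mu], because the sign in [d theta = sqrt (2 C) e1 /\ e2] depends on the
    orientation. For [C != 0] the alternative bears on constants, not on points:
    [K^H = (3 C - A) / 2] is one number for the whole surface, so either [A = 3 C] or [K^H] vanishes
    nowhere. A local isometry is obtained from a smooth map that pulls the model metric back to [g]:
    as [g] is nondegenerate, the inverse function theorem supplies the rest. Smoothness is a
    statement about all iterated partial derivatives, so it is proved by coinduction, on classes of
    functions stable under differentiation. *)

Lemma pds_rcons (s : seq 'I_n) (a : 'I_n) f :
  pds (rcons s a) f = pds s (pd a f).
Proof. by rewrite /pds foldr_rcons. Qed.

Lemma smooth_continuous U f u : smooth_on U f -> U u -> {for u, continuous f}.
Proof. by move=> sf Uu; have [] := sf [::] u Uu. Qed.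

Lemma smooth_derivable U f u a :
  smooth_on U f -> U u -> derivable f u (delta_mx 0 a).
Proof. by move=> sf Uu; have [_] := sf [::] u Uu. Qed.

Lemma smooth_pd U f a : smooth_on U f -> smooth_on U (pd a f).
Proof. by move=> sf s u Uu; have := sf (rcons s a) u Uu; rewrite pds_rcons. Qed.

Lemma smooth_sub U V f : V `<=` U -> smooth_on U f -> smooth_on V f.
Proof. by move=> VU sf s u Vu; apply: sf; exact: VU. Qed.

Lemma pd_eq_on U f g a u :
  open U -> (forall v, U v -> f v = g v) -> U u -> pd a f u = pd a g u.
Proof.
move=> oU fg Uu; apply: near_eq_derive.
by apply: filterS (open_nbhs_nbhs (conj oU Uu)) => v /fg.
Qed.

Lemma pds_eq_on U f g s u :
  open U -> (forall v, U v -> f v = g v) -> U u -> pds s f u = pds s g u.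
Proof.
move=> oU fg; elim: s u => [|a s IH] u Uu /=; first exact: fg.
exact: pd_eq_on oU IH Uu.
Qed.

Lemma continuous_eq_on (T : topologicalType) U (f g : 'rV[R]_n -> T) u :
  open U -> (forall v, U v -> f v = g v) -> U u ->
  {for u, continuous f} -> {for u, continuous g}.
Proof.
move=> oU fg Uu; rewrite /prop_for /continuous_at -(fg _ Uu).
apply: cvg_trans; apply: (@near_eq_cvg _ _ (nbhs u)).
by apply: filterS (open_nbhs_nbhs (conj oU Uu)) => v /fg.
Qed.

Lemma derivable_eq_on U f g u v :
  open U -> (forall v, U v -> f v = g v) -> U u ->
  derivable f u v -> derivable g u v.
Proof.
move=> oU fg Uu; apply: near_eq_derivable.
by apply: filterS (open_nbhs_nbhs (conj oU Uu)) => w /fg.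
Qed.

Lemma smooth_eq_on U f g :
  open U -> (forall v, U v -> f v = g v) -> smooth_on U f -> smooth_on U g.
Proof.
move=> oU fg sf s u Uu; have [cf df] := sf s u Uu.
have e v : U v -> pds s f v = pds s g v by exact: pds_eq_on.
by split=> [|a]; [exact: continuous_eq_on e Uu cf|exact: derivable_eq_on e Uu _].
Qed.

(** Coinduction principle: a class of functions stable under differentiation, up to equality on [U],
    consists of smooth functions. Words of derivatives are peeled from the right, where the
    derivative that is applied first stands. *)
Lemma smooth_coind U (S : ('rV[R]_n -> R) -> Prop) :
  open U ->
  (forall f u, S f -> U u -> {for u, continuous f} /\
     forall a, derivable f u (delta_mx 0 a)) ->
  (forall f a, S f -> exists2 g, S g & forall u, U u -> pd a f u = g u) ->
  forall f, S f -> smooth_on U f.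
Proof.
move=> oU S1 S2 f Sf s; elim/last_ind: s f Sf => [|s a IH] f Sf u Uu.
  exact: S1.
have [g Sg fg] := S2 f a Sf.
have e v : U v -> pds s g v = pds (rcons s a) f v.
  by move=> Uv; rewrite pds_rcons; apply/esym; exact: pds_eq_on fg Uv.
have [cg dg] := IH g Sg u Uu.
by split=> [|b]; [exact: continuous_eq_on e Uu cg|exact: derivable_eq_on e Uu _].
Qed.

Lemma is_derive_line f p v (r : R) :
  derivable f (p + r *: v) v ->
  is_derive r 1 (fun s : R => f (p + s *: v)) ('D_v f (p + r *: v)).
Proof.
have e : (fun h : R => h^-1 *: (f (p + (h *: (1:R) + r) *: v) - f (p + r *: v)))
  = (fun h : R => h^-1 *: (f (h *: v + (p + r *: v)) - f (p + r *: v))).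
  apply/funext => h; congr (_ *: (f _ - _)).
  by rewrite [h *: 1]mulr1 scalerDl addrCA.
move=> df; split; first by rewrite /derivable e.
by rewrite /derive e.
Qed.

Lemma MVT_segment_line f p v (s : R) : 0 <= s ->
  (forall r : R, 0 <= r <= s -> derivable f (p + r *: v) v) ->
  exists2 r : R, 0 <= r <= s & f (p + s *: v) - f p = s * 'D_v f (p + r *: v).
Proof.
move=> s0 df; pose g (r : R) := f (p + r *: v).
have g0 : g 0 = f p by rewrite /g scale0r addr0.
have dg (r : R) : 0 <= r <= s -> is_derive r 1 g ('D_v f (p + r *: v)).
  by move=> rs; apply: is_derive_line; exact: df.
have [||r rs E] := @MVT_segment _ g (fun r => 'D_v f (p + r *: v)) 0 s s0.
- by move=> r /subset_itv_oo_cc rs; apply: dg; rewrite in_itv in rs.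
- by apply: derivable_within_continuous => r; rewrite in_itv => /dg[].
- by exists r; [rewrite in_itv in rs|rewrite -/(g s) -g0 E subr0 mulrC].
Qed.

Lemma MVT_line f p v (s : R) :
  (forall r : R, `|r| <= `|s| -> derivable f (p + r *: v) v) ->
  exists2 r : R, `|r| <= `|s| & f (p + s *: v) - f p = s * 'D_v f (p + r *: v).
Proof.
move=> df; have [s0|s0] := leP 0 s.
  have le (r : R) : 0 <= r <= s -> `|r| <= `|s|.
    by move=> /andP[r0 rs]; rewrite !ger0_norm.
  have [r /le rs E] := MVT_segment_line s0 (fun r rs => df r (le r rs)).
  by exists r.
have le (r : R) : 0 <= r <= - s -> `|s + r| <= `|s|.
  move=> /andP[r0 rs]; rewrite !ler0_norm ?lerN2 ?lerDl // ?(ltW s0) //.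
  by rewrite -lerBrDl sub0r.
have Ns0 : 0 <= - s by rewrite oppr_ge0 ltW.
have e (r : R) : p + s *: v + r *: v = p + (s + r) *: v.
  by rewrite scalerDl addrA.
(* For negative [s] the forward version is applied from the other endpoint. *)
have [|r /le rs] := @MVT_segment_line f (p + s *: v) v _ Ns0.
  by move=> r /le/df; rewrite e.
rewrite !e subrr scale0r addr0 => E; exists (s + r) => //.
by rewrite -opprB E mulNr opprK.
Qed.

Lemma coord_norm_le (v : 'rV[R]_n) (a : 'I_n) : `|v 0 a| <= `|v|.
Proof.
rewrite [leRHS]/Num.norm /= mx_normrE.
exact: (le_bigmax _ (fun i : 'I_1 * 'I_n => `|v i.1 i.2|) (0, a)).
Qed.

Lemma rV_norm_le (v : 'rV[R]_n) (e : R) :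
  0 <= e -> (forall a, `|v 0 a| <= e) -> `|v| <= e.
Proof.
move=> e0 ve; rewrite [leLHS]/Num.norm /= mx_normrE bigmax_le// => -[i j] _ /=.
by rewrite ord1.
Qed.

End PartialDerivatives.

(** * Continuous partial derivatives imply differentiability *)

Definition dotr (R : realType) n (w v : 'rV[R]_n) : R := \sum_a v 0 a * w 0 a.

Lemma dotr_is_linear (R : realType) n (w : 'rV[R]_n) : linear (dotr w).
Proof.
move=> k u v; rewrite /dotr scaler_sumr -big_split /=.
by apply: eq_bigr => a _; rewrite !mxE mulrDl -mulrA.
Qed.

HB.instance Definition _ (R : realType) n (w : 'rV[R]_n) :=
  GRing.isLinear.Build R 'rV[R]_n R _ (dotr w) (dotr_is_linear w).

Section C1.
Context {R : realType} {n : nat}.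
Implicit Types (f g : 'rV[R]_n -> R) (U V : set 'rV[R]_n) (u v p : 'rV[R]_n).

Lemma dotr_norm_le (w v : 'rV[R]_n) (e : R) :
  (forall a, `|w 0 a| <= e) -> `|dotr w v| <= n%:R * e * `|v|.
Proof.
move=> we; apply: le_trans (ler_norm_sum _ _ _) _.
apply: (@le_trans _ _ (\sum_(a < n) e * `|v|)).
  apply: ler_sum => a _; rewrite normrM mulrC ler_pM //.
  exact: coord_norm_le.
by rewrite sumr_const card_ord -mulrA mulr_natl.
Qed.

Lemma dotr_continuous (w : 'rV[R]_n) : continuous (dotr w).
Proof.
apply: continuous_big => [|a _ v]; first exact: add_continuous.
apply: (@continuousM R _ (fun v : 'rV[R]_n => v 0 a)); last exact: cst_continuous.
exact: coord_continuous.
Qed.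

(* Path from [0] to [h] along the coordinate axes. *)
Let trunc (h : 'rV[R]_n) (k : nat) : 'rV[R]_n :=
  \row_j (if (j < k)%N then h 0 j else 0).

(** The increment is telescoped over the edges of the axis-parallel path and each edge is treated by
    the mean value theorem. The path stays within distance [r] of [u] because truncating a vector
    does not increase its sup norm. *)
Lemma C1_remainder f u (r e : R) (h : 'rV[R]_n) :
  0 <= e ->
  (forall a v, `|v - u| <= r -> derivable f v (delta_mx 0 a)) ->
  (forall a v, `|v - u| <= r -> `|pd a f v - pd a f u| <= e) ->
  `|h| <= r ->
  `|f (u + h) - f u - dotr (dif f u) h| <= n%:R * e * `|h|.
Proof.
move=> e0 df cf hr.
have t0 : trunc h 0 = 0 by apply/rowP => j; rewrite !mxE ltn0.
have tn : trunc h n = h by apply/rowP => j; rewrite !mxE ltn_ord.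
have tS (k : 'I_n) : trunc h k.+1 = trunc h k + h 0 k *: delta_mx 0 k.
  apply/rowP => j; rewrite !mxE ltnS leq_eqVlt eqxx /= -(inj_eq val_inj) /=.
  by case: ltngtP => // [||/val_inj ->]; rewrite ?mulr0 ?addr0 ?mulr1 ?add0r.
have near (k : 'I_n) (s : R) : `|s| <= `|h 0 k| ->
    `|u + trunc h k + s *: delta_mx 0 k - u| <= r.
  move=> sh; apply: le_trans hr; apply: rV_norm_le => // j.
  rewrite -(addrA u) (addrC u) addrK !mxE eqxx /= -(inj_eq val_inj) /=.
  case: ltngtP => // [jk|jk|jk].
  - by rewrite mulr0 addr0; exact: coord_norm_le.
  - by rewrite mulr0 addr0 normr0.
  - rewrite mulr1 add0r; apply: le_trans sh _; exact: coord_norm_le.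
have -> : f (u + h) - f u = \sum_(k < n) (f (u + trunc h k.+1) - f (u + trunc h k)).
  rewrite -(big_mkord xpredT (fun k => f (u + trunc h k.+1) - f (u + trunc h k))).
  by rewrite telescope_sumr// tn t0 addr0.
rewrite /dotr -sumrB; apply: le_trans (ler_norm_sum _ _ _) _.
apply: (@le_trans _ _ (\sum_(a < n) e * `|h|)); last first.
  by rewrite sumr_const card_ord -mulrA mulr_natl.
apply: ler_sum => k _.
have [s sh] := @MVT_line R n f (u + trunc h k) (delta_mx 0 k) (h 0 k)
  (fun s sh => df k _ (near k s sh)).
rewrite tS addrA => ->; rewrite mxE -mulrBr normrM mulrC ler_pM //.
  by apply: cf; exact: near.
exact: coord_norm_le.
Qed.

Lemma C1_diff f u :
  (forall a, \forall v \near u, derivable f v (delta_mx 0 a)) ->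
  (forall a, {for u, continuous (pd a f)}) ->
  is_diff u f (dotr (dif f u)).
Proof.
move=> df cf.
have H : f \o shift u =
    (cst (f u) : _ -> R^o) + (dotr (dif f u) : _ -> R^o) +o_ (0 : 'rV[R]_n) id.
  apply/eqaddoP => _/posnumP[e].
  (* Dividing by [n + 1] rather than [n] keeps [e'] positive when [n = 0]. *)
  pose e' := e%:num / (n%:R + 1).
  have e'0 : 0 < e' by rewrite divr_gt0 // ltr_wpDl.
  have : \forall v \near u, (forall a, derivable f v (delta_mx 0 a)) /\
      (forall a, `|pd a f v - pd a f u| <= e').
    near=> v; split; near: v; first exact: filter_forall.
    apply: filter_forall => a.
    have /cvgrPdist_le/(_ _ e'0) := cf a.
    by apply: filterS => v; rewrite distrC.
  case/nbhs_normP => r /= r0 Hr.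
  apply/(@nbhs_normP R 'rV[R]_n); exists (r/2) => /=; first by rewrite divr_gt0.
  move=> h /=; rewrite sub0r normrN => hr.
  have inr v : `|v - u| <= r / 2 -> ball_ Num.norm u r v.
    move=> vr; rewrite /ball_/= distrC; apply: le_lt_trans vr _.
    by rewrite ltr_pdivrMr // ltr_pMr // ltrDl.
  have := @C1_remainder f u (r/2) e' h (ltW e'0).
  rewrite -[(f \o shift u - _) h]/(f (h + u) - (f u + dotr (dif f u) h)).
  rewrite opprD addrA [h + u]addrC => /(_ _ _ (ltW hr)) E.
  apply: le_trans (E _ _) _ => [a v /inr/Hr[]//|a v /inr/Hr[]//|].
  apply: ler_wpM2r => //; rewrite /e' mulrCA ger_pMr //.
  by rewrite ler_pdivrMr ?mul1r ?lerDl // ltr_wpDl.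
have D := diff_unique (@dotr_continuous (dif f u)) H.
split; last by rewrite D.
by apply/diff_locallyP; rewrite D; split => //; exact: dotr_continuous.
Unshelve. all: by end_near. Qed.

Lemma smooth_diff U f u : open U -> smooth_on U f -> U u ->
  is_diff u f (dotr (dif f u)).
Proof.
move=> oU sf Uu; apply: C1_diff => a.
  apply: filterS (open_nbhs_nbhs (conj oU Uu)) => v Uv.
  exact: smooth_derivable sf Uv.
exact: smooth_continuous (smooth_pd _ sf) Uu.
Qed.

Lemma smooth_differentiable U f u : open U -> smooth_on U f -> U u ->
  differentiable f u.
Proof. by move=> oU sf Uu; case: (smooth_diff oU sf Uu). Qed.

Lemma derive_dotr f u v : differentiable f u ->
  'D_v f u = \sum_a v 0 a * pd a f u.
Proof.
move=> df; rewrite deriveE // {1}(row_sum_delta v) linear_sum /=.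
by apply: eq_bigr => a _; rewrite linearZ /= -deriveE.
Qed.

End C1.

(** * Chain rule *)

Section ChainRule.
Context {R : realType}.

Lemma differentiable_rV (n m : nat) (tau : 'rV[R]_n -> 'rV[R]_m) u :
  (forall b, differentiable (fun v => tau v 0 b) u) -> differentiable tau u.
Proof.
move=> dt.
have -> : tau = \sum_(b < m) (fun v => tau v 0 b *: (delta_mx 0 b : 'rV[R]_m)).
  by apply/funext => v; rewrite fct_sumE [LHS]row_sum_delta.
apply: differentiable_sum => b.
exact: (@differentiableZl R 'rV[R]_n 'rV[R]_m (fun v => tau v 0 b)).
Qed.

Lemma derive_rV (n m : nat) (tau : 'rV[R]_n -> 'rV[R]_m) u v :
  differentiable tau u ->
  'D_v tau u = \row_b 'D_v (fun w => tau w 0 b) u.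
Proof.
move=> dt; rewrite derive_mx; last exact: diff_derivable.
by apply/rowP => b; rewrite !mxE.
Qed.

Lemma derive_comp_rV (n m : nat) (tau : 'rV[R]_n -> 'rV[R]_m)
    (f : 'rV[R]_m -> R) u v :
  (forall b, differentiable (fun v => tau v 0 b) u) ->
  differentiable f (tau u) ->
  differentiable (fun w => f (tau w)) u /\
  'D_v (fun w => f (tau w)) u =
    \sum_b pd b f (tau u) * 'D_v (fun w => tau w 0 b) u.
Proof.
move=> /differentiable_rV dt df.
have dc : differentiable (f \o tau) u by exact: differentiable_comp.
split; first exact: dc.
rewrite -[LHS]/('D_v (f \o tau) u) deriveE // diff_comp //= -(deriveE v dt).
rewrite -deriveE // derive_dotr // derive_rV //.
by apply: eq_bigr => b _; rewrite mxE mulrC.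
Qed.

Lemma derive_comp_R (V : normedModType R) (phi : R -> R) (f : V -> R) (d : R)
    (u v : V) :
  differentiable f u -> is_derive (f u) 1 phi d ->
  differentiable (fun w => phi (f w)) u /\
  'D_v (fun w => phi (f w)) u = d * 'D_v f u.
Proof.
move=> df dphi.
have dp : differentiable phi (f u) by apply/derivable1_diffP; case: dphi.
have dc : differentiable (phi \o f) u by exact: differentiable_comp.
split; first exact: dc.
rewrite -[LHS]/('D_v (phi \o f) u) deriveE // diff_comp //= -(deriveE v df).
by rewrite diff1E // derive1E derive_val -[LHS]/(_ * _) mulrC.
Qed.

End ChainRule.

(** * Stability of smoothness under elementary operations and composition *)

Section SmoothClosure.
Context {R : realType} {n : nat}.
Implicit Types (f g : 'rV[R]_n -> R) (U : set 'rV[R]_n).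

Lemma smooth_cst U (c : R) : open U -> smooth_on U (fun _ : 'rV[R]_n => c).
Proof.
move=> oU; apply: (@smooth_coind _ _ _ (fun f => exists c, f = fun=> c)) => //.
- move=> _ u [d ->] Uu; split; first exact: cst_continuous.
  by move=> a; exact: derivable_cst.
- move=> _ a [d ->]; exists (fun=> 0); first by exists 0.
  by move=> u _; exact: derive_cst.
- by exists c.
Qed.

Lemma derive_coord (u v : 'rV[R]_n) (b : 'I_n) :
  'D_v (fun w : 'rV[R]_n => w 0 b) u = v 0 b.
Proof.
have := @derive_rV R n n id u v; rewrite derive_id => /(_ _)/rowP/(_ b).
by rewrite mxE => <- //; exact: ex_diff.
Qed.

Lemma smooth_coord U (b : 'I_n) : open U -> smooth_on U (fun u => u 0 b).
Proof.
move=> oU; apply: (@smooth_coind _ _ _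
  (fun f => (f = fun u => u 0 b) \/ exists c, f = fun=> c)) => //.
- move=> _ u [|[d]] -> Uu; split.
  + exact: coord_continuous.
  + by move=> a; apply: diff_derivable; exact: differentiable_coord.
  + exact: cst_continuous.
  + by move=> a; exact: derivable_cst.
- move=> _ a [|[d]] ->.
    exists (fun=> (delta_mx 0 a : 'rV[R]_n) 0 b); first by right; eexists.
    by move=> u _; exact: derive_coord.
  exists (fun=> 0); first by right; exists 0.
  by move=> u _; exact: derive_cst.
- by left.
Qed.

(* Closed under [pd] on [U]: this proves smoothness of composite expressions by
   [smooth_coind]. *)
Inductive smooth_expr U : ('rV[R]_n -> R) -> Prop :=
| SmoothBase f : smooth_on U f -> smooth_expr U f
| SmoothAdd f g : smooth_expr U f -> smooth_expr U g ->
    smooth_expr U (fun u => f u + g u)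
| SmoothMul f g : smooth_expr U f -> smooth_expr U g ->
    smooth_expr U (fun u => f u * g u)
| SmoothInv f : smooth_expr U f -> (forall u, U u -> f u != 0) ->
    smooth_expr U (fun u => (f u)^-1)
| SmoothSqrt f : smooth_expr U f -> (forall u, U u -> 0 < f u) ->
    smooth_expr U (fun u => Num.sqrt (f u))
| SmoothLn f : smooth_expr U f -> (forall u, U u -> 0 < f u) ->
    smooth_expr U (fun u => ln (f u))
| SmoothCos f : smooth_expr U f -> smooth_expr U (fun u => cos (f u))
| SmoothSin f : smooth_expr U f -> smooth_expr U (fun u => sin (f u))
| SmoothComp m (V : set 'rV[R]_m) (tau : 'rV[R]_n -> 'rV[R]_m)
    (f : 'rV[R]_m -> R) :
    open V -> smooth_on V f -> (forall u, U u -> V (tau u)) ->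
    (forall b, smooth_expr U (fun u => tau u 0 b)) ->
    smooth_expr U (fun u => f (tau u)).

Lemma smooth_expr_cst U c : open U -> smooth_expr U (fun=> c).
Proof. by move=> oU; apply: SmoothBase; exact: smooth_cst. Qed.

Lemma smooth_expr_sum U (I : Type) (r : seq I) (F : I -> 'rV[R]_n -> R) :
  open U -> (forall i, smooth_expr U (F i)) ->
  smooth_expr U (fun u => \sum_(i <- r) F i u).
Proof.
move=> oU sF; elim: r => [|i r IH].
  under eq_fun do rewrite big_nil.
  exact: smooth_expr_cst.
under eq_fun do rewrite big_cons.
exact: SmoothAdd.
Qed.

(** Full differentiability is carried through the induction because the chain rule needs it. A
    partial derivative only has to agree on [U] with another expression, as [smooth_coind]
    allows. *)
Let good U f := (forall u, U u -> differentiable f u) /\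
  forall a, exists2 g, smooth_expr U g & forall u, U u -> pd a f u = g u.

Let good_comp U (phi dphi : R -> R) f : open U -> smooth_expr U f ->
  (forall u, U u -> is_derive (f u) 1 phi (dphi (f u))) ->
  smooth_expr U (fun u => dphi (f u)) ->
  good U f -> good U (fun u => phi (f u)).
Proof.
move=> oU sf dP sd [df pf]; split.
  by move=> u Uu; have [] := derive_comp_R 0 (df u Uu) (dP u Uu).
move=> a; have [g sg fg] := pf a.
exists (fun u => dphi (f u) * g u); first exact: SmoothMul.
move=> u Uu; rewrite -fg //.
by have [] := derive_comp_R (delta_mx 0 a) (df u Uu) (dP u Uu).
Qed.

Let good_expr U f : open U -> smooth_expr U f -> good U f.
Proof.
move=> oU; elim=> {f}.
- move=> f sf; split; first by move=> u; exact: smooth_differentiable.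
  by move=> a; exists (pd a f) => //; apply: SmoothBase; exact: smooth_pd.
- move=> f g sf [df pf] sg [dg pg]; split=> [u Uu|a].
    exact: differentiableD (df u Uu) (dg u Uu).
  have [f' sf' ff'] := pf a; have [g' sg' gg'] := pg a.
  exists (fun u => f' u + g' u); first exact: SmoothAdd.
  move=> u Uu; rewrite -ff' // -gg' //.
  apply: deriveD; apply: diff_derivable; [exact: df|exact: dg].
- move=> f g sf [df pf] sg [dg pg]; split=> [u Uu|a].
    exact: differentiableM (df u Uu) (dg u Uu).
  have [f' sf' ff'] := pf a; have [g' sg' gg'] := pg a.
  exists (fun u => f u * g' u + g u * f' u).
    by apply: SmoothAdd; exact: SmoothMul.
  move=> u Uu; rewrite -ff' // -gg' //.
  apply: deriveM; apply: diff_derivable; [exact: df|exact: dg].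
- move=> f sf gf f0.
  apply: (@good_comp U (fun x => x^-1) (fun x => - (x^-1 * x^-1))) => //.
  + move=> u Uu; split.
      exact: (@derivableV R _ id (f u) 1 (f0 u Uu)).
    rewrite (@deriveV R _ id (f u) 1 (f0 u Uu)) // derive_id.
    by rewrite -[_ *: _]/(_ * _) mulr1 -exprVn expr2.
  + have -> : (fun u => - ((f u)^-1 * (f u)^-1)) =
              (fun u => (-1) * ((f u)^-1 * (f u)^-1)).
      by apply/funext => u; rewrite mulN1r.
    apply: SmoothMul; first exact: smooth_expr_cst.
    by apply: SmoothMul; exact: SmoothInv.
- move=> f sf gf f0.
  apply: (@good_comp U Num.sqrt (fun x => (2 * Num.sqrt x)^-1)) => //.
  + by move=> u Uu; apply: is_derive1_sqrt; exact: f0.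
  + apply: SmoothInv.
      apply: SmoothMul; first exact: smooth_expr_cst.
      exact: SmoothSqrt.
    by move=> u Uu; rewrite mulf_neq0 ?pnatr_eq0 // gt_eqF // sqrtr_gt0 f0.
- move=> f sf gf f0.
  apply: (@good_comp U (@ln R) (fun x => x^-1)) => //.
  + by move=> u Uu; apply: is_derive1_ln; exact: f0.
  + by apply: SmoothInv => // u Uu; rewrite gt_eqF // f0.
- move=> f sf gf.
  apply: (@good_comp U (@cos R) (fun x => - sin x)) => //.
  have -> : (fun u => - sin (f u)) = (fun u => (-1) * sin (f u)).
    by apply/funext => u; rewrite mulN1r.
  by apply: SmoothMul; [exact: smooth_expr_cst|exact: SmoothSin].
- move=> f sf gf.
  apply: (@good_comp U (@sin R) (@cos R)) => //.
  exact: SmoothCos.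
- move=> m V tau f oV sf UV st gt.
  have dt u : U u -> forall b, differentiable (fun v => tau v 0 b) u.
    by move=> Uu b; have [+ _] := gt b; apply.
  have df u : U u -> differentiable f (tau u).
    by move=> Uu; apply: smooth_differentiable oV sf (UV u Uu).
  split=> [u Uu|a].
    by have [] := derive_comp_rV 0 (dt u Uu) (df u Uu).
  have /choice[g gP] : forall b, exists g,
      smooth_expr U g /\ forall u, U u -> pd a (fun v => tau v 0 b) u = g u.
    by move=> b; have [_ /(_ a)[g]] := gt b; exists g.
  exists (fun u => \sum_b pd b f (tau u) * g b u).
    apply: smooth_expr_sum => // b; apply: SmoothMul; last by have [] := gP b.
    by apply: SmoothComp oV _ UV st; exact: smooth_pd.
  move=> u Uu; rewrite /pd.
  have [_ ->] := derive_comp_rV (delta_mx 0 a) (dt u Uu) (df u Uu).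
  by apply: eq_bigr => b _; have [_ <-] := gP b.
Qed.

Lemma smooth_exprP U f : open U -> smooth_expr U f -> smooth_on U f.
Proof.
move=> oU; apply: smooth_coind => // {}f => [u sf Uu|a sf].
  have [df _] := good_expr oU sf.
  split=> [|a]; last by apply: diff_derivable; exact: df.
  by apply: differentiable_continuous; exact: df.
by have [_] := good_expr oU sf.
Qed.

End SmoothClosure.

(** * Rules for partial derivatives and symmetry of second derivatives *)

Section PartialRules.
Context {R : realType} {n : nat}.
Implicit Types (f g : 'rV[R]_n -> R) (U : set 'rV[R]_n) (u : 'rV[R]_n).

Lemma pd_cst (a : 'I_n) (c : R) u : pd a (fun=> c) u = 0.
Proof. exact: derive_cst. Qed.

Lemma pdD (a : 'I_n) f g u :
  derivable f u (delta_mx 0 a) -> derivable g u (delta_mx 0 a) ->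
  pd a (fun v => f v + g v) u = pd a f u + pd a g u.
Proof. exact: deriveD. Qed.

Lemma pdB (a : 'I_n) f g u :
  derivable f u (delta_mx 0 a) -> derivable g u (delta_mx 0 a) ->
  pd a (fun v => f v - g v) u = pd a f u - pd a g u.
Proof. exact: deriveB. Qed.

Lemma pdN (a : 'I_n) f u :
  derivable f u (delta_mx 0 a) -> pd a (fun v => - f v) u = - pd a f u.
Proof. exact: deriveN. Qed.

Lemma pdM (a : 'I_n) f g u :
  derivable f u (delta_mx 0 a) -> derivable g u (delta_mx 0 a) ->
  pd a (fun v => f v * g v) u = pd a f u * g u + f u * pd a g u.
Proof.
move=> df dg; rewrite /pd (deriveM df dg) addrC.
by congr (_ + _); rewrite -[LHS]/(_ * _) mulrC.
Qed.

Lemma pdZ (a : 'I_n) (c : R) f u :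
  derivable f u (delta_mx 0 a) -> pd a (fun v => c * f v) u = c * pd a f u.
Proof.
move=> df; rewrite pdM; [|exact: derivable_cst|exact: df].
by rewrite pd_cst mul0r add0r.
Qed.

Lemma pdV (a : 'I_n) f u : f u != 0 ->
  derivable f u (delta_mx 0 a) ->
  pd a (fun v => (f v)^-1) u = - (pd a f u / f u ^+ 2).
Proof.
move=> f0 df; rewrite /pd (deriveV f0 df).
by rewrite -[LHS]/(_ * _) mulNr mulrC.
Qed.

Lemma pd_sum (a : 'I_n) (m : nat) (f : 'I_m -> 'rV[R]_n -> R) u :
  (forall i, derivable (f i) u (delta_mx 0 a)) ->
  pd a (fun v => \sum_i f i v) u = \sum_i pd a (f i) u.
Proof.
move=> df; rewrite -(derive_sum df).
by rewrite /pd; congr (derive _ _ _); apply/funext => v; rewrite fct_sumE.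
Qed.

Lemma pd_comp1 (a : 'I_n) (phi : R -> R) f (d : R) u :
  differentiable f u -> is_derive (f u) 1 phi d ->
  pd a (fun v => phi (f v)) u = d * pd a f u.
Proof. by move=> df dp; have [] := derive_comp_R (delta_mx 0 a) df dp. Qed.

Lemma pd_shift (a : 'I_n) f u c : pd a (fun v => f (v + c)) u = pd a f (u + c).
Proof.
rewrite /pd /derive.
set F := (X in X @ _); set G := (X in _ = lim (X @ _)).
by have -> : F = G by apply/funext => h; rewrite /F /G /= addrA.
Qed.

Lemma derivable_shift f u c v :
  derivable f (u + c) v -> derivable (fun w => f (w + c)) u v.
Proof.
rewrite /derivable.
set F := (X in X @ _); set G := (X in _ -> cvg (X @ _)).
by have -> : F = G by apply/funext => h; rewrite /F /G /= addrA.
Qed.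

(** Mean value theorem applied twice: along [a] to the increment [phi] of [f] in direction [b], then
    along [b] to [pd a f]. *)
Lemma double_difference U f u (a b : 'I_n) (s : R) : smooth_on U f ->
  (forall x y : R, `|x| <= `|s| -> `|y| <= `|s| ->
     U (u + x *: delta_mx 0 a + y *: delta_mx 0 b)) ->
  exists x y : R, [/\ `|x| <= `|s|, `|y| <= `|s| &
    f (u + s *: delta_mx 0 a + s *: delta_mx 0 b) - f (u + s *: delta_mx 0 a)
    - (f (u + s *: delta_mx 0 b) - f u) =
    s * (s * pd b (pd a f) (u + x *: delta_mx 0 a + y *: delta_mx 0 b))].
Proof.
move=> sf Us; pose phi p := f (p + s *: delta_mx 0 b) - f p.
have Us0 (x : R) : `|x| <= `|s| -> U (u + x *: delta_mx 0 a).
  by move=> xs; have := Us x 0 xs; rewrite normr0 scale0r addr0; apply.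
have d1 (x : R) : `|x| <= `|s| ->
    derivable (fun p => f (p + s *: delta_mx 0 b)) (u + x *: delta_mx 0 a)
      (delta_mx 0 a).
  move=> xs; apply: derivable_shift; apply: smooth_derivable sf _; exact: Us.
have d0 (x : R) : `|x| <= `|s| ->
    derivable f (u + x *: delta_mx 0 a) (delta_mx 0 a).
  by move=> xs; apply: smooth_derivable sf _; exact: Us0.
have [x xs E] := @MVT_line _ _ phi u (delta_mx 0 a) s
  (fun x xs => derivableB (d1 x xs) (d0 x xs)).
have [y ys E'] := @MVT_line _ _ (pd a f) (u + x *: delta_mx 0 a) (delta_mx 0 b) s
  (fun y ys => smooth_derivable (smooth_pd a sf) (Us x y xs ys)).
exists x, y; split => //; rewrite -[LHS]/(phi (u + s *: delta_mx 0 a) - phi u) E.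
congr (_ * _); rewrite -E'.
rewrite -[LHS]/(pd a phi _) pdB; [|exact: d1|exact: d0].
by rewrite pd_shift.
Qed.

(** Schwarz's theorem: the double difference is symmetric in [a] and [b], so the two mixed
    derivatives share a value at two points near [u], and both are continuous at [u]. *)
Lemma pd_pd_comm U f u (a b : 'I_n) : open U -> smooth_on U f -> U u ->
  pd a (pd b f) u = pd b (pd a f) u.
Proof.
move=> oU sf Uu; apply/eqP; rewrite -subr_eq0 -normr_eq0 eq_le normr_ge0 andbT.
apply/ler_addgt0Pl => e e0; rewrite addr0.
have e20 : 0 < e / 2 by rewrite divr_gt0.
have cX c d : \forall v \near u, `|pd c (pd d f) u - pd c (pd d f) v| <= e / 2.
  have /cvgrPdist_le/(_ _ e20) := smooth_continuous (smooth_pd c (smooth_pd d sf)) Uu.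
  exact.
have NU := open_nbhs_nbhs (conj oU Uu).
have [r /= r0 Hr] :=
  (@nbhs_normP R 'rV[R]_n _ _).1 (filterI NU (filterI (cX a b) (cX b a))).
(* Two displacements of length at most [r / 3] stay strictly inside the ball of radius [r]. *)
pose s := r / 3; have s0 : 0 < s by rewrite divr_gt0.
have in_r c d (x y : R) : `|x| <= `|s| -> `|y| <= `|s| ->
    ball_ Num.norm u r (u + x *: delta_mx 0 c + y *: (delta_mx 0 d : 'rV[R]_n)).
  move=> xs ys; rewrite /ball_ /= -addrA opprD addNKr normrN.
  have nd i : `|delta_mx 0 i : 'rV[R]_n| <= 1.
    apply: rV_norm_le => // j; rewrite mxE.
    by case: (_ && _); rewrite ?normr1 ?normr0.
  rewrite (le_lt_trans (ler_normD _ _))// !normrZ.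
  apply: (@le_lt_trans _ _ (s * 1 + s * 1)).
    by rewrite -(gtr0_norm s0); apply: lerD; apply: ler_pM.
  by rewrite mulr1 /s; lra.
have [x [y [xs ys E]]] := double_difference (a := a) (b := b) sf
  (fun x y xs ys => (Hr _ (in_r a b x y xs ys)).1).
have [x' [y' [xs' ys' E']]] := double_difference (a := b) (b := a) sf
  (fun x y xs ys => (Hr _ (in_r b a x y xs ys)).1).
have EE : pd b (pd a f) (u + x *: delta_mx 0 a + y *: delta_mx 0 b)
    = pd a (pd b f) (u + x' *: delta_mx 0 b + y' *: delta_mx 0 a).
  have sn0 : s != 0 by rewrite gt_eqF.
  apply: (mulfI sn0); apply: (mulfI sn0).
  refine (etrans (esym E) (etrans _ E')); rewrite (addrAC u).
  by rewrite !opprB [LHS]addrACA [RHS]addrACA [X in _ + X = _]addrC.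
have [_ [_ h1]] := Hr _ (in_r a b x y xs ys).
have [_ [h2 _]] := Hr _ (in_r b a x' y' xs' ys').
rewrite (splitr e); apply: le_trans (lerD h2 h1).
rewrite EE [X in _ <= _ + X]distrC.
by apply: le_trans (ler_normD _ _); rewrite subrKA.
Qed.

End PartialRules.

(** * Smooth functions, matrices and Jacobians *)

Section SmoothOps.
Context {R : realType} {n : nat}.
Implicit Types (f g : 'rV[R]_n -> R) (U : set 'rV[R]_n) (u : 'rV[R]_n).

Lemma smoothD U f g : open U -> smooth_on U f -> smooth_on U g ->
  smooth_on U (fun u => f u + g u).
Proof.
by move=> oU sf sg; apply: smooth_exprP => //; apply: SmoothAdd; exact: SmoothBase.
Qed.

Lemma smoothM U f g : open U -> smooth_on U f -> smooth_on U g ->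
  smooth_on U (fun u => f u * g u).
Proof.
by move=> oU sf sg; apply: smooth_exprP => //; apply: SmoothMul; exact: SmoothBase.
Qed.

Lemma smoothN U f : open U -> smooth_on U f -> smooth_on U (fun u => - f u).
Proof.
move=> oU sf; under eq_fun do rewrite -mulN1r.
exact: smoothM oU (smooth_cst _ oU) sf.
Qed.

Lemma smoothB U f g : open U -> smooth_on U f -> smooth_on U g ->
  smooth_on U (fun u => f u - g u).
Proof. by move=> oU sf sg; exact: smoothD oU sf (smoothN oU sg). Qed.

Lemma smoothZ U (c : R) f : open U -> smooth_on U f ->
  smooth_on U (fun u => c * f u).
Proof. by move=> oU sf; exact: smoothM oU (smooth_cst _ oU) sf. Qed.

Lemma smoothV U f : open U -> smooth_on U f -> (forall u, U u -> f u != 0) ->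
  smooth_on U (fun u => (f u)^-1).
Proof.
by move=> oU sf f0; apply: smooth_exprP => //; apply: SmoothInv => //; exact: SmoothBase.
Qed.

Lemma smooth_sqrt U f : open U -> smooth_on U f -> (forall u, U u -> 0 < f u) ->
  smooth_on U (fun u => Num.sqrt (f u)).
Proof.
by move=> oU sf f0; apply: smooth_exprP => //; apply: SmoothSqrt => //; exact: SmoothBase.
Qed.

Lemma smooth_ln U f : open U -> smooth_on U f -> (forall u, U u -> 0 < f u) ->
  smooth_on U (fun u => ln (f u)).
Proof.
by move=> oU sf f0; apply: smooth_exprP => //; apply: SmoothLn => //; exact: SmoothBase.
Qed.

Lemma smooth_cos U f : open U -> smooth_on U f -> smooth_on U (fun u => cos (f u)).
Proof.
by move=> oU sf; apply: smooth_exprP => //; apply: SmoothCos => //; exact: SmoothBase.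
Qed.

Lemma smooth_sin U f : open U -> smooth_on U f -> smooth_on U (fun u => sin (f u)).
Proof.
by move=> oU sf; apply: smooth_exprP => //; apply: SmoothSin => //; exact: SmoothBase.
Qed.

Lemma smooth_sum U (I : Type) (r : seq I) (P : pred I) (F : I -> 'rV[R]_n -> R) :
  open U -> (forall i, smooth_on U (F i)) ->
  smooth_on U (fun u => \sum_(i <- r | P i) F i u).
Proof.
move=> oU sF; elim: r => [|i r IH].
  under eq_fun do rewrite big_nil.
  exact: smooth_cst.
under eq_fun do rewrite big_cons.
by case: (P i); [exact: smoothD oU (sF i) IH|exact: IH].
Qed.

Lemma smooth_prod U (I : Type) (r : seq I) (P : pred I) (F : I -> 'rV[R]_n -> R) :
  open U -> (forall i, smooth_on U (F i)) ->
  smooth_on U (fun u => \prod_(i <- r | P i) F i u).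
Proof.
move=> oU sF; elim: r => [|i r IH].
  under eq_fun do rewrite big_nil.
  exact: smooth_cst.
under eq_fun do rewrite big_cons.
by case: (P i); [exact: smoothM oU (sF i) IH|exact: IH].
Qed.

Lemma smooth_comp (m : nat) U (V : set 'rV[R]_m) (tau : 'rV[R]_n -> 'rV[R]_m)
    (f : 'rV[R]_m -> R) :
  open U -> open V -> smooth_on V f -> (forall u, U u -> V (tau u)) ->
  smooth_mx_on U tau -> smooth_on U (fun u => f (tau u)).
Proof.
move=> oU oV sf UV st; apply: smooth_exprP => //.
by apply: (SmoothComp oV sf UV) => b; apply: SmoothBase; exact: st.
Qed.

Lemma smooth_det (m : nat) U (B : 'rV[R]_n -> 'M[R]_m) :
  open U -> smooth_mx_on U B -> smooth_on U (fun u => \det (B u)).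
Proof.
move=> oU sB; apply: smooth_sum => // s; apply: smoothZ => //.
by apply: smooth_prod => // i; exact: sB.
Qed.

Lemma smooth_invmx (m : nat) U (B : 'rV[R]_n -> 'M[R]_m) :
  open U -> smooth_mx_on U B -> (forall u, U u -> B u \in unitmx) ->
  smooth_mx_on U (fun u => invmx (B u)).
Proof.
move=> oU sB uB i j.
apply: (@smooth_eq_on _ _ _ (fun u => (\det (B u))^-1 * cofactor (B u) j i)) => //.
  by move=> u Uu; rewrite /invmx uB // !mxE.
apply: smoothM => //.
  apply: smoothV => //; first exact: smooth_det.
  by move=> u /uB; rewrite unitmxE unitfE.
rewrite /cofactor; apply: smoothZ => //; apply: smooth_det => // k l.
by under eq_fun do rewrite !mxE; exact: sB.
Qed.

Lemma smooth_mulmx (m p q : nat) U (A : 'rV[R]_n -> 'M[R]_(m, p))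
    (B : 'rV[R]_n -> 'M[R]_(p, q)) :
  open U -> smooth_mx_on U A -> smooth_mx_on U B ->
  smooth_mx_on U (fun u => A u *m B u).
Proof.
move=> oU sA sB i j; under eq_fun do rewrite mxE.
by apply: smooth_sum => // k; apply: smoothM; [|exact: sA|exact: sB].
Qed.

Lemma smooth_mx_differentiable (m : nat) U (tau : 'rV[R]_n -> 'rV[R]_m) u :
  open U -> smooth_mx_on U tau -> U u -> differentiable tau u.
Proof.
move=> oU st Uu; apply: differentiable_rV => b.
exact: smooth_differentiable oU (st 0 b) Uu.
Qed.

Lemma jacobianE (m : nat) (tau : 'rV[R]_n -> 'rV[R]_m) u a b :
  differentiable tau u -> 'J tau u a b = pd a (fun v => tau v 0 b) u.
Proof.
move=> dt; have := deriveEjacobian (delta_mx 0 a) dt.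
by rewrite derive_rV // -rowE => /rowP/(_ b); rewrite !mxE.
Qed.

Lemma smooth_jacobian (m : nat) U (tau : 'rV[R]_n -> 'rV[R]_m) :
  open U -> smooth_mx_on U tau -> smooth_mx_on U (fun u => 'J tau u).
Proof.
move=> oU st a b.
apply: (@smooth_eq_on _ _ _ (pd a (fun v => tau v 0 b))) => //.
  move=> u Uu; rewrite jacobianE //; exact: smooth_mx_differentiable st Uu.
by apply: smooth_pd; exact: st.
Qed.

End SmoothOps.

(** Completeness lets row vectors enter Banach's fixed point theorem, on which the inverse function
    theorem rests. *)
HB.instance Definition _ (R : realType) (m n : nat) := Complete.on 'M[R]_(m, n).

(** * Norm estimates for linear and smooth maps *)

Section MatrixNorm.
Context {R : realType}.

Lemma mulmx_norm_le (m n : nat) (A : 'M[R]_(m, n)) :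
  exists2 K : R, 0 <= K & forall v : 'rV[R]_m, `|v *m A| <= K * `|v|.
Proof.
exists (\sum_i \sum_j `|A i j|).
  by apply: sumr_ge0 => i _; apply: sumr_ge0.
move=> v; apply: rV_norm_le.
  by apply: mulr_ge0 => //; apply: sumr_ge0 => i _; apply: sumr_ge0.
move=> j; rewrite mxE (le_trans (ler_norm_sum _ _ _))// mulr_suml.
apply: ler_sum => i _; rewrite normrM mulrC ler_pM // ?coord_norm_le //.
by rewrite (bigD1 j) //= lerDl sumr_ge0.
Qed.

Lemma diff_jacobian (m n : nat) (f : 'rV[R]_m -> 'rV[R]_n) x v :
  differentiable f x -> 'd f x v = v *m 'J f x.
Proof. by move=> df; rewrite -deriveE // deriveEjacobian. Qed.

Lemma jacobian_remainder (m n : nat) (f : 'rV[R]_m -> 'rV[R]_n) x (e : R) :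
  differentiable f x -> 0 < e ->
  \forall k \near (0 : 'rV[R]_m), `|f (x + k) - f x - k *m 'J f x| <= e * `|k|.
Proof.
move=> df e0; have := diff_locally df => /eqaddoP/(_ _ e0).
apply: filterS => k /=.
rewrite -[(f \o shift x - _) k]/(f (k + x) - (f x + 'd f x k)).
by rewrite opprD addrA [k + x]addrC diff_jacobian.
Qed.

(** Mean value theorem along the segment, component by component; the factor [m] appears because a
    linear form is bounded in the sup norm by the sum of its [m] coefficients. *)
Lemma rV_lipschitz (m n : nat) (f : 'rV[R]_m -> 'rV[R]_n) (U : set 'rV[R]_m)
    (e : R) (x y : 'rV[R]_m) :
  open U -> smooth_mx_on U f -> 0 <= e ->
  (forall t : R, 0 <= t <= 1 -> U (x + t *: (y - x))) ->
  (forall v, U v -> forall a b, `|pd a (fun w => f w 0 b) v| <= e) ->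
  `|f y - f x| <= m%:R * e * `|y - x|.
Proof.
move=> oU sf e0 Ut fe; apply: rV_norm_le => [|b].
  by rewrite !mulr_ge0.
pose g (w : 'rV[R]_m) : R := f w 0 b.
have dg (t : R) : 0 <= t <= 1 -> differentiable g (x + t *: (y - x)).
  by move=> /Ut Uv; exact: smooth_differentiable oU (sf 0 b) Uv.
have [t t01] := MVT_segment_line ler01
  (fun (t : R) t01 => @diff_derivable _ _ _ g _ (y - x) (dg t t01)).
rewrite scale1r (addrC x) subrK mul1r => E.
rewrite !mxE E derive_dotr; last exact: dg.
pose w := \row_a pd a g (x + t *: (y - x)).
have -> : \sum_a (y - x) 0 a * pd a g (x + t *: (y - x)) = dotr w (y - x).
  by apply: eq_bigr => a _; rewrite !mxE.
by apply: dotr_norm_le => a; rewrite mxE; apply: fe; exact: Ut.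
Qed.

End MatrixNorm.

(** * Inverse function theorem *)

Section InverseFunction.
Context {R : realType} {n : nat}.
Variables (U : set 'rV[R]_n) (f : 'rV[R]_n -> 'rV[R]_n) (u0 : 'rV[R]_n).
Hypotheses (oU : open U) (sf : smooth_mx_on U f) (Uu0 : U u0)
  (unitJ : 'J f u0 \in unitmx).

Let A := invmx ('J f u0).
(* Newton's iteration with frozen slope solves [f x = z] as a fixed point of
   [x |-> g x + z *m A]. *)
Let g x := x - f x *m A.

Let smooth_g : smooth_mx_on U g.
Proof.
move=> i b; rewrite ord1 /g; under eq_fun do rewrite !mxE.
apply: smoothB oU (smooth_coord b oU) _.
apply: smooth_sum => // k; apply: smoothM oU (sf 0 k) (smooth_cst _ oU).
Qed.

Let dg0 a b : pd a (fun x => g x 0 b) u0 = 0.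
Proof.
have df : differentiable f u0 by exact: smooth_mx_differentiable oU sf Uu0.
have dfk k : derivable (fun v => f v 0 k) u0 (delta_mx 0 a).
  exact: smooth_derivable (sf 0 k) Uu0.
rewrite /g; under eq_fun do rewrite !mxE.
rewrite pdB; last 2 first.
- exact: smooth_derivable (smooth_coord b oU) Uu0.
- exact: smooth_derivable (smooth_sum _ _ oU
    (fun k => smoothM oU (sf 0 k) (smooth_cst _ oU))) Uu0.
rewrite pd_sum; last first.
  by move=> k; apply: derivableM; [exact: dfk|exact: derivable_cst].
rewrite (eq_bigr (fun k => 'J f u0 a k * A k b)); last first.
  move=> k _; rewrite pdM; [|exact: dfk|exact: derivable_cst].
  by rewrite pd_cst mulr0 addr0 jacobianE.
have := mulmxV unitJ => /matrixP/(_ a b); rewrite !mxE => ->.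
by rewrite [pd _ _ _]derive_coord !mxE eqxx /= eq_sym subrr.
Qed.

(** The partial derivatives of [g] vanish at [u0], hence are small nearby. The bound
    [(2 * (n + 1))^-1] compensates the factor [n] of [rV_lipschitz] and makes [g] contract by
    [1/2]. *)
Let exists_radius : exists2 r : R, 0 < r & forall x, `|x - u0| <= r ->
  [/\ U x, 'J f x \in unitmx & forall a b,
      `|pd a (fun x => g x 0 b) x| <= (2 * (n%:R + 1))^-1].
Proof.
have e0 : 0 < (2 * (n%:R + 1))^-1 :> R by rewrite invr_gt0 mulr_gt0 // ltr_wpDl.
have NU := open_nbhs_nbhs (conj oU Uu0).
have ND : \forall x \near u0, \det ('J f x) != 0.
  have c : {for u0, continuous (fun x => \det ('J f x))}.
    exact: smooth_continuous (smooth_det oU (smooth_jacobian oU sf)) Uu0.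
  have d0 : \det ('J f u0) != 0 by rewrite -unitfE -unitmxE.
  exact: (cvgr_neq0 _ c d0).
have NG : \forall x \near u0, forall a b,
    `|pd a (fun x => g x 0 b) x| <= (2 * (n%:R + 1))^-1.
  suff H (ab : 'I_n * 'I_n) : \forall x \near u0,
      `|pd ab.1 (fun x => g x 0 ab.2) x| <= (2 * (n%:R + 1))^-1.
    by apply: filterS (filter_forall (nbhs_filter u0) H) => x Hx a b; exact: (Hx (a, b)).
  have /cvgrPdist_le/(_ _ e0) :=
    smooth_continuous (smooth_pd ab.1 (smooth_g 0 ab.2)) Uu0.
  by rewrite dg0; apply: filterS => x; rewrite sub0r normrN.
have [r /= r0 Hr] :=
  (@nbhs_normP R 'rV[R]_n _ _).1 (filterI NU (filterI ND NG)).
exists (r / 2); first by rewrite divr_gt0.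
move=> x xr; have [|Ux [Dx Gx]] := Hr x.
  rewrite /ball_ /= distrC; apply: le_lt_trans xr _.
  by rewrite ltr_pdivrMr // ltr_pMr // ltrDl.
split; [exact: Ux|by rewrite unitmxE unitfE|exact: Gx].
Qed.

Let g_contracts (r : R) x y :
  (forall x, `|x - u0| <= r -> [/\ U x, 'J f x \in unitmx & forall a b,
      `|pd a (fun x => g x 0 b) x| <= (2 * (n%:R + 1))^-1]) ->
  `|x - u0| < r -> `|y - u0| < r -> `|g y - g x| <= 2^-1 * `|y - x|.
Proof.
move=> Hr xr yr; pose B := ball u0 r.
have oB : open B by exact: ball_open.
have BE v : B v <-> `|v - u0| < r.
  by rewrite /B -ball_normE /ball_ /= distrC.
have BU : B `<=` U by move=> v /BE/ltW/Hr[H _ _]; exact: H.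
have := @rV_lipschitz R n n g B (2 * (n%:R + 1))^-1 x y oB
  (fun i j => smooth_sub BU (smooth_g i j)).
move=> /(_ _ _ _)/le_trans; apply.
- by rewrite invr_ge0 mulr_ge0 // addr_ge0.
- move=> t /andP[t0 t1]; apply/BE.
  have -> : x + t *: (y - x) - u0 = (1 - t) *: (x - u0) + t *: (y - u0).
    by apply/rowP => j; rewrite !mxE; ring.
  apply: le_lt_trans (ler_normD _ _) _; rewrite !normrZ.
  rewrite (ger0_norm t0) ger0_norm ?subr_ge0 //.
  have [->|tn0] := eqVneq t 0; first by rewrite mul0r subr0 mul1r addr0.
  have t_gt0 : 0 < t by rewrite lt_neqAle eq_sym tn0.
  have h1 : (1 - t) * `|x - u0| <= (1 - t) * r.
    by apply: ler_wpM2l (ltW xr); rewrite subr_ge0.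
  have h2 : t * `|y - u0| < t * r by rewrite ltr_pM2l.
  lra.
- by move=> v /BE/ltW/Hr[_ _ H]; exact: H.
apply: ler_wpM2r => //; rewrite invfM mulrCA ger_pMr //.
by rewrite ler_pdivrMr ?mul1r ?lerDl // ltr_wpDl.
Qed.

(** Existence of preimages comes from Banach's theorem, uniqueness and the Lipschitz bound of [f']
    from the contraction property of [g]. The derivative of [f'] then follows from that of [f], and
    smoothness by coinduction. *)
Lemma inverse_function : exists (W V : set 'rV[R]_n) (f' : 'rV[R]_n -> 'rV[R]_n),
  [/\ [/\ W u0, open W & W `<=` U], open V, smooth_mx_on V f',
      forall y, W y -> V (f y) /\ f' (f y) = y &
      forall z, V z -> W (f' z) /\ f (f' z) = z].
Proof.
have [r0 r0_gt0 Hr0] := exists_radius.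
(* Banach's theorem wants a closed set and the contraction estimate an open ball: the closed ball of
   radius [r] lies in the open ball of radius [r0]. *)
pose r := r0 / 2; have r_gt0 : 0 < r by rewrite divr_gt0.
have rr0 : r < r0 by rewrite ltr_pdivrMr // ltr_pMr // ltrDl.
have AK : A \in unitmx by rewrite unitmx_inv.
have uA (v : 'rV[R]_n) : v *m A = 0 -> v = 0.
  by move=> v0; rewrite -(mulmxK AK v) v0 mul0mx.
have gc x y : `|x - u0| <= r -> `|y - u0| <= r -> `|g y - g x| <= 2^-1 * `|y - x|.
  by move=> xr yr; apply: (g_contracts Hr0); exact: le_lt_trans rr0.
(* On the closed ball [g] moves away from [g u0] by at most [r / 2]; the other [r / 2] is what the
   translation by [(z - f u0) *m A] may use up, so that the iteration stays inside. *)
pose V := [set z : 'rV[R]_n | `|(z - f u0) *m A| < r / 2].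
pose W := [set x | `|x - u0| < r] `&` (f @^-1` V).
have [K K0 AN] := mulmx_norm_le A.
have oV : open V.
  rewrite openE => z Vz; pose d := r / 2 - `|(z - f u0) *m A|.
  have d0 : 0 < d by rewrite subr_gt0.
  have K1 : 0 < K + 1 by rewrite ltr_wpDl.
  apply/(@nbhs_normP R 'rV[R]_n); exists (d / (K + 1)) => /=.
    by rewrite divr_gt0.
  move=> y yz; rewrite /V /=.
  have -> : (y - f u0) *m A = (z - f u0) *m A - (z - y) *m A.
    by rewrite -mulmxBl; congr (_ *m _); apply/rowP => j; rewrite !mxE; ring.
  apply: le_lt_trans (ler_normB _ _) _; rewrite -ltrBrDl -/d.
  apply: le_lt_trans (AN _) _; rewrite /ball_ /= ltr_pdivlMr // in yz.
  apply: le_lt_trans yz; rewrite mulrC; apply: ler_wpM2l => //.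
  by rewrite lerDl.
have Ur x : `|x - u0| <= r -> U x.
  by move=> xr; have [|//] := Hr0 x; exact/ltW/(le_lt_trans xr).
have fcont x : U x -> {for x, continuous f}.
  move=> Ux; apply: differentiable_continuous.
  exact: smooth_mx_differentiable oU sf Ux.
have oW : open W.
  rewrite openE => x [xr Vx]; rewrite /interior; apply: filterI.
    have /cvgrPdist_lt := @cvg_id _ (nbhs x).
    have d0 : 0 < r - `|x - u0| by rewrite subr_gt0.
    move=> /(_ _ d0); apply: filterS => y yx /=.
    have -> : y - u0 = (x - u0) - (x - y)
      by apply/rowP => j; rewrite !mxE; ring.
    by apply: le_lt_trans (ler_normB _ _) _; rewrite -ltrBrDl.
  apply: (fcont x); first by apply: Ur; exact: ltW.
  exact: open_nbhs_nbhs.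
(* In [y - x = (g y - g x) + (f y - f x) *m A] the first term is absorbed, being at most half of the
   left side. *)
have inj x y : `|x - u0| <= r -> `|y - u0| <= r ->
    `|y - x| <= 2 * `|(f y - f x) *m A|.
  move=> xr yr; have := gc _ _ xr yr.
  have e : y - x = (g y - g x) + (f y - f x) *m A.
    by rewrite /g mulmxBl; apply/rowP => j; rewrite !mxE; ring.
  have := ler_normD (g y - g x) ((f y - f x) *m A); rewrite -e; lra.
have sol z : V z -> exists x, W x /\ f x = z.
  move=> Vz; pose B := closed_ball_ Num.norm u0 r.
  pose T x := g x + z *m A.
  have gu : g u0 + z *m A = u0 + (z - f u0) *m A.
    by rewrite /g mulmxBl; apply/rowP => j; rewrite !mxE; ring.
  have BE x : B x <-> `|x - u0| <= r by rewrite /B /closed_ball_ /= distrC.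
  have Tb x : B x -> `|T x - u0| < r.
    move=> /BE xr; have -> : T x - u0 = (g x - g u0) + (z - f u0) *m A.
      by rewrite -(addrK (z *m A) (g u0)) gu; apply/rowP => j; rewrite !mxE; ring.
    apply: le_lt_trans (ler_normD _ _) _.
    have h : `|u0 - u0| <= r by rewrite subrr normr0 ltW.
    have := gc _ _ h xr; move: Vz; rewrite /V /=; lra.
  have fT : set_fun B B T by move=> x Bx; apply/BE/ltW/Tb.
  pose T' : {fun B >-> B} := mkfun fT.
  have [||| p Bp pT] := @banach_fixed_point R 'rV[R]_n B T'.
  - have h2 : (0:R) <= 2^-1 by [].
    exists (NngNum h2); split => /=; first by rewrite invf_lt1 // ltrDl.
    move=> [x y] /= [/BE Bx /BE By].
    have -> : T x - T y = g x - g y by apply/rowP => j; rewrite /T !mxE; ring.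
    exact: gc.
  - exact: closed_closed_ball_.
  - by exists u0; apply/BE; rewrite subrr normr0 ltW.
  have fp : f p = z.
    apply/esym/eqP; rewrite -subr_eq0; apply/eqP/uA.
    have /eqP : p = p + (z - f p) *m A.
      by rewrite {1}pT /= /T /g mulmxBl; apply/rowP => j; rewrite !mxE; ring.
    by rewrite -[X in X == _]addr0 (inj_eq (@addrI _ p)) => /eqP <-.
  exists p; split; last exact: fp.
  split => /=; last by rewrite fp.
  by rewrite pT /=; apply: Tb.
have [f' Hf'] : exists f' : 'rV[R]_n -> 'rV[R]_n,
    forall z, V z -> W (f' z) /\ f (f' z) = z.
  have /choice[f' Hf'] : forall z, exists x, V z -> W x /\ f x = z.
    move=> z; have [Vz|nVz] := pselect (V z); last by exists 0.
    by have [x Hx] := sol z Vz; exists x.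
  by exists f'.
have lip z z' : V z -> V z' -> `|f' z - f' z'| <= 2 * (K * `|z - z'|).
  move=> Vz Vz'; have [[zr _] e] := Hf' _ Vz; have [[zr' _] e'] := Hf' _ Vz'.
  have := inj _ _ (ltW zr') (ltW zr); rewrite e e' => /le_trans; apply.
  by rewrite ler_pM2l.
have f'cont z : V z -> {for z, continuous f'}.
  move=> Vz; apply/(@cvgrPdist_le _ _ _ (nbhs z)) => e e0.
  have K1 : 0 < 2 * K + 1 by rewrite ltr_wpDl // mulr_ge0.
  have e1 : 0 < e / (2 * K + 1) by rewrite divr_gt0.
  have /cvgrPdist_lt/(_ _ e1) N1 := @cvg_id _ (nbhs z).
  apply: filterS (filterI N1 (open_nbhs_nbhs (conj oV Vz))) => y [yz Vy].
  apply: le_trans (lip _ _ Vz Vy) _.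
  rewrite /= ltr_pdivlMr // in yz; apply: le_trans (ltW yz).
  by rewrite mulrA mulrC ler_wpM2l // lerDl.
(* With [k] the increment of [f'], the remainder of [f] is small relative to [k], hence relative to
   [h] because [f'] is Lipschitz; multiplying by the inverse Jacobian gives the derivative. *)
have der z v : V z -> is_derive z v f' (v *m invmx ('J f (f' z))).
  move=> Vz; set x := f' z; set B := invmx _.
  have [[xr _] fx] := Hf' _ Vz.
  have [Ux uJ _] := Hr0 x (ltW (lt_trans xr rr0)).
  have [KB KB0 BN] := mulmx_norm_le B.
  suff H : h^-1 *: (f' (h *: v + z) - f' z) @[h --> 0^'] --> v *m B.
    by split; [apply/cvg_ex; exists (v *m B)|exact: cvg_lim H].
  apply/cvgrPdist_le => e e0.
  pose C := KB * (2 * (K * `|v|)).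
  have C0 : 0 <= C by rewrite !mulr_ge0.
  have e'0 : 0 < e / (C + 1) by rewrite divr_gt0 // ltr_wpDl.
  have [d /= d0 Hd] := (@nbhs_normP R 'rV[R]_n _ _).1
    (jacobian_remainder (smooth_mx_differentiable oU sf Ux) e'0).
  have [p /= p0 Hp] := (@nbhs_normP R 'rV[R]_n _ _).1
    (open_nbhs_nbhs (conj oV Vz)).
  have q0 : 0 < p / (`|v| + 1) by rewrite divr_gt0 // ltr_wpDl.
  have q1 : 0 < d / (2 * (K * `|v|) + 1).
    by rewrite divr_gt0 // ltr_wpDl // !mulr_ge0.
  near=> h.
  have h0 : h != 0 by near: h; exact: nbhs_dnbhs_neq.
  have hp : `|h| < p / (`|v| + 1) by near: h; exact: dnbhs0_lt.
  have hd : `|h| < d / (2 * (K * `|v|) + 1) by near: h; exact: dnbhs0_lt.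
  have Vh : V (h *: v + z).
    apply: Hp; rewrite /ball_ /= opprD addrCA subrr addr0 normrN normrZ.
    rewrite ltr_pdivlMr ?ltr_wpDl // in hp; apply: le_lt_trans hp.
    by rewrite ler_wpM2l // lerDl.
  set k := f' _ - f' z.
  have kn : `|k| <= `|h| * (2 * (K * `|v|)).
    apply: le_trans (lip _ _ Vh Vz) _.
    by rewrite addrK normrZ (mulrCA K) (mulrCA 2).
  have kd : `|k| < d.
    apply: le_lt_trans kn _.
    rewrite ltr_pdivlMr ?ltr_wpDl ?mulr_ge0 // in hd; apply: le_lt_trans hd.
    by rewrite ler_wpM2l // lerDl.
  have := Hd k; rewrite /ball_ /= sub0r normrN => /(_ kd).
  have -> : x + k = f' (h *: v + z) by rewrite /k addrC subrK.
  have [_ ->] := Hf' _ Vh; rewrite fx addrK => E.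
  have -> : v *m B - h^-1 *: k = h^-1 *: ((h *: v - k *m 'J f x) *m B).
    rewrite mulmxBl mulmxK; last exact: uJ.
    rewrite -[in RHS]scalemxAl.
    rewrite [RHS]scalerBr.
    rewrite scalerA mulVf; last exact: h0.
    by rewrite scale1r.
  have h_gt0 : 0 < `|h| by rewrite normr_gt0.
  rewrite normrZ normfV ler_pdivrMl; last exact: h_gt0.
  apply: le_trans (BN _) _; apply: le_trans (ler_wpM2l KB0 E) _.
  apply: le_trans (ler_wpM2l KB0 (ler_wpM2l (ltW e'0) kn)) _.
  have -> : KB * (e / (C + 1) * (`|h| * (2 * (K * `|v|))))
      = `|h| * (e * (C / (C + 1))) by rewrite /C; ring.
  rewrite ler_wpM2l // ger_pMr // ler_pdivrMr ?mul1r ?lerDl //.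
  by rewrite ltr_wpDl.
have WU : W `<=` U by move=> x [/ltW/Ur].
have sB : smooth_mx_on W (fun x => invmx ('J f x)).
  apply: smooth_invmx oW _ _ => [i j|x [xr _]].
    exact: smooth_sub WU (smooth_jacobian oU sf i j).
  by have [] := Hr0 x (ltW (lt_trans xr rr0)).
have pdf' a b z : V z -> derivable (fun w => f' w 0 b) z (delta_mx 0 a) /\
    pd a (fun w => f' w 0 b) z = invmx ('J f (f' z)) a b.
  move=> Vz; have [df' vf'] := der z (delta_mx 0 a) Vz; split.
    by have /derivable_mxP := df'; apply.
  have := derive_mx df'; rewrite vf' => /rowP/(_ b).
  by rewrite -rowE !mxE.
have comp_cont (phi : 'rV[R]_n -> R) z : smooth_on W phi -> V z ->
    {for z, continuous (phi \o f')}.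
  move=> sphi Vz; apply: continuous_comp; first exact: f'cont.
  by apply: smooth_continuous sphi _; have [] := Hf' _ Vz.
have f'diff b z : V z -> differentiable (fun w => f' w 0 b) z.
  move=> Vz; pose fb w : R := f' w 0 b.
  suff [dz _] : is_diff z fb (dotr (dif fb z)) by exact: dz.
  apply: C1_diff => a.
    apply: filterS (open_nbhs_nbhs (conj oV Vz)) => y Vy.
    by have [] := pdf' a b y Vy.
  apply: (continuous_eq_on oV _ Vz (comp_cont _ _ (sB a b) Vz)) => y Vy.
  by have [_ ->] := pdf' a b y Vy.
have sf' : smooth_mx_on V f'.
  move=> i b; rewrite ord1.
  (* This class is stable under [pd]: the derivatives of [f'] are the entries of the inverse
     Jacobian of [f] composed with [f']. *)
  pose S (F : 'rV[R]_n -> R) := exists2 phi, smooth_on W phi & F = phi \o f'.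
  apply: (@smooth_coind _ _ _ S oV); last first.
  - by exists (fun x => x 0 b) => //; exact: smooth_coord.
  - move=> _ a [phi sphi ->].
    exists ((fun x => \sum_c pd c phi x * invmx ('J f x) a c) \o f').
      eexists; last by [].
      apply: (smooth_sum _ _ oW) => c; exact: smoothM oW (smooth_pd c sphi) (sB a c).
    move=> z Vz; have [Wz _] := Hf' _ Vz.
    have dphi := smooth_differentiable oW sphi Wz.
    have [_] := derive_comp_rV (delta_mx 0 a) (fun b => f'diff b z Vz) dphi.
    rewrite /pd /= => ->; apply: eq_bigr => c _.
    by have [_ <-] := pdf' a c z Vz.
  move=> _ z [phi sphi ->] Vz; split; first exact: comp_cont.
  move=> a; have [Wz _] := Hf' _ Vz.
  have dphi := smooth_differentiable oW sphi Wz.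
  have [dc _] := derive_comp_rV (delta_mx 0 a) (fun b => f'diff b z Vz) dphi.
  exact: diff_derivable dc.
exists W, V, f'; split.
- split; [|exact: oW|by move=> x [/ltW/Ur]].
  by split; rewrite /= ?/V /= subrr ?mul0mx normr0 ?divr_gt0.
- exact: oV.
- exact: sf'.
- move=> y [yr Vy]; split; first exact: Vy.
  have [[xr _] e] := Hf' _ Vy.
  have := inj _ _ (ltW yr) (ltW xr); rewrite e subrr mul0mx normr0 mulr0.
  by rewrite normr_le0 subr_eq0 => /eqP.
- exact: Hf'.
Unshelve. all: by end_near. Qed.

End InverseFunction.

(** * Poincare lemma *)

Section Poincare.
Context {R : realType} {n : nat}.

Lemma is_derive_of_curve (f : 'rV[R]_n -> R) (u v : 'rV[R]_n) (d : R) :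
  is_derive (0 : R) 1 (fun x : R => f (u + x *: v)) d ->
  derivable f u v /\ 'D_v f u = d.
Proof.
set g := fun x : R => _.
have e : (fun h : R => h^-1 *: (g (h *: (1 : R) + 0) - g 0))
    = (fun h : R => h^-1 *: (f (h *: v + u) - f u)).
  apply/funext => h; rewrite /g addr0 scale0r addr0 -[h *: 1]/(h * 1) mulr1.
  by rewrite [u + _]addrC.
move=> [dg <-]; split; first by move: dg; rewrite /derivable e.
by rewrite /derive [in RHS]e.
Qed.

Variables (w : 'I_n -> 'rV[R]_n -> R) (B : set 'rV[R]_n) (u0 : 'rV[R]_n) (M r : R).
Hypotheses (M0 : 0 <= M) (oB : open B) (sw : forall a, smooth_on B (w a))
  (cw : forall a b u, B u -> pd a (w b) u = pd b (w a) u)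
  (BE : forall u, B u <-> `|u - u0| < r)
  (wM : forall a u, B u -> `|w a u| <= M)
  (dwM : forall a b u, B u -> `|pd a (w b) u| <= M).

Let mu := @lebesgue_measure R.

(** Integral of the 1-form with components [w a] along the segment from [u0] to [u], which stays in
    the ball [B]. *)
Let primitive u : R :=
  \int[mu]_(s in `[0, 1]) \sum_a w a (u0 + s *: (u - u0)) * (u - u0) 0 a.

Let seg u (s : R) : B u -> 0 <= s <= 1 -> B (u0 + s *: (u - u0)).
Proof.
move=> /BE ur /andP[s0 s1]; apply/BE; rewrite addrC addKr normrZ ger0_norm //.
by apply: le_lt_trans ur; rewrite ler_piMl.
Qed.

Let derive_w a u (s : R) (v : 'rV[R]_n) : B (u + s *: v) ->
  is_derive s 1 (fun s : R => w a (u + s *: v)) (dotr (dif (w a) (u + s *: v)) v).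
Proof.
move=> Bs; have dw := smooth_differentiable oB (sw a) Bs.
apply: is_derive_eq (is_derive_line (diff_derivable dw)) _.
by rewrite derive_dotr //; apply: eq_bigr => c _; rewrite mxE.
Qed.

Let integrand_derivable u (s : R) : B u -> 0 <= s <= 1 ->
  derivable (fun s : R => \sum_a w a (u0 + s *: (u - u0)) * (u - u0) 0 a) s 1.
Proof.
move=> Bu s01.
have -> : (fun s : R => \sum_a w a (u0 + s *: (u - u0)) * (u - u0) 0 a) =
    \sum_a (fun s : R => w a (u0 + s *: (u - u0)) * (u - u0) 0 a).
  by apply/funext => t; rewrite fct_sumE.
apply: derivable_sum => a; apply: derivableM; last exact: derivable_cst.
by have [] := derive_w a (seg Bu s01).
Qed.

Let integrable_integrand u : B u ->
  mu.-integrable `[0, 1]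
    (EFin \o (fun s : R => \sum_a w a (u0 + s *: (u - u0)) * (u - u0) 0 a)).
Proof.
move=> Bu; apply: continuous_compact_integrable; first exact: segment_compact.
apply: derivable_within_continuous => s; rewrite in_itv /=.
exact: integrand_derivable.
Qed.

(** Differentiation under the integral sign, dominated by the constant [n * (M * r + M)]. Closedness
    turns the differentiated integrand into the [s]-derivative of [s * w b (u0 + s *: (u - u0))],
    which the fundamental theorem of calculus integrates to [w b u]. *)
Lemma primitive_pd u b : B u ->
  derivable primitive u (delta_mx 0 b) /\ pd b primitive u = w b u.
Proof.
move=> Bu; apply: is_derive_of_curve.
pose d (x : R) : 'rV[R]_n := u + x *: delta_mx 0 b - u0.
pose Phi (x s : R) := \sum_a w a (u0 + s *: d x) * d x 0 a.
pose eta := r - `|u - u0|.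
have eta0 : 0 < eta by rewrite subr_gt0; apply/BE.
have Bx (x : R) : x \in `](- eta), eta[ -> B (u + x *: delta_mx 0 b).
  rewrite in_itv /= -ltr_norml => xe; apply/BE.
  have -> : u + x *: delta_mx 0 b - u0 = (u - u0) + x *: delta_mx 0 b.
    by rewrite addrAC.
  apply: le_lt_trans (ler_normD _ _) _; rewrite -ltrBrDl -/eta normrZ.
  apply: le_lt_trans xe; apply: ler_piMr => //.
  apply: rV_norm_le => // j; rewrite mxE.
  by case: (_ && _); rewrite ?normr1 ?normr0.
pose DPhi (x s : R) := \sum_a (s * pd b (w a) (u0 + s *: d x) * d x 0 a
  + w a (u0 + s *: d x) * (b == a)%:R).
have dPhi x s : x \in `](- eta), eta[ -> 0 <= s <= 1 ->
    is_derive x 1 (Phi ^~ s) (DPhi x s).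
  move=> xe s01; rewrite /Phi.
  have -> : (fun x => \sum_a w a (u0 + s *: d x) * d x 0 a) =
      \sum_a (fun x => w a (u0 + s *: d x) * d x 0 a).
    by apply/funext => t; rewrite fct_sumE.
  apply: is_derive_sum => a.
  have E (x' : R) : u0 + s *: d x' = (u0 + s *: (u - u0)) + x' *: (s *: delta_mx 0 b).
    by apply/rowP => j; rewrite /d !mxE; ring.
  have d1 : is_derive x 1 (fun x => w a (u0 + s *: d x))
      (s * pd b (w a) (u0 + s *: d x)).
    have -> : (fun x => w a (u0 + s *: d x)) =
        (fun x => w a ((u0 + s *: (u - u0)) + x *: (s *: delta_mx 0 b))).
      by apply/funext => x'; rewrite E.
    have Bs := seg (Bx x xe) s01; rewrite -/(d x) E in Bs.
    rewrite E; apply: is_derive_eq (derive_w a Bs) _.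
    rewrite /dotr (bigD1 b) //= big1 => [|c cb].
      by rewrite !mxE !eqxx mulr1 addr0.
    by rewrite !mxE eqxx (negPf cb) mulr0 mul0r.
  have d2 : is_derive x 1 (fun x => d x 0 a) (b == a)%:R.
    have -> : (fun x => d x 0 a) = (fun x : R => (u - u0) 0 a + (a == b)%:R * x).
      by apply/funext => x'; rewrite /d !mxE eqxx /=; ring.
    have -> : (b == a)%:R = 0 + (a == b)%:R *: (1 : R).
      by rewrite add0r eq_sym -[RHS]/(_ * _) mulr1.
    exact: is_deriveD.
  have H := @is_deriveM _ _ _ _ x 1 _ _ d1 d2.
  refine (@is_derive_eq _ _ _ _ _ _ _ _ H _).
  by rewrite addrC; congr (_ + _); exact: (mulrC (d x 0 a)).
have I0 : `](- eta), eta[%classic (0 : R) by rewrite /= in_itv /= oppr_lt0 eta0.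
have uI x : `](- eta), eta[%classic x -> B (u + x *: delta_mx 0 b) by exact: Bx.
have G_ub (x s : R) : `](- eta), eta[%classic x -> `[0, 1]%classic s ->
    `|partial1of2 Phi x s| <= n%:R * (M * r + M).
  move=> xe; rewrite /= in_itv /= => s01; rewrite partial1of2E.
  have [_ ->] := dPhi x s xe s01.
  apply: le_trans (ler_norm_sum _ _ _) _.
  apply: (@le_trans _ _ (\sum_(a < n) (M * r + M))); last first.
    by rewrite sumr_const card_ord mulr_natl.
  have Bs := seg (Bx x xe) s01; rewrite -/(d x) in Bs.
  apply: ler_sum => a _; apply: le_trans (ler_normD _ _) _.
  have dr : `|d x 0 a| <= r.
    by apply: le_trans (coord_norm_le _ _) _; apply/ltW/BE; exact: Bx.
  apply: lerD; rewrite normrM; last first.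
    rewrite -[leRHS]mulr1; apply: ler_pM => //; first exact: wM.
    by case: (b == a); rewrite ?normr1 ?normr0.
  apply: ler_pM => //; rewrite normrM.
  move: s01 => /andP[s0 s1]; rewrite ger0_norm // -[leRHS]mul1r.
  by apply: ler_pM => //; exact: dwM.
have M1 : 0 <= n%:R * (M * r + M).
  rewrite mulr_ge0 // addr_ge0 // mulr_ge0 //.
  by have /BE/ltW := Bu; apply: le_trans.
have mI : measurable (`[0, 1]%classic : set R) by exact: measurable_itv.
have intPhi (x : R) : `](- eta), eta[%classic x ->
    mu.-integrable `[0, 1] (EFin \o Phi x).
  by move=> /uI/integrable_integrand.
have derPhi (x s : R) : `](- eta), eta[%classic x -> `[0, 1]%classic s ->
    derivable (Phi ^~ s) x 1.
  by move=> xe; rewrite /= in_itv /= => s01; have [] := dPhi x s xe s01.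
have intG : mu.-integrable `[0, 1]
    (EFin \o (fun _ : R => n%:R * (M * r + M))).
  apply: continuous_compact_integrable; first exact: segment_compact.
  by apply: continuous_subspaceT => s; exact: cst_continuous.
have dF := @derivable_under_integral _ _ _ mu Phi _ mI 0 (- eta) eta I0 intPhi derPhi
  _ (fun=> M1) intG G_ub.
have vF := @differentiation_under_integral _ _ _ mu Phi _ mI 0 (- eta) eta I0 intPhi derPhi
  _ (fun=> M1) intG G_ub.
split; first exact: dF.
rewrite -derive1E; etransitivity; first exact: vF.
pose G (s : R) := s * w b (u0 + s *: (u - u0)).
pose G' (s : R) := s * dotr (dif (w b) (u0 + s *: (u - u0))) (u - u0)
  + w b (u0 + s *: (u - u0)).
have dG (s : R) : 0 <= s <= 1 -> is_derive s 1 G (G' s).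
  move=> s01; have d1 := derive_w b (seg Bu s01).
  have H := @is_deriveM _ _ _ _ s 1 _ _ (is_derive_id s (1 : R)) d1.
  refine (@is_derive_eq _ _ _ _ _ _ _ _ H _).
  by congr (_ + _); exact: mulr1.
have G'c : {within `[0, 1], continuous G'}.
  have -> : G' = (fun s => s * \sum_a (u - u0) 0 a * pd a (w b) (u0 + s *: (u - u0)))
      \+ (fun s => w b (u0 + s *: (u - u0))).
    apply/funext => s; congr (_ * _ + _).
    by apply: eq_bigr => a _; rewrite [dif _ _ _ _]mxE.
  apply: derivable_within_continuous => s; rewrite in_itv /= => s01.
  have Bs := seg Bu s01.
  apply: derivableD; last by have [] := derive_w b Bs.
  apply: (@derivableM R R id); first exact: derivable_id.
  have -> : (fun s : R => \sum_a (u - u0) 0 a * pd a (w b) (u0 + s *: (u - u0))) =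
      \sum_a (fun s : R => (u - u0) 0 a * pd a (w b) (u0 + s *: (u - u0))).
    by apply/funext => t; rewrite fct_sumE.
  apply: derivable_sum => a; apply: derivableM; first exact: derivable_cst.
  have dpw := smooth_differentiable oB (smooth_pd a (sw b)) Bs.
  by have [] := is_derive_line (diff_derivable (v := u - u0) dpw).
have Gc (s : R) : 0 <= s <= 1 -> {for s, continuous G}.
  by move=> /dG[dGs _]; apply: differentiable_continuous; apply/derivable1_diffP.
have Goo : derivable_oo_LRcontinuous G 0 1.
  split.
  - by move=> s; rewrite in_itv /= => /andP[s0 s1]; have [] := dG s _; rewrite ?ltW.
  - by apply: cvg_at_right_filter; apply: Gc; rewrite lexx ler01.
  - by apply: cvg_at_left_filter; apply: Gc; rewrite lexx ler01.
have GG' : {in `]0, 1[, (G^`()%classic : R -> R) =1 G'}.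
  move=> s; rewrite in_itv /= derive1E => /andP[s0 s1].
  by have [] := dG s _; rewrite ?ltW.
have := continuous_FTC2 ltr01 G'c Goo GG'.
rewrite /G mul0r mul1r scale1r (addrC u0) subrK sube0 => FTC.
suff -> : \int[mu]_(s in `[0, 1]) partial1of2 Phi 0 s = \int[mu]_(s in `[0, 1]) G' s.
  by rewrite /Rintegral FTC.
apply: eq_Rintegral => s; rewrite inE /= in_itv /= => s01.
rewrite partial1of2E; have [_ ->] := dPhi 0 s I0 s01.
rewrite /DPhi big_split /=.
have d0 : d 0 = u - u0 by rewrite /d scale0r addr0.
rewrite d0 /G' /dotr mulr_sumr; congr (_ + _).
  apply: eq_bigr => a _; rewrite [dif _ _ _ _]mxE cw; last exact: seg.
  by rewrite -mulrA; congr (_ * _); rewrite mulrC.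
rewrite (bigD1 b) //= eqxx mulr1 big1 ?addr0 // => a ab.
by rewrite eq_sym (negPf ab) mulr0.
Qed.

(** Coinduction on the class made of [primitive] and all functions smooth on [B]: the derivatives of
    [primitive] are the [w a]. *)
Lemma primitive_smooth : smooth_on B primitive.
Proof.
pose S (f : 'rV[R]_n -> R) := f = primitive \/ smooth_on B f.
apply: (@smooth_coind _ _ _ S oB); last by left.
- move=> f u [->|sf] Bu; last first.
    split; first exact: smooth_continuous sf Bu.
    by move=> a; exact: smooth_derivable sf Bu.
  split; last by move=> a; have [] := primitive_pd a Bu.
  have NB := open_nbhs_nbhs (conj oB Bu).
  suff [dz _] : is_diff u primitive (dotr (dif primitive u)).
    exact: differentiable_continuous.
  apply: C1_diff => a.
    by apply: filterS NB => v Bv; have [] := primitive_pd a Bv.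
  apply: (continuous_eq_on oB _ Bu (smooth_continuous (sw a) Bu)) => v Bv.
  by have [_ ->] := primitive_pd a Bv.
- move=> f a [->|sf]; last by exists (pd a f); [right; exact: smooth_pd|].
  exists (w a); first by right; exact: sw.
  by move=> u Bu; have [] := primitive_pd a Bu.
Qed.

End Poincare.

(** On a small ball the [w a] and their first derivatives differ by at most [1] from their values at
    [u0]; this yields the uniform bound [M] that dominates the integrands. *)
Lemma poincare_lemma (R : realType) (n : nat) (U : set 'rV[R]_n)
    (w : 'I_n -> 'rV[R]_n -> R) (u0 : 'rV[R]_n) :
  open U -> U u0 -> (forall a, smooth_on U (w a)) ->
  (forall a b u, U u -> pd a (w b) u = pd b (w a) u) ->
  exists (B : set 'rV[R]_n) (F : 'rV[R]_n -> R),
    [/\ open B, B u0, B `<=` U, smooth_on B F &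
        forall a u, B u -> pd a F u = w a u].
Proof.
move=> oU Uu0 sw cw.
have e0 : 0 < (1 : R) by [].
have NU := open_nbhs_nbhs (conj oU Uu0).
have N1 : \forall u \near u0, forall a, `|w a u0 - w a u| <= 1.
  apply: (@filter_forall _ _ (fun a u => `|w a u0 - w a u| <= 1)
    (nbhs u0) (nbhs_filter u0)) => a.
  by have /cvgrPdist_le/(_ _ e0) := smooth_continuous (sw a) Uu0.
have N2 : \forall u \near u0, forall ab : 'I_n * 'I_n,
    `|pd ab.1 (w ab.2) u0 - pd ab.1 (w ab.2) u| <= 1.
  apply: (@filter_forall _ _ (fun (ab : 'I_n * 'I_n) u =>
    `|pd ab.1 (w ab.2) u0 - pd ab.1 (w ab.2) u| <= 1) (nbhs u0) (nbhs_filter u0)) => ab.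
  by have /cvgrPdist_le/(_ _ e0) :=
    smooth_continuous (smooth_pd ab.1 (sw ab.2)) Uu0.
have [r /= r0 Hr] := (@nbhs_normP R 'rV[R]_n _ _).1 (filterI NU (filterI N1 N2)).
pose B := ball u0 r.
have oB : open B by exact: ball_open.
have BE v : B v <-> `|v - u0| < r.
  by rewrite /B -ball_normE /ball_ /= distrC.
have HB v : B v -> (ball_ Num.norm u0 r) v by move=> /BE; rewrite /ball_ /= distrC.
have BU : B `<=` U by move=> v /HB/Hr[H _]; exact: H.
have S1 (I : finType) (f : I -> R) (i : I) : `|f i| <= \sum_j `|f j|.
  by rewrite (bigD1 i) //= lerDl sumr_ge0.
have near1 (x y : R) : `|x - y| <= 1 -> `|y| <= `|x| + 1.
  move=> xy; have -> : y = x - (x - y) by ring.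
  by apply: le_trans (ler_normB _ _) _; rewrite lerD2l.
pose M := \sum_a `|w a u0| +
  \sum_(ab : 'I_n * 'I_n) `|pd ab.1 (w ab.2) u0| + 1.
have S0 : 0 <= \sum_a `|w a u0| by exact: sumr_ge0.
have S2 : 0 <= \sum_(ab : 'I_n * 'I_n) `|pd ab.1 (w ab.2) u0| by exact: sumr_ge0.
have M0 : 0 <= M by rewrite /M; lra.
have sB a : smooth_on B (w a) by exact: smooth_sub BU (sw a).
have wM a u : B u -> `|w a u| <= M.
  move=> /HB/Hr[_ [H _]]; have := near1 _ _ (H a).
  by have := S1 _ (fun a => w a u0) a; rewrite /M; lra.
have dwM a b u : B u -> `|pd a (w b) u| <= M.
  move=> /HB/Hr[_ [_ H]]; have := near1 _ _ (H (a, b)).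
  have := S1 _ (fun ab : 'I_n * 'I_n => pd ab.1 (w ab.2) u0) (a, b).
  by rewrite /M /=; lra.
have cB a b u : B u -> pd a (w b) u = pd b (w a) u by move=> /BU; exact: cw.
exists B; eexists; split.
- exact: oB.
- by apply/BE; rewrite subrr normr0.
- exact: BU.
- exact: (primitive_smooth M0 oB sB cB BE wM dwM).
- by move=> a u Bu; have [_ ->] := primitive_pd M0 oB sB cB BE wM dwM a Bu.
Qed.

(** * Moving frames *)

Section MatrixDerivative.
Context {R : realType} {n : nat}.

Definition pdmx (p q : nat) (a : 'I_n) (B : 'rV[R]_n -> 'M[R]_(p, q))
    (u : 'rV[R]_n) : 'M[R]_(p, q) :=
  \matrix_(i, j) pd a (fun v => B v i j) u.

Lemma smooth_pdmx p q U a (B : 'rV[R]_n -> 'M[R]_(p, q)) :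
  smooth_mx_on U B -> smooth_mx_on U (pdmx a B).
Proof.
move=> sB i j; under eq_fun do rewrite mxE.
by apply: smooth_pd; exact: sB.
Qed.

Lemma pdmx_mul p q s U a (A : 'rV[R]_n -> 'M[R]_(p, q))
    (B : 'rV[R]_n -> 'M[R]_(q, s)) u :
  smooth_mx_on U A -> smooth_mx_on U B -> U u ->
  pdmx a (fun v => A v *m B v) u = pdmx a A u *m B u + A u *m pdmx a B u.
Proof.
move=> sA sB Uu; apply/matrixP => i j; rewrite !mxE -big_split /=.
under [in LHS]eq_fun do rewrite mxE.
have dA k : derivable (fun v => A v i k) u (delta_mx 0 a).
  exact: smooth_derivable (sA i k) Uu.
have dB k : derivable (fun v => B v k j) u (delta_mx 0 a).
  exact: smooth_derivable (sB k j) Uu.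
rewrite pd_sum; last by move=> k; apply: derivableM; [exact: dA|exact: dB].
apply: eq_bigr => k _; rewrite !mxE.
by rewrite pdM; [|exact: dA|exact: dB].
Qed.

Lemma pdmx_add p q U a (A B : 'rV[R]_n -> 'M[R]_(p, q)) u :
  smooth_mx_on U A -> smooth_mx_on U B -> U u ->
  pdmx a (fun v => A v + B v) u = pdmx a A u + pdmx a B u.
Proof.
move=> sA sB Uu; apply/matrixP => i j; rewrite !mxE.
under [in LHS]eq_fun do rewrite mxE.
rewrite pdD; [by []|exact: smooth_derivable (sA i j) Uu|].
exact: smooth_derivable (sB i j) Uu.
Qed.

Lemma pdmx_eq_on p q U a (A B : 'rV[R]_n -> 'M[R]_(p, q)) u :
  open U -> (forall v, U v -> A v = B v) -> U u -> pdmx a A u = pdmx a B u.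
Proof.
move=> oU AB Uu; apply/matrixP => i j; rewrite !mxE.
by apply: (pd_eq_on _ oU _ Uu) => v Uv; rewrite AB.
Qed.

End MatrixDerivative.

Section MovingFrame.
Context {R : realType} {n : nat}.
Variables (U : set 'rV[R]_n) (e : 'rV[R]_n -> 'M[R]_n)
  (om : 'I_n -> 'rV[R]_n -> 'M[R]_n) (g : 'rV[R]_n -> 'M[R]_n).
Hypotheses (oU : open U) (se : smooth_mx_on U e)
  (som : forall a, smooth_mx_on U (om a))
  (ue : forall u, U u -> e u \in unitmx)
  (om_anti : forall a u, U u -> (om a u)^T = - om a u)
  (om_torsion : forall a b u, U u ->
     col b (pdmx a e u + om a u *m e u) = col a (pdmx b e u + om b u *m e u))
  (gE : forall u, U u -> g u = (e u)^T *m e u).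

(** The rows of [e] form an orthonormal coframe, [om a] is the connection matrix evaluated on the
    coordinate vector [a], and [om_torsion] is the structure equation [d e + om /\ e = 0]. [T a]
    will turn out to be [e] times the matrix of Christoffel symbols. *)
Let T a u := pdmx a e u + om a u *m e u.

Lemma frame_pd_metric a u : U u ->
  pdmx a g u = (T a u)^T *m e u + (e u)^T *m T a u.
Proof.
move=> Uu; rewrite (pdmx_eq_on _ oU gE Uu).
rewrite (pdmx_mul (U := U)); last 3 first.
- by move=> i j; under eq_fun do rewrite mxE; exact: se.
- exact: se.
- exact: Uu.
have -> : pdmx a (fun v => (e v)^T) u = (pdmx a e u)^T.
  by apply/matrixP => i j; rewrite !mxE; under eq_fun do rewrite mxE.
rewrite /T linearD /= trmx_mul om_anti // mulmxDl mulmxDr.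
by rewrite !mulmxN mulNmx -mulmxA addrACA addNr addr0.
Qed.

Lemma frame_metric_unit u : U u -> g u \in unitmx.
Proof. by move=> Uu; rewrite gE // unitmx_mul unitmx_tr ue. Qed.

(** Uniqueness of the Levi-Civita connection. Antisymmetry of [om] expresses the derivatives of [g]
    through [T], and the symmetry of [T] given by vanishing torsion collapses the Koszul combination
    to [2 * (e^T *m T a)]. *)
Lemma frame_christoffel c a b u : U u ->
  christoffel g c a b u = (invmx (e u) *m T a u) c b.
Proof.
move=> Uu; have sym k i j : T i u k j = T j u k i.
  have := om_torsion i j Uu => /colP/(_ k); rewrite -/(T i u) -/(T j u).
  by rewrite ![col _ _ _ _]mxE.
have E d : pd a (fun y => g y b d) u + pd b (fun y => g y a d) u
     - pd d (fun y => g y a b) u = 2 * ((e u)^T *m T a u) d b.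
  have pE i j k : pd i (fun y => g y j k) u =
      \sum_l T i u l j * e u l k + \sum_l e u l j * T i u l k.
    have := frame_pd_metric i Uu => /matrixP/(_ j k); rewrite ![in LHS]mxE => ->.
    rewrite !mxE; congr (_ + _); apply: eq_bigr => l _.
      by rewrite [_^T _ _]mxE.
    by rewrite [_^T _ _]mxE.
  rewrite !pE !mxE.
  have -> : \sum_j (e u)^T d j * T a u j b = \sum_l T a u l b * e u l d.
    by apply: eq_bigr => l _; rewrite [_^T _ _]mxE mulrC.
  have e1 : \sum_l T b u l a * e u l d = \sum_l T a u l b * e u l d.
    by apply: eq_bigr => l _; rewrite sym.
  have e2 : \sum_l e u l b * T a u l d = \sum_l e u l b * T d u l a.
    by apply: eq_bigr => l _; rewrite sym.
  have e3 : \sum_l e u l b * T d u l a = \sum_l T d u l a * e u l b.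
    by apply: eq_bigr => l _; rewrite mulrC.
  rewrite e1 e2.
  have -> : \sum_l e u l a * T d u l b = \sum_l e u l a * T b u l d.
    by apply: eq_bigr => l _; rewrite sym.
  rewrite e3; ring.
rewrite /christoffel; under eq_bigr do rewrite E mulrCA.
rewrite -mulr_sumr mulKf // gE //.
have -> : invmx (e u) = invmx ((e u)^T *m e u) *m (e u)^T.
  have gu : (e u)^T *m e u \in unitmx by rewrite -gE // frame_metric_unit.
  apply: (can_inj (mulKmx gu)).
  by rewrite mulKVmx // -mulmxA mulmxV ?ue // mulmx1.
by rewrite -mulmxA mxE.
Qed.

Definition curvature_form a b u : 'M[R]_n :=
  pdmx a (om b) u - pdmx b (om a) u + om a u *m om b u - om b u *m om a u.

(** The Christoffel matrices [G a] are the gauge transforms of the [om a] by [e], so the two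
    curvatures are conjugate by [e]; the second derivatives of [e] cancel by symmetry. *)
Lemma frame_riemann d c a b u : U u ->
  riemann g d c a b u = (invmx (e u) *m curvature_form a b u *m e u) d c.
Proof.
move=> Uu; pose G a v := invmx (e v) *m T a v.
have sT i : smooth_mx_on U (T i).
  move=> k l; rewrite /T; under eq_fun do rewrite mxE.
  apply: smoothD oU _ _; first exact: smooth_pdmx.
  exact: (smooth_mulmx oU (som i) se).
have sG i : smooth_mx_on U (G i).
  exact: smooth_mulmx oU (smooth_invmx oU se ue) (sT i).
have eG i v : U v -> e v *m G i v = T i v by move=> Uv; rewrite /G mulKVmx // ue.
have R1 : riemann g d c a b u =
    (pdmx a (G b) u - pdmx b (G a) u + G a u *m G b u - G b u *m G a u) d c.
  rewrite /riemann !mxE sumrB -addrA; congr (_ + _); first congr (_ - _).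
  - by apply: (pd_eq_on _ oU _ Uu) => v Uv; exact: frame_christoffel.
  - by apply: (pd_eq_on _ oU _ Uu) => v Uv; exact: frame_christoffel.
  - by congr (_ - _); apply: eq_bigr => k _; rewrite !frame_christoffel.
rewrite {}R1; congr (fun_of_matrix _ d c); apply: (can_inj (mulKmx (ue Uu))).
rewrite -mulmxA mulKVmx ?ue //.
have D i j : e u *m pdmx i (G j) u = pdmx i (T j) u - pdmx i e u *m G j u.
  by rewrite -(pdmx_eq_on i oU (eG j) Uu) (pdmx_mul _ se (sG j) Uu) addrAC subrr add0r.
have P i j : pdmx i (T j) u =
    pdmx i (pdmx j e) u + (pdmx i (om j) u *m e u + om j u *m pdmx i e u).
  rewrite (pdmx_add (U := U)); [|exact: smooth_pdmx|exact: (smooth_mulmx oU (som j) se)|exact: Uu].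
  by rewrite (pdmx_mul _ (som j) se Uu).
have GG i j : e u *m (G i u *m G j u) =
    pdmx i e u *m G j u + om i u *m (pdmx j e u + om j u *m e u).
  by rewrite mulmxA eG // {1}/T mulmxDl -mulmxA eG.
have S : pdmx a (pdmx b e) u = pdmx b (pdmx a e) u.
  apply/matrixP => k l.
  have H i j : pdmx i (pdmx j e) u k l = pd i (pd j (fun v => e v k l)) u.
    by rewrite mxE; congr (pd i _ u); apply/funext => v; rewrite mxE.
  refine (etrans (H a b) (etrans _ (esym (H b a)))).
  exact: pd_pd_comm oU (se k l) Uu.
rewrite mulmxBr mulmxDr mulmxBr !D !P !GG S /curvature_form.
rewrite !mulmxBl !mulmxDl !mulNmx !mulmxDr -!mulmxA.
move: (pdmx b (pdmx a e) u) (pdmx a (om b) u *m e u) (om b u *m pdmx a e u)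
  (pdmx a e u *m G b u) (pdmx b (om a) u *m e u) (om a u *m pdmx b e u)
  (pdmx b e u *m G a u) (om a u *m (om b u *m e u)) (om b u *m (om a u *m e u)).
by move=> X1 X2 X3 X4 X5 X6 X7 X8 X9; apply/matrixP => i j; rewrite !mxE; ring.
Qed.

Lemma frame_space_form K u d c a b : U u ->
  (forall k l, curvature_form a b u k l = K * (e u k a * e u l b - e u k b * e u l a)) ->
  riemann g d c a b u = K * ((d == a)%:R * g u b c - (d == b)%:R * g u a c).
Proof.
move=> Uu Om; rewrite frame_riemann //.
have -> : curvature_form a b u = K *: (col a (e u) *m (col b (e u))^T
    - col b (e u) *m (col a (e u))^T).
  by apply/matrixP => k l; rewrite Om !mxE !big_ord1 !mxE.
have X i j : invmx (e u) *m (col i (e u) *m (col j (e u))^T) *m e u =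
    col i 1%:M *m row j (g u).
  rewrite mulmxA -mulmxA; congr (_ *m _).
    by rewrite !colE mulmxA mulVmx // ue.
  by rewrite gE // row_mul tr_col.
rewrite -scalemxAr -scalemxAl mulmxBr mulmxBl !X.
by rewrite !mxE !big_ord1 !mxE.
Qed.

(* Covariant derivative of [df], for [df = \sum_k ph_k e^k]. *)
Lemma frame_hess f (ph : 'I_n -> 'rV[R]_n -> R) a b u : U u ->
  (forall k, smooth_on U (ph k)) ->
  (forall v c, U v -> pd c f v = \sum_k ph k v * e v k c) ->
  hess g f u a b =
    \sum_k (pd a (ph k) u - \sum_l ph l u * om a u l k) * e u k b.
Proof.
move=> Uu sph fE; rewrite mxE.
rewrite (pd_eq_on a oU (fun v => @fE v b) Uu).
have dph k : derivable (ph k) u (delta_mx 0 a).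
  exact: smooth_derivable (sph k) Uu.
have de k : derivable (fun v => e v k b) u (delta_mx 0 a).
  exact: smooth_derivable (se k b) Uu.
rewrite pd_sum; last by move=> k; apply: derivableM; [exact: dph|exact: de].
under eq_bigr do rewrite pdM //.
under [X in _ - X]eq_bigr => c _ do
  rewrite frame_christoffel // fE // mulr_sumr.
rewrite exchange_big /=.
have -> : \sum_j \sum_i (invmx (e u) *m T a u) i b * (ph j u * e u j i) =
    \sum_j ph j u * T a u j b.
  apply: eq_bigr => j _.
  have := congr1 (fun M : 'M[R]_n => M j b) (mulKVmx (ue Uu) (T a u)).
  rewrite mxE => <-.
  by rewrite mulr_sumr; apply: eq_bigr => i _; rewrite mulrC mulrA.
have -> : \sum_j ph j u * T a u j b = \sum_j ph j u * pd a (fun v => e v j b) u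
    + \sum_k (\sum_l ph l u * om a u l k) * e u k b.
  under [X in _ + X]eq_bigr do rewrite mulr_suml.
  rewrite [X in _ + X]exchange_big -big_split /=; apply: eq_bigr => j _.
  rewrite /T !mxE mulrDr mulr_sumr; congr (_ + _).
  by apply: eq_bigr => l _; rewrite mulrA.
rewrite opprD addrA -sumrB -sumrB; apply: eq_bigr => k _.
by rewrite addrK mulrBl.
Qed.

End MovingFrame.

(** * Constant curvature and conformal changes *)

Section SpaceForm.
Context {R : realType} {n : nat}.
Implicit Types (g : 'rV[R]_n -> 'M[R]_n) (B : 'M[R]_n) (u v w : 'rV[R]_n).

Lemma innerE B v w : inner B v w = \sum_a \sum_b v 0 a * B a b * w 0 b.
Proof.
rewrite /inner mxE exchange_big; apply: eq_bigr => b _.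
by rewrite mxE mulr_suml; apply: eq_bigr => a _; rewrite [_^T _ _]mxE.
Qed.

Lemma innerC B v w : B^T = B -> inner B v w = inner B w v.
Proof.
move=> sB; rewrite /inner -[in RHS]sB.
have -> : w *m B^T *m v^T = (v *m B *m w^T)^T by rewrite !trmx_mul trmxK mulmxA.
by rewrite [RHS]mxE.
Qed.

Lemma innerDl B (k : R) u v w : inner B (u + k *: v) w = inner B u w + k * inner B v w.
Proof. by rewrite /inner !mulmxDl mxE -!scalemxAl [X in _ + X]mxE. Qed.

Definition posdef B := B^T = B /\ forall v, v != 0 -> 0 < inner B v v.

Lemma posdef_unit B : posdef B -> B \in unitmx.
Proof.
move=> [sB pB]; rewrite -row_free_unit -kermx_eq0; apply/eqP/row_matrixP => i.
rewrite row0; apply/eqP; apply: contraT => /pB.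
rewrite /inner -row_mul mulmx_ker row0 mul0mx mxE ltxx //.
Qed.

(** Strict Cauchy-Schwarz inequality: the Gram determinant is [|v - t w|^2 |w|^2], where [t *: w] is
    the orthogonal projection of [v] on the line of [w]. *)
Lemma gram_gt0 B v w : posdef B -> row_free (col_mx v w) ->
  0 < inner B v v * inner B w w - inner B v w ^+ 2.
Proof.
move=> [sB pB] vw.
have indep (x : 'rV[R]_1) (y : 'rV[R]_1) : x *m v + y *m w = 0 -> x = 0 /\ y = 0.
  rewrite -mul_row_col => /eqP; rewrite mulmx_free_eq0 // => /eqP.
  by rewrite -(row_mx0 _ _ 1 1) => /eq_row_mx.
have w0 : w != 0.
  apply/eqP => w0; have := indep 0 1%:M.
  rewrite mul0mx mul1mx w0 addr0 => /(_ erefl)[_ /matrixP/(_ 0 0)].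
  by rewrite !mxE eqxx => /eqP; rewrite oner_eq0.
have ww := pB w w0; set t := inner B v w / inner B w w.
have z0 : v + (- t) *: w != 0.
  apply/eqP => z0; have := indep 1%:M (- t)%:M.
  rewrite mul1mx mul_scalar_mx z0 => /(_ erefl)[/matrixP/(_ 0 0)].
  by rewrite !mxE eqxx => /eqP; rewrite oner_eq0.
have := mulr_gt0 (pB _ z0) ww.
rewrite innerDl !(innerC _ (v + _)) // !innerDl (innerC w v) //.
have -> : (inner B v v + - t * inner B v w
   + - t * (inner B v w + - t * inner B w w)) * inner B w w
  = inner B v v * inner B w w - inner B v w ^+ 2; last by [].
rewrite /t; field; exact: lt0r_neq0.
Qed.

(** A condition at a single point, so that [K] may vary: this covers every surface, with its
    Gaussian curvature, as well as metrics of constant curvature. *)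
Definition space_form g K u := forall d c a b,
  riemann g d c a b u = K * ((d == a)%:R * g u b c - (d == b)%:R * g u a c).

Lemma space_form_ricci g K u : space_form g K u ->
  ricci g u = ((n%:R - 1) * K) *: g u.
Proof.
move=> sf; apply/matrixP => b c; rewrite !mxE.
under eq_bigr => a _ do rewrite sf eqxx mul1r.
rewrite -mulr_sumr sumrB sumr_const card_ord (bigD1 b) //= eqxx mul1r.
rewrite big1 ?addr0 => [|a ab]; last by rewrite (negPf ab) mul0r.
by rewrite -mulr_natl; ring.
Qed.

Lemma space_form_sectional g K u v w : space_form g K u -> (g u)^T = g u ->
  inner (g u) v v * inner (g u) w w - inner (g u) v w ^+ 2 != 0 ->
  sectional g u v w = K.
Proof.
move=> sf sg D0; rewrite /sectional.
set X := \row_d _.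
have -> : X = K *: (inner (g u) w w *: v + (- inner (g u) v w) *: w).
  apply/rowP => d; rewrite !mxE.
  rewrite [inner _ v w]innerC // !innerE.
  under eq_bigr => a _ do under eq_bigr => b _ do under eq_bigr => c _ do
    rewrite sf.
  have E1 : \sum_a \sum_b \sum_c v 0 a * w 0 b * w 0 c *
      (K * ((d == a)%:R * g u b c)) =
      K * ((\sum_b \sum_c w 0 b * g u b c * w 0 c) * v 0 d).
    rewrite (bigD1 d) //= [X in _ + X]big1 ?addr0 => [|a ad]; last first.
      apply: big1 => b _; apply: big1 => c _.
      by rewrite eq_sym (negPf ad) mul0r !mulr0.
    rewrite mulr_suml mulr_sumr; apply: eq_bigr => b _.
    rewrite mulr_suml mulr_sumr; apply: eq_bigr => c _.
    by rewrite eqxx mul1r; ring.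
  have E2 : \sum_a \sum_b \sum_c v 0 a * w 0 b * w 0 c *
      (K * ((d == b)%:R * g u a c)) =
      K * ((\sum_b \sum_c w 0 b * g u b c * v 0 c) * w 0 d).
    under eq_bigr => a _.
      rewrite (bigD1 d) //= [X in _ + X]big1 ?addr0 => [|b bd]; last first.
        by apply: big1 => c _; rewrite eq_sym (negPf bd) mul0r !mulr0.
      over.
    rewrite /= exchange_big mulr_suml mulr_sumr; apply: eq_bigr => c _.
    rewrite mulr_suml mulr_sumr; apply: eq_bigr => a _.
    have -> : g u a c = g u c a by rewrite -[in LHS]sg mxE.
    by rewrite eqxx mul1r; ring.
  rewrite mulrDr mulNr mulrN -E1 -E2 -sumrB; apply: eq_bigr => a _.
  rewrite -sumrB; apply: eq_bigr => b _.
  rewrite -sumrB; apply: eq_bigr => c _; ring.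
rewrite -[K *: _]add0r innerDl innerDl.
have -> : inner (g u) 0 v = 0 by rewrite /inner !mul0mx mxE.
have -> : inner (g u) (inner (g u) w w *: v) v = inner (g u) w w * inner (g u) v v.
  by rewrite -[_ *: v]add0r innerDl /inner !mul0mx mxE add0r.
rewrite (innerC w v sg); set x := inner _ _ _ in D0 *.
by apply: (canLR (mulfK D0)); ring.
Qed.

End SpaceForm.

Section Conformal.
Context {R : realType} {n : nat}.
Variables (U : set 'rV[R]_n).
Hypothesis oU : open U.

(** Lowering the index of the gradient [E] gives [df], so Leibniz's rule trades [g] times
    derivatives of [E] for second derivatives of [f] minus [E] times derivatives of [g]. The latter
    assemble into the Christoffel terms of the Hessian. *)
Lemma lie_grad (g : 'rV[R]_n -> 'M[R]_n) (f : 'rV[R]_n -> R) u :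
  smooth_mx_on U g -> (forall v, U v -> g v \in unitmx) ->
  (forall v, U v -> (g v)^T = g v) -> smooth_on U f -> U u ->
  lie g (grad g f) u = 2 *: hess g f u.
Proof.
move=> sg ug symg sf Uu; apply/matrixP => a b; rewrite !mxE.
pose E v := grad g f v.
have sE : smooth_mx_on U E.
  apply: smooth_mulmx oU _ (smooth_invmx oU sg ug) => i j.
  by under eq_fun do rewrite mxE; exact: smooth_pd.
have EE c d : \sum_k pd c (fun y => E y 0 k) u * g u k d =
    pd c (pd d f) u - \sum_k E u 0 k * pd c (fun y => g y k d) u.
  have H v : U v -> \sum_k E v 0 k * g v k d = pd d f v.
    move=> Uv; have := congr1 (fun M : 'rV[R]_n => M 0 d) (mulmxKV (ug v Uv) (dif f v)).
    by rewrite mxE [dif f v 0 d]mxE.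
  have dE k : derivable (fun v => E v 0 k) u (delta_mx 0 c).
    exact: smooth_derivable (sE 0 k) Uu.
  have dg k : derivable (fun v => g v k d) u (delta_mx 0 c).
    exact: smooth_derivable (sg k d) Uu.
  rewrite -(pd_eq_on c oU H Uu) pd_sum; last first.
    by move=> k; apply: derivableM; [exact: dE|exact: dg].
  rewrite -sumrB; apply: eq_bigr => k _.
  by rewrite pdM; [rewrite addrK|exact: dE|exact: dg].
have gS i j v : U v -> g v i j = g v j i by move=> Uv; rewrite -[in LHS]symg // mxE.
rewrite !big_split /=.
have -> : \sum_i g u i b * pd a (fun y => E y 0 i) u =
    pd a (pd b f) u - \sum_k E u 0 k * pd a (fun y => g y k b) u.
  by rewrite -EE; apply: eq_bigr => k _; rewrite mulrC.
have -> : \sum_i g u a i * pd b (fun y => E y 0 i) u =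
    pd a (pd b f) u - \sum_k E u 0 k * pd b (fun y => g y k a) u.
  rewrite (pd_pd_comm _ _ oU sf Uu) -EE; apply: eq_bigr => k _.
  by rewrite mulrC gS.
have -> : \sum_c christoffel g c a b u * pd c f u =
    2^-1 * (\sum_k E u 0 k * pd a (fun y => g y k b) u
     + \sum_k E u 0 k * pd b (fun y => g y k a) u
     - \sum_k E u 0 k * pd k (fun y => g y a b) u).
  rewrite -big_split -sumrB /= mulr_sumr.
  under eq_bigr => c _ do rewrite /christoffel -mulrA mulr_suml mulr_sumr.
  rewrite exchange_big /=; apply: eq_bigr => d _.
  rewrite -!mulrDr -mulrBr -mulr_sumr; congr (_ * _).
  have -> : E u 0 d = \sum_c pd c f u * invmx (g u) c d.
    by rewrite /E /grad mxE; apply: eq_bigr => c _; rewrite mxE.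
  have e1 i j : pd i (fun y => g y j d) u = pd i (fun y => g y d j) u.
    by apply: (pd_eq_on i oU _ Uu) => v Uv; rewrite gS.
  rewrite mulr_suml; apply: eq_bigr => c _; rewrite !e1; ring.
rewrite -/E; set s1 := \sum_i _; set s2 := \sum_i _; set s3 := \sum_i _.
by field.
Qed.

Variables (h H : 'rV[R]_n -> 'M[R]_n) (lam f : 'rV[R]_n -> R).
Hypotheses (sh : smooth_mx_on U h) (uh : forall v, U v -> h v \in unitmx)
  (symh : forall v, U v -> (h v)^T = h v)
  (slam : smooth_on U lam) (lam_gt0 : forall v, U v -> 0 < lam v)
  (HE : forall v, U v -> H v = (lam v ^+ 2)^-1 *: h v).

(** [H] is [exp (- 2 L)] times [h], so the classical formulas for a conformal change hold with
    conformal exponent [- L]. *)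
Let L v := ln (lam v).

Lemma pd_ln (k : 'rV[R]_n -> R) a u : smooth_on U k -> (forall v, U v -> 0 < k v) ->
  U u -> pd a (fun v => ln (k v)) u = (k u)^-1 * pd a k u.
Proof.
move=> sk k0 Uu; apply: pd_comp1; first exact: smooth_differentiable oU sk Uu.
by apply: is_derive1_ln; exact: k0.
Qed.

Lemma conformal_pd a b c u : U u ->
  pd a (fun v => H v b c) u =
  (lam u ^+ 2)^-1 * (pd a (fun v => h v b c) u - 2 * pd a L u * h u b c).
Proof.
move=> Uu; have l0 := lt0r_neq0 (lam_gt0 Uu).
have dl : derivable lam u (delta_mx 0 a) by exact: smooth_derivable slam Uu.
have E v : U v -> H v b c = (lam v * lam v)^-1 * h v b c.
  by move=> Uv; rewrite HE // mxE expr2.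
rewrite (pd_eq_on a oU E Uu) pdM; last 2 first.
- apply: smooth_derivable (smoothV oU (smoothM oU slam slam) _) Uu.
  by move=> v Uv; rewrite mulf_neq0 // lt0r_neq0 // lam_gt0.
- exact: smooth_derivable (sh b c) Uu.
rewrite pdV; [|by rewrite mulf_neq0|exact: derivableM].
rewrite (pdM dl dl) /L pd_ln //.
move: (pd a lam u) (pd a _ u) => x y; field; exact: l0.
Qed.

Lemma conformal_invmx u : U u -> invmx (H u) = (lam u ^+ 2) *: invmx (h u).
Proof.
move=> Uu; rewrite HE // invmxZ ?invrK //.
by rewrite unitmxZ ?uh // unitfE invr_neq0 // expf_neq0 // lt0r_neq0 // lam_gt0.
Qed.

Lemma conformal_christoffel c a b u : U u ->
  christoffel H c a b u = christoffel h c a b u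
    - ((c == b)%:R * pd a L u + (c == a)%:R * pd b L u
       - \sum_d invmx (h u) c d * pd d L u * h u a b).
Proof.
move=> Uu; rewrite /christoffel conformal_invmx //.
have l0 := lt0r_neq0 (lam_gt0 Uu).
have I j k : \sum_d invmx (h u) j d * h u k d = (j == k)%:R.
  have := congr1 (fun M : 'M[R]_n => M j k) (mulVmx (uh Uu)); rewrite !mxE => <-.
  by apply: eq_bigr => d _; rewrite -{2}(symh Uu) mxE.
have -> : (c == b)%:R * pd a L u + (c == a)%:R * pd b L u
       - \sum_d invmx (h u) c d * pd d L u * h u a b =
  2^-1 * \sum_d (invmx (h u) c d * (2 * pd a L u * h u b d + 2 * pd b L u * h u a d
     - 2 * pd d L u * h u a b)).
  rewrite -!I !mulr_suml -big_split /= -sumrB mulr_sumr; apply: eq_bigr => d _.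
  move: (pd a L u) (pd b L u) (pd d L u) => x y z; by field.
rewrite -mulrBr -sumrB; congr (_ * _); apply: eq_bigr => d _.
rewrite !conformal_pd // [(_ *: invmx _) _ _]mxE.
move: (pd a L u) (pd b L u) (pd d L u) => x y z.
move: (pd a _ u) (pd b _ u) (pd d _ u) => x' y' z'.
field; exact: l0.
Qed.

(** The inner product, for [h], of the gradients of [L] and [f]. *)
Let S u := \sum_c \sum_d invmx (h u) c d * pd d L u * pd c f u.

Lemma conformal_hess a b u : U u ->
  hess H f u a b = hess h f u a b
    + (pd a L u * pd b f u + pd b L u * pd a f u) - S u * h u a b.
Proof.
move=> Uu; rewrite !mxE.
under eq_bigr => c _ do rewrite conformal_christoffel // mulrBl.
rewrite sumrB; set X := \sum_i christoffel _ _ _ _ _ * _.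
have -> : \sum_i ((i == b)%:R * pd a L u + (i == a)%:R * pd b L u -
      \sum_d invmx (h u) i d * pd d L u * h u a b) * pd i f u =
    pd a L u * pd b f u + pd b L u * pd a f u - S u * h u a b.
  under eq_bigr => i _ do rewrite mulrBl mulrDl.
  rewrite sumrB big_split /=; congr (_ + _ - _).
  - rewrite (bigD1 b) //= eqxx mul1r big1 ?addr0 // => i ib.
    by rewrite (negPf ib) !mul0r.
  - rewrite (bigD1 a) //= eqxx mul1r big1 ?addr0 // => i ia.
    by rewrite (negPf ia) !mul0r.
  - rewrite /S mulr_suml; apply: eq_bigr => c _; rewrite !mulr_suml.
    by apply: eq_bigr => d _; rewrite mulrAC.
move: (pd a (pd b f) u) X (_ + _) (S u * _) => x y z t; ring.
Qed.

End Conformal.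

(** * Conformal changes in dimension two *)

Section Conformal2.
Context {R : realType}.
Variables (U : set 'rV[R]_2) (h H : 'rV[R]_2 -> 'M[R]_2) (lam f : 'rV[R]_2 -> R).
Hypotheses (oU : open U)
  (sh : smooth_mx_on U h) (uh : forall v, U v -> h v \in unitmx)
  (symh : forall v, U v -> (h v)^T = h v)
  (slam : smooth_on U lam) (lam_gt0 : forall v, U v -> 0 < lam v)
  (HE : forall v, U v -> H v = (lam v ^+ 2)^-1 *: h v).

(** Only in dimension 2 do the first-order terms of [conformal_hess] cancel: the symmetric product
    of [dL] and [df] and the multiple of [h] both have trace twice the inner product of the
    gradients. *)
Lemma conformal_laplacian u : U u ->
  laplacian H f u = lam u ^+ 2 * laplacian h f u.
Proof.
move=> Uu; rewrite /laplacian (conformal_invmx uh lam_gt0 HE Uu).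
pose L v := ln (lam v); pose D := (dif L u : 'rV_2); pose F := dif f u.
have symi : (invmx (h u))^T = invmx (h u) by rewrite trmx_inv symh.
have -> : hess H f u = hess h f u + (D^T *m F + F^T *m D)
    - (F *m invmx (h u) *m D^T) 0 0 *: h u.
  apply/matrixP => a b.
  rewrite (conformal_hess oU f sh uh symh slam lam_gt0 HE a b Uu).
  have mD (X Y Z : 'M[R]_2) : (X + Y - Z) a b = X a b + Y a b - Z a b.
    by rewrite !mxE.
  rewrite mD; congr (_ + _ - _).
    by rewrite !mxE !big_ord1 !mxE [X in _ + X = _]mulrC.
  rewrite [(_ *: h u) a b]mxE; congr (_ * _).
  rewrite mxE exchange_big /=; apply: eq_bigr => d _.
  rewrite [_^T _ _]mxE [D _ _]mxE [(F *m _) _ _]mxE mulr_suml.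
  by apply: eq_bigr => c _; rewrite [F _ _]mxE mulrC mulrA.
rewrite -scalemxAl mxtraceZ mulmxBr mulmxDr linearB /= mxtraceD.
rewrite mulmxDr mxtraceD -scalemxAr mulVmx ?uh // mxtraceZ mxtrace1.
have tr1 (X : 'M[R]_1) : \tr X = X 0 0 by rewrite /mxtrace big_ord1.
have e1 : \tr (invmx (h u) *m (F^T *m D)) = (F *m invmx (h u) *m D^T) 0 0.
  rewrite mulmxA mxtrace_mulC tr1.
  have -> : D *m (invmx (h u) *m F^T) = (F *m invmx (h u) *m D^T)^T.
    by rewrite !trmx_mul symi trmxK.
  by rewrite mxE.
have e2 : \tr (invmx (h u) *m (D^T *m F)) = (F *m invmx (h u) *m D^T) 0 0.
  by rewrite mulmxA mxtrace_mulC mulmxA tr1.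
rewrite e1 e2; move: (_ 0 0) (\tr _) => x y; ring.
Qed.

(* Condition (u) of the ansatz for constant [rho] says that the Hessian of
   [f = ln nu] for [lam^-2 h] is a multiple of the metric. *)
Lemma conformal_hess_scalar u al : U u ->
  hess h f u + 2 *: odot (dif (fun v => ln (lam v)) u) (dif f u) = al *: h u ->
  hess H f u = (2^-1 * laplacian H f u) *: H u.
Proof.
move=> Uu E.
have [k HH] : exists k, hess H f u = k *: H u.
  have l0 := lt0r_neq0 (lam_gt0 Uu).
  (* Unification fills the hole with the inner product of the gradients of [ln lam] and [f]. *)
  eexists (lam u ^+ 2 * (al - _)); apply/matrixP => a b.
  rewrite (conformal_hess oU f sh uh symh slam lam_gt0 HE a b Uu).
  have oE (v w : 'rV[R]_2) : (2 *: odot v w) a b = v 0 a * w 0 b + v 0 b * w 0 a.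
    by rewrite !mxE !big_ord1 !mxE mulVKf // [X in _ + X]mulrC.
  have := congr1 (fun M : 'M[R]_2 => M a b) E.
  rewrite [LHS]mxE oE ![dif _ _ _ _]mxE => ->.
  have zE (k : R) (M : 'M[R]_2) : (k *: M) a b = k * M a b by rewrite mxE.
  rewrite HE // !zE -mulrBl mulrA; congr (_ * _).
  by rewrite mulrAC mulfV ?mul1r // expf_neq0.
rewrite HH; congr (_ *: _).
have uH : H u \in unitmx.
  by rewrite HE // unitmxZ ?uh // unitfE invr_neq0 // expf_neq0 // lt0r_neq0 // lam_gt0.
by rewrite /laplacian HH -scalemxAr mulVmx // mxtraceZ mxtrace1; field.
Qed.

End Conformal2.

(** * Surfaces *)

Lemma big_ord2 (V : nmodType) (F : 'I_2 -> V) : \sum_i F i = F 0 + F 1.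
Proof.
rewrite !big_ord_recl big_ord0 addr0; congr (F _ + F _); exact: val_inj.
Qed.

Lemma ord2P (P : 'I_2 -> Prop) : P 0 -> P 1 -> forall i, P i.
Proof.
by move=> P0 P1 [[|[|//]] i2]; [have -> : Ordinal i2 = 0 by exact: val_inj
  |have -> : Ordinal i2 = 1 by exact: val_inj].
Qed.

Definition mx22 (R : Type) (x y z t : R) : 'M[R]_2 :=
  \matrix_(i, j) if i == 0 then if j == 0 then x else y
                 else if j == 0 then z else t.

Lemma det_mx22 (R : comNzRingType) (M : 'M[R]_2) :
  \det M = M 0 0 * M 1 1 - M 0 1 * M 1 0.
Proof.
rewrite (expand_det_row _ 0) big_ord2 /cofactor !det_mx11 !mxE /=.
have -> : lift 0 0 = 1 :> 'I_2 by exact: val_inj.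
have -> : lift 1 0 = 0 :> 'I_2 by exact: val_inj.
by rewrite /= expr0 expr1; ring.
Qed.

(* An oriented coframe [e1 = p dx + q dy], [e2 = r dy]; its connection form
   [w] is determined by [d e1 = w /\ e2] and [d e2 = - w /\ e1]. *)
Section SurfaceFrame.
Context {R : realType}.
Implicit Types (p q r f : 'rV[R]_2 -> R).

Definition conn0 p q r u : R := (pd 0 q u - pd 1 p u) / r u.

Definition conn1 p q r u : R := (q u * conn0 p q r u + pd 0 r u) / p u.

(** Solves [d w = - K e1 /\ e2] for [K], with [e1 /\ e2 = p r dx /\ dy]. *)
Definition frame_gauss p q r u : R :=
  - (pd 0 (conn1 p q r) u - pd 1 (conn0 p q r) u) / (p u * r u).

(** With [frame_coef1], the components of [df] in the coframe [(e1, e2)]. *)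
Definition frame_coef0 p f u : R := pd 0 f u / p u.

Definition frame_coef1 p q r f u : R := (p u * pd 1 f u - q u * pd 0 f u) / (p u * r u).

Variables (U : set 'rV[R]_2) (p q r : 'rV[R]_2 -> R) (g : 'rV[R]_2 -> 'M[R]_2).
Hypotheses (oU : open U) (sp : smooth_on U p) (sq : smooth_on U q)
  (sr : smooth_on U r) (p0 : forall u, U u -> p u != 0)
  (r0 : forall u, U u -> r u != 0).

Lemma smooth_conn0 : smooth_on U (conn0 p q r).
Proof.
apply: smoothM oU _ (smoothV oU sr r0).
exact: smoothB oU (smooth_pd 0 sq) (smooth_pd 1 sp).
Qed.

Lemma smooth_conn1 : smooth_on U (conn1 p q r).
Proof.
apply: smoothM oU _ (smoothV oU sp p0).
exact: smoothD oU (smoothM oU sq smooth_conn0) (smooth_pd 0 sr).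
Qed.

Lemma smooth_frame_coef0 f : smooth_on U f -> smooth_on U (frame_coef0 p f).
Proof. by move=> sf; exact: smoothM oU (smooth_pd 0 sf) (smoothV oU sp p0). Qed.

Lemma smooth_frame_coef1 f : smooth_on U f -> smooth_on U (frame_coef1 p q r f).
Proof.
move=> sf; apply: smoothM oU _ (smoothV oU (smoothM oU sp sr) _).
  apply: smoothB oU (smoothM oU sp (smooth_pd 1 sf)) _.
  exact: smoothM oU sq (smooth_pd 0 sf).
by move=> u Uu; rewrite mulf_neq0 ?p0 ?r0.
Qed.

Let e u := mx22 (p u) (q u) 0 (r u).
Let om (a : 'I_2) u :=
  let w := if a == 0 then conn0 p q r u else conn1 p q r u in mx22 0 (- w) w 0.

Hypothesis gE : forall u, U u -> g u = (e u)^T *m e u.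

Let eE i j : (fun v => e v i j) =
  if i == 0 then if j == 0 then p else q else if j == 0 then (fun=> 0) else r.
Proof. by apply/funext => v; rewrite mxE; case: ifP => _; case: ifP. Qed.

Let omE a i j : (fun v => om a v i j) =
  let w := if a == 0 then conn0 p q r else conn1 p q r in
  if i == 0 then if j == 0 then (fun=> 0) else (fun v => - w v)
  else if j == 0 then w else (fun=> 0).
Proof.
apply/funext => v; rewrite mxE /=.
by case: (i == 0); case: (j == 0) => //; case: (a == 0).
Qed.

Let se : smooth_mx_on U e.
Proof.
move=> i j; rewrite eE; case: (i == 0); case: (j == 0).
- exact: sp.
- exact: sq.
- exact: smooth_cst.
- exact: sr.
Qed.

Let som a : smooth_mx_on U (om a).
Proof.
have sw : smooth_on U (if a == 0 then conn0 p q r else conn1 p q r).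
  by case: (a == 0); [exact: smooth_conn0|exact: smooth_conn1].
move=> i j; rewrite omE /=; case: (i == 0); case: (j == 0).
- exact: smooth_cst.
- exact: smoothN.
- exact: sw.
- exact: smooth_cst.
Qed.

Let ue u : U u -> e u \in unitmx.
Proof.
move=> Uu; rewrite unitmxE unitfE det_mx22 !mxE /= mulr0 subr0.
by rewrite mulf_neq0 ?p0 ?r0.
Qed.

Let om_anti a u : U u -> (om a u)^T = - om a u.
Proof.
by move=> _; apply/matrixP; elim/ord2P; elim/ord2P; rewrite !mxE /= ?oppr0 ?opprK.
Qed.

Let torsion01 u : U u ->
  col 1 (pdmx 0 e u + om 0 u *m e u) = col 0 (pdmx 1 e u + om 1 u *m e u).
Proof.
move=> Uu; apply/matrixP => k j; rewrite ![col _ _ _ _]mxE.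
have TE a b : (pdmx a e u + om a u *m e u) k b = pd a (fun v => e v k b) u +
    (om a u k 0 * e u 0 b + om a u k 1 * e u 1 b).
  by rewrite mxE; congr (_ + _); [rewrite mxE|rewrite mxE big_ord2].
rewrite !TE !eE ; move: TE => _; elim/ord2P: k; rewrite !mxE /=.
  by rewrite !(mul0r, mulr0, add0r, addr0) mulNr divfK ?r0 // opprB addrC subrK.
rewrite !(mul0r, mulr0, add0r, addr0) pd_cst add0r divfK ?p0 //.
by rewrite addrC mulrC.
Qed.

Let om_torsion a b u : U u ->
  col b (pdmx a e u + om a u *m e u) = col a (pdmx b e u + om b u *m e u).
Proof.
move=> Uu; elim/ord2P: a; elim/ord2P: b => //; first exact: torsion01.
by apply/esym; exact: torsion01.
Qed.

(** Antisymmetric matrices of size 2 commute, so [om /\ om = 0] and the curvature matrix has the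
    single independent entry [d w], a multiple of [e1 /\ e2]. *)
Lemma surface_space_form u : U u -> space_form g (frame_gauss p q r u) u.
Proof.
move=> Uu d c a b.
apply: (frame_space_form oU se som ue om_anti om_torsion gE d c Uu) => k l.
have D w : smooth_on U w -> forall i, derivable w u (delta_mx 0 i).
  by move=> sw i; exact: smooth_derivable sw Uu.
rewrite /curvature_form !mxE !big_ord2 !omE /frame_gauss.
have d0 := D _ smooth_conn0; have d1 := D _ smooth_conn1.
elim/ord2P: a; elim/ord2P: b; elim/ord2P: k; elim/ord2P: l;
  rewrite !mxE /= ?pd_cst ?(pdN (d0 _)) ?(pdN (d1 _));
  move: (pd 0 (conn1 p q r) u) (pd 1 (conn0 p q r) u) (pd 0 (conn0 p q r) u)
    (pd 1 (conn1 p q r) u) => x y z t; by field; rewrite ?p0 ?r0.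
Qed.

Lemma surface_hess f a b u : smooth_on U f -> U u ->
  let w := if a == 0 then conn0 p q r u else conn1 p q r u in
  hess g f u a b =
    (pd a (frame_coef0 p f) u - frame_coef1 p q r f u * w) * (if b == 0 then p u else q u) +
    (pd a (frame_coef1 p q r f) u + frame_coef0 p f u * w) * (if b == 0 then 0 else r u).
Proof.
move=> sf Uu w.
pose ph (k : 'I_2) := if k == 0 then frame_coef0 p f else frame_coef1 p q r f.
have sph k : smooth_on U (ph k).
  by rewrite /ph; case: (k == 0); [exact: smooth_frame_coef0|exact: smooth_frame_coef1].
have fE v c : U v -> pd c f v = \sum_k ph k v * e v k c.
  move=> Uv; rewrite big_ord2 /ph /= /frame_coef0 /frame_coef1.
  elim/ord2P: c; rewrite !mxE /=; move: (pd 0 f v) (pd 1 f v) => x y;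
    by field; rewrite ?p0 ?r0.
rewrite (frame_hess oU se ue om_anti om_torsion gE a b Uu sph fE).
rewrite !big_ord2 /ph /= !mxE /= -/w.
by congr (_ * _ + _ * _); rewrite ?mulr0 ?add0r ?addr0 ?mulrN ?opprK.
Qed.

Let invg u : U u -> invmx (g u) =
  ((p u * r u) ^+ 2)^-1 *: mx22 (q u ^+ 2 + r u ^+ 2) (- (p u * q u))
                              (- (p u * q u)) (p u ^+ 2).
Proof.
move=> Uu; have ug : g u \in unitmx by rewrite gE // unitmx_mul unitmx_tr ue.
apply: (can_inj (mulKmx ug)); rewrite mulmxV // gE //.
apply/matrixP; elim/ord2P; elim/ord2P; rewrite !mxE !big_ord2 !mxE !big_ord2 !mxE /=;
  by field; rewrite ?p0 ?r0.
Qed.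

(** Scaling the coframe by [lam] adds to [w] the Hodge dual of [d ln lam] (this is [c0E] and [c1E]),
    whose exterior derivative is the Laplacian of [ln lam] times the area form of [g]. The division
    by [lam ^+ 2] rescales the area form. *)
Lemma frame_gauss_conformal lam u : smooth_on U lam ->
  (forall v, U v -> 0 < lam v) -> U u ->
  frame_gauss (fun v => lam v * p v) (fun v => lam v * q v) (fun v => lam v * r v) u
  = (frame_gauss p q r u - laplacian g (fun v => ln (lam v)) u) / lam u ^+ 2.
Proof.
move=> sl lam_gt0 Uu; pose L v := ln (lam v).
have sL : smooth_on U L by exact: smooth_ln.
have l0 v : U v -> lam v != 0 by move=> /lam_gt0/lt0r_neq0.
have D w v : smooth_on U w -> U v -> forall i, derivable w v (delta_mx 0 i).
  by move=> sw Uv i; exact: smooth_derivable sw Uv.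
have dlam v i : U v -> pd i lam v = lam v * pd i L v.
  by move=> Uv; rewrite /L (pd_ln oU _ sl) // mulVKf // l0.
have c0E v : U v ->
    conn0 (fun v => lam v * p v) (fun v => lam v * q v) (fun v => lam v * r v) v
    = conn0 p q r v - p v * frame_coef1 p q r L v.
  move=> Uv; rewrite /conn0 /frame_coef1 !pdM ?dlam //; try exact: D.
  move: (pd 0 L v) (pd 1 L v) (pd 0 q v) (pd 1 p v) => x y z t.
  by field; rewrite ?p0 ?r0 ?l0.
have c1E v : U v ->
    conn1 (fun v => lam v * p v) (fun v => lam v * q v) (fun v => lam v * r v) v
    = conn1 p q r v + (r v * frame_coef0 p L v - q v * frame_coef1 p q r L v).
  move=> Uv; rewrite /conn1 c0E // pdM ?dlam //; try exact: D.
  rewrite /frame_coef1 /frame_coef0; move: (conn0 p q r v) => c.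
  move: (pd 0 L v) (pd 1 L v) (pd 0 r v) => x y z.
  by field; rewrite ?p0 ?r0 ?l0.
rewrite {1}/frame_gauss (pd_eq_on 0 oU c1E Uu) (pd_eq_on 1 oU c0E Uu).
have sph0 := smooth_frame_coef0 sL; have sph1 := smooth_frame_coef1 sL.
have s1 := smoothM oU sr sph0; have s2 := smoothM oU sq sph1.
rewrite (pdD (D _ _ smooth_conn1 Uu 0) (D _ _ (smoothB oU s1 s2) Uu 0)).
rewrite (pdB (D _ _ s1 Uu 0) (D _ _ s2 Uu 0)).
rewrite (pdB (D _ _ smooth_conn0 Uu 1) (D _ _ (smoothM oU sp sph1) Uu 1)).
rewrite (pdM (D _ _ sr Uu 0) (D _ _ sph0 Uu 0)) (pdM (D _ _ sq Uu 0) (D _ _ sph1 Uu 0)).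
rewrite (pdM (D _ _ sp Uu 1) (D _ _ sph1 Uu 1)).
rewrite /laplacian invg // -scalemxAl mxtraceZ /mxtrace big_ord2 !mxE !big_ord2.
have HS a b := surface_hess a b sL Uu.
rewrite -/L !HS /= !mxE /= /frame_gauss.
have e0 : conn0 p q r u * r u = pd 0 q u - pd 1 p u by rewrite /conn0 divfK ?r0.
have e1 : conn1 p q r u * p u = q u * conn0 p q r u + pd 0 r u.
  by rewrite /conn1 divfK ?p0.
have -> : pd 0 q u = conn0 p q r u * r u + pd 1 p u by rewrite e0 subrK.
have -> : pd 0 r u = conn1 p q r u * p u - q u * conn0 p q r u.
  by rewrite e1 [X in X - _]addrC addrK.
move: (pd 0 (conn1 p q r) u) (pd 1 (conn0 p q r) u) (conn0 p q r u) (conn1 p q r u)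
  (pd 1 p u) => x1 x2 x3 x4 x5.
move: (pd 0 (frame_coef0 p L) u) (pd 0 (frame_coef1 p q r L) u) (pd 1 (frame_coef0 p L) u)
  (pd 1 (frame_coef1 p q r L) u) => y1 y2 y3 y4.
move: (frame_coef0 p L u) (frame_coef1 p q r L u) => z1 z2.
by field; rewrite ?p0 ?r0 ?l0.
Qed.

(* Ricci identity: a function whose Hessian is a constant multiple of the
   metric has a gradient annihilated by the curvature. *)
Lemma frame_gauss_hess_const f kappa u : smooth_on U f ->
  (forall v, U v -> hess g f v = kappa *: g v) -> U u ->
  frame_gauss p q r u * frame_coef0 p f u = 0 /\
  frame_gauss p q r u * frame_coef1 p q r f u = 0.
Proof.
move=> sf Hf Uu.
have D w v : smooth_on U w -> U v -> forall i, derivable w v (delta_mx 0 i).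
  by move=> sw Uv i; exact: smooth_derivable sw Uv.
have sc0 := smooth_conn0; have sc1 := smooth_conn1.
have sph0 := smooth_frame_coef0 sf; have sph1 := smooth_frame_coef1 sf.
have HE a b v : U v -> hess g f v a b = kappa * g v a b.
  by move=> Uv; rewrite Hf // mxE.
(* Writing [df = f1 e1 + f2 e2], the Hessian equation amounts to [d f1 = f2 w + kappa e1] and
   [d f2 = - f1 w + kappa e2]. In [d d f2 = 0] and [d d f1 = 0] the terms in [kappa] cancel by the
   structure equations, which leaves [f1 d w = 0] and [f2 d w = 0]. *)
have P00 v : U v -> pd 0 (frame_coef0 p f) v =
    frame_coef1 p q r f v * conn0 p q r v + kappa * p v.
  move=> Uv; have := HE 0 0 v Uv.
  rewrite (surface_hess _ _ sf Uv) (gE Uv) /= !mxE !big_ord2 !mxE /=.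
  move: (pd _ _ _) (pd _ _ _) => x y H.
  by apply: (mulIf (p0 Uv)); lra.
have P10 v : U v -> pd 1 (frame_coef0 p f) v =
    frame_coef1 p q r f v * conn1 p q r v + kappa * q v.
  move=> Uv; have := HE 1 0 v Uv.
  rewrite (surface_hess _ _ sf Uv) (gE Uv) /= !mxE !big_ord2 !mxE /=.
  move: (pd _ _ _) (pd _ _ _) => x y H.
  by apply: (mulIf (p0 Uv)); lra.
have P01 v : U v -> pd 0 (frame_coef1 p q r f) v =
    - (frame_coef0 p f v * conn0 p q r v).
  move=> Uv; have := HE 0 1 v Uv.
  rewrite (surface_hess _ _ sf Uv) (gE Uv) /= !mxE !big_ord2 !mxE /=.
  rewrite P00 //; move: (pd _ _ _) => x H.
  by apply: (mulIf (r0 Uv)); lra.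
have P11 v : U v -> pd 1 (frame_coef1 p q r f) v =
    - (frame_coef0 p f v * conn1 p q r v) + kappa * r v.
  move=> Uv; have := HE 1 1 v Uv.
  rewrite (surface_hess _ _ sf Uv) (gE Uv) /= !mxE !big_ord2 !mxE /=.
  rewrite P10 //; move: (pd _ _ _) => x H.
  by apply: (mulIf (r0 Uv)); lra.
have e0 : conn0 p q r u * r u = pd 0 q u - pd 1 p u by rewrite /conn0 divfK ?r0.
have e1 : conn1 p q r u * p u = q u * conn0 p q r u + pd 0 r u.
  by rewrite /conn1 divfK ?p0.
have Z f' i : smooth_on U f' -> pd i (fun v => kappa * f' v) u = kappa * pd i f' u.
  by move=> sf'; rewrite pdZ //; exact: D.
have pr0 : p u * r u != 0 by rewrite mulf_neq0 ?p0 ?r0.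
split.
- have := pd_pd_comm 0 1 oU sph1 Uu.
  rewrite (pd_eq_on 0 oU P11 Uu) (pd_eq_on 1 oU P01 Uu).
  have s0 := smoothM oU sph0 sc0; have s1 := smoothM oU sph0 sc1.
  rewrite (pdD (D _ _ (smoothN oU s1) Uu 0) (D _ _ (smoothZ kappa oU sr) Uu 0)).
  rewrite (Z _ 0 sr) (pdN (D _ _ s1 Uu 0)) (pdN (D _ _ s0 Uu 1)).
  rewrite (pdM (D _ _ sph0 Uu 0) (D _ _ sc1 Uu 0)) (pdM (D _ _ sph0 Uu 1) (D _ _ sc0 Uu 1)).
  rewrite P00 // P10 // /frame_gauss.
  have -> : pd 0 r u = conn1 p q r u * p u - q u * conn0 p q r u.
    by rewrite e1 [X in X - _]addrC addrK.
  move: (pd 0 (conn1 p q r) u) (pd 1 (conn0 p q r) u) (conn0 p q r u) (conn1 p q r u)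
    (frame_coef0 p f u) (frame_coef1 p q r f u) => x1 x2 x3 x4 x5 x6 H.
  have -> : - (x1 - x2) / (p u * r u) * x5 = (x2 - x1) * x5 / (p u * r u) by ring.
  by apply/eqP; rewrite mulf_eq0 invr_eq0 (negPf pr0) orbF; apply/eqP; lra.
- have := pd_pd_comm 0 1 oU sph0 Uu.
  rewrite (pd_eq_on 0 oU P10 Uu) (pd_eq_on 1 oU P00 Uu).
  have s0 := smoothM oU sph1 sc0; have s1 := smoothM oU sph1 sc1.
  rewrite (pdD (D _ _ s1 Uu 0) (D _ _ (smoothZ kappa oU sq) Uu 0)).
  rewrite (pdD (D _ _ s0 Uu 1) (D _ _ (smoothZ kappa oU sp) Uu 1)).
  rewrite (Z _ 0 sq) (Z _ 1 sp).
  rewrite (pdM (D _ _ sph1 Uu 0) (D _ _ sc1 Uu 0)) (pdM (D _ _ sph1 Uu 1) (D _ _ sc0 Uu 1)).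
  rewrite P01 // P11 // /frame_gauss.
  have -> : pd 0 q u = conn0 p q r u * r u + pd 1 p u by rewrite e0 subrK.
  move: (pd 0 (conn1 p q r) u) (pd 1 (conn0 p q r) u) (conn0 p q r u) (conn1 p q r u)
    (frame_coef0 p f u) (frame_coef1 p q r f u) (pd 1 p u) => x1 x2 x3 x4 x5 x6 x7 H.
  have -> : - (x1 - x2) / (p u * r u) * x6 = (x2 - x1) * x6 / (p u * r u) by ring.
  by apply/eqP; rewrite mulf_eq0 invr_eq0 (negPf pr0) orbF; apply/eqP; lra.
Qed.

End SurfaceFrame.

(** * Three-dimensional coframes *)

Lemma big_ord3 (V : nmodType) (F : 'I_3 -> V) : \sum_i F i = F 0 + F 1 + F 2%:R.
Proof.
rewrite !big_ord_recl big_ord0 addr0 addrA; congr (F _ + F _ + F _); exact: val_inj.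
Qed.

Lemma ord3P (P : 'I_3 -> Prop) : P 0 -> P 1 -> P 2%:R -> forall i, P i.
Proof.
by move=> P0 P1 P2 [[|[|[|//]]] i3]; [have -> : Ordinal i3 = 0 by exact: val_inj
  |have -> : Ordinal i3 = 1 by exact: val_inj
  |have -> : Ordinal i3 = 2%:R by exact: val_inj].
Qed.

Lemma gram_posdef (R : realType) (n : nat) (e : 'M[R]_n) :
  e \in unitmx -> posdef (e^T *m e).
Proof.
move=> ue; split=> [|v v0]; first by rewrite trmx_mul trmxK.
have -> : inner (e^T *m e) v v = \sum_k (v *m e^T) 0 k ^+ 2.
  rewrite /inner mulmxA -[_ *m e *m _]mulmxA -[e *m v^T]trmxK trmx_mul trmxK mxE.
  by apply: eq_bigr => k _; rewrite [_^T _ _]mxE expr2.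
rewrite lt_neqAle sumr_ge0 ?andbT => [|k _]; last exact: sqr_ge0.
rewrite eq_sym psumr_eq0 => [|k _]; last exact: sqr_ge0.
apply: contra v0 => /allP H; rewrite -[v](@mulmxK _ _ _ e^T) ?unitmx_tr //.
suff -> : v *m e^T = 0 by rewrite mul0mx.
apply/rowP => k; rewrite [RHS]mxE; apply/eqP; rewrite -sqrf_eq0.
by have := H k; rewrite mem_index_enum => /(_ isT).
Qed.

(* Coframe [e1, e2, t] with structure equations [d e1 = w /\ e2],
   [d e2 = - w /\ e1], [d w = - K e1 /\ e2] and [d t = c e1 /\ e2]. *)
Section ContactFrame.
Context {R : realType}.
Variables (U : set 'rV[R]_3) (e1 e2 t w : 'I_3 -> 'rV[R]_3 -> R) (c K : R).
Hypotheses (oU : open U)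
  (se1 : forall a, smooth_on U (e1 a)) (se2 : forall a, smooth_on U (e2 a))
  (st : forall a, smooth_on U (t a)) (sw : forall a, smooth_on U (w a))
  (S1 : forall a b u, U u -> pd a (e1 b) u - pd b (e1 a) u =
     w a u * e2 b u - w b u * e2 a u)
  (S2 : forall a b u, U u -> pd a (e2 b) u - pd b (e2 a) u =
     w b u * e1 a u - w a u * e1 b u)
  (S3 : forall a b u, U u -> pd a (t b) u - pd b (t a) u =
     c * (e1 a u * e2 b u - e1 b u * e2 a u))
  (S4 : forall a b u, U u -> pd a (w b) u - pd b (w a) u =
     - K * (e1 a u * e2 b u - e1 b u * e2 a u)).

(** Tabulated by [nth], so that case analysis on the indices reduces every entry by computation; the
    default value is never reached. *)
Definition contact_frame u : 'M[R]_3 :=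
  \matrix_(k, a) nth 0 [:: e1 a u; e2 a u; t a u] k.

(** With the matrix [om] below, the structure equations of [e1] and [e2] hold for every [x]; the one
    of [t] forces [c + 2 * x = 0]. *)
Let x : R := - c / 2.

(* Levi-Civita connection of the metric making the coframe orthonormal. *)
Let om (a : 'I_3) u : 'M[R]_3 := \matrix_(k, l) nth 0 (nth [::]
  [:: [:: 0; x * t a u - w a u; x * e2 a u];
      [:: w a u - x * t a u; 0; - x * e1 a u];
      [:: - x * e2 a u; x * e1 a u; 0]] k) l.

Let d_om b (a : 'I_3) u : 'M[R]_3 := \matrix_(k, l) nth 0 (nth [::]
  [:: [:: 0; x * pd b (t a) u - pd b (w a) u; x * pd b (e2 a) u];
      [:: pd b (w a) u - x * pd b (t a) u; 0; - x * pd b (e1 a) u];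
      [:: - x * pd b (e2 a) u; x * pd b (e1 a) u; 0]] k) l.

Let der f a u : smooth_on U f -> U u -> derivable f u (delta_mx 0 a).
Proof. by move=> sf Uu; exact: smooth_derivable sf Uu. Qed.

Let pdmx_om a b u : U u -> pdmx b (om a) u = d_om b a u.
Proof.
move=> Uu; apply/matrixP => k l; rewrite [LHS]mxE [RHS]mxE.
have -> : (fun v => om a v k l) = (fun v => nth 0 (nth [::]
  [:: [:: 0; x * t a v - w a v; x * e2 a v];
      [:: w a v - x * t a v; 0; - x * e1 a v];
      [:: - x * e2 a v; x * e1 a v; 0]] k) l).
  by apply/funext => v; rewrite mxE.
have dt := der (a := b) (st a) Uu; have dw := der (a := b) (sw a) Uu.
have d1 := der (a := b) (se1 a) Uu; have d2 := der (a := b) (se2 a) Uu.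
have xt := der (a := b) (smoothZ x oU (st a)) Uu.
elim/ord3P: k; elim/ord3P: l; rewrite /= ?pd_cst //.
- by rewrite (pdB xt dw) (pdZ x dt).
- by rewrite (pdZ x d2).
- by rewrite (pdB dw xt) (pdZ x dt).
- by rewrite (pdZ (- x) d1).
- by rewrite (pdZ (- x) d2).
- by rewrite (pdZ x d1).
Qed.

Let frameE k a : (fun v => contact_frame v k a) = nth (fun=> 0) [:: e1 a; e2 a; t a] k.
Proof.
by apply/funext => v; rewrite mxE; elim/ord3P: k.
Qed.

Lemma smooth_contact_frame : smooth_mx_on U contact_frame.
Proof.
move=> k a; rewrite frameE; elim/ord3P: k => /=;
  [exact: se1|exact: se2|exact: st].
Qed.

Let som a : smooth_mx_on U (om a).
Proof.
move=> k l.
have -> : (fun v => om a v k l) = (fun v => nth 0 (nth [::]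
  [:: [:: 0; x * t a v - w a v; x * e2 a v];
      [:: w a v - x * t a v; 0; - x * e1 a v];
      [:: - x * e2 a v; x * e1 a v; 0]] k) l).
  by apply/funext => v; rewrite mxE.
elim/ord3P: k; elim/ord3P: l => /=.
- exact: smooth_cst.
- exact: smoothB oU (smoothZ x oU (st a)) (sw a).
- exact: smoothZ oU (se2 a).
- exact: smoothB oU (sw a) (smoothZ x oU (st a)).
- exact: smooth_cst.
- exact: smoothZ oU (se1 a).
- exact: smoothZ oU (se2 a).
- exact: smoothZ oU (se1 a).
- exact: smooth_cst.
Qed.

Let om_anti a u : U u -> (om a u)^T = - om a u.
Proof.
move=> _; apply/matrixP; elim/ord3P; elim/ord3P; rewrite !mxE /=; ring.
Qed.

Let om_torsion a b u : U u ->
  col b (pdmx a contact_frame u + om a u *m contact_frame u) =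
  col a (pdmx b contact_frame u + om b u *m contact_frame u).
Proof.
move=> Uu; apply/matrixP => k j; rewrite ![col _ _ _ _]mxE.
have TE i l : (pdmx i contact_frame u + om i u *m contact_frame u) k l =
    pd i (fun v => contact_frame v k l) u +
    (om i u k 0 * e1 l u + om i u k 1 * e2 l u + om i u k 2%:R * t l u).
  rewrite mxE; congr (_ + _); first by rewrite mxE.
  by rewrite mxE big_ord3 ![contact_frame u _ l]mxE.
rewrite !TE !frameE; move: (S1 a b Uu) (S2 a b Uu) (S3 a b Uu) => {TE}.
elim/ord3P: k; rewrite !mxE /=;
  move: (pd a (e1 b) u) (pd b (e1 a) u) (pd a (e2 b) u) (pd b (e2 a) u)
    (pd a (t b) u) (pd b (t a) u) => z1 z2 z3 z4 z5 z6 H1 H2 H3;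
  apply/eqP; rewrite -subr_eq0; apply/eqP.
- by rewrite (_ : z1 = z2 + (w a u * e2 b u - w b u * e2 a u)); [rewrite /x; field|lra].
- by rewrite (_ : z3 = z4 + (w b u * e1 a u - w a u * e1 b u)); [rewrite /x; field|lra].
- by rewrite (_ : z5 = z6 + c * (e1 a u * e2 b u - e1 b u * e2 a u)); [rewrite /x; field|lra].
Qed.

Variable g : 'rV[R]_3 -> 'M[R]_3.
Hypotheses (uframe : forall u, U u -> contact_frame u \in unitmx)
  (gE : forall u, U u -> g u = (contact_frame u)^T *m contact_frame u).

(** The plane orthogonal to the fibres has curvature [K - 3 c^2 / 4] and the planes containing the
    fibre direction have curvature [c^2 / 4]; these agree exactly when [K = c^2]. *)
Lemma contact_space_form u : K = c ^+ 2 -> U u -> space_form g (c ^+ 2 / 4) u.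
Proof.
move=> Kc Uu d' c' a b.
apply: (frame_space_form oU smooth_contact_frame som uframe om_anti om_torsion gE
  d' c' Uu) => k l.
rewrite /curvature_form !pdmx_om //.
have CE : (d_om a b u - d_om b a u + om a u *m om b u - om b u *m om a u) k l =
    d_om a b u k l - d_om b a u k l
    + (om a u k 0 * om b u 0 l + om a u k 1 * om b u 1 l + om a u k 2%:R * om b u 2%:R l)
    - (om b u k 0 * om a u 0 l + om b u k 1 * om a u 1 l + om b u k 2%:R * om a u 2%:R l).
  rewrite mxE; congr (_ + _); last by rewrite mxE mxE big_ord3.
  rewrite mxE; congr (_ + _); last by rewrite mxE big_ord3.
  by rewrite mxE; congr (_ + _); rewrite mxE.
rewrite {}CE ![contact_frame u _ _]mxE.
move: (S1 a b Uu) (S2 a b Uu) (S3 a b Uu) (S4 a b Uu); rewrite Kc.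
rewrite !mxE; set z1 := pd a (e1 b) u; set z2 := pd b (e1 a) u;
  set z3 := pd a (e2 b) u; set z4 := pd b (e2 a) u;
  set z5 := pd a (t b) u; set z6 := pd b (t a) u;
  set z7 := pd a (w b) u; set z8 := pd b (w a) u.
move: z1 z2 z3 z4 z5 z6 z7 z8 => z1 z2 z3 z4 z5 z6 z7 z8.
move: (e1 a u) (e1 b u) (e2 a u) (e2 b u) (t a u) (t b u) (w a u) (w b u)
  => a1 b1 a2 b2 ta tb wa wb H1 H2 H3 H4.
have {H1}-> : z1 = z2 + (wa * b2 - wb * a2) by lra.
have {H2}-> : z3 = z4 + (wb * a1 - wa * b1) by lra.
have {H3}-> : z5 = z6 + c * (a1 * b2 - b1 * a2) by lra.
have {H4}-> : z7 = z8 + - c ^+ 2 * (a1 * b2 - b1 * a2) by lra.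
elim/ord3P: k; elim/ord3P: l => /=; rewrite /x; by field.
Qed.

End ContactFrame.

(** * Coordinates of Nil over a flat base *)

Section NilCoordinates.
Context {R : realType}.
Variables (U : set 'rV[R]_3) (e1 e2 t w : 'I_3 -> 'rV[R]_3 -> R) (c : R).
Hypotheses (oU : open U)
  (se1 : forall a, smooth_on U (e1 a)) (se2 : forall a, smooth_on U (e2 a))
  (st : forall a, smooth_on U (t a)) (sw : forall a, smooth_on U (w a))
  (S1 : forall a b u, U u -> pd a (e1 b) u - pd b (e1 a) u =
     w a u * e2 b u - w b u * e2 a u)
  (S2 : forall a b u, U u -> pd a (e2 b) u - pd b (e2 a) u =
     w b u * e1 a u - w a u * e1 b u)
  (S3 : forall a b u, U u -> pd a (t b) u - pd b (t a) u =
     c * (e1 a u * e2 b u - e1 b u * e2 a u))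
  (S4 : forall a b u, U u -> pd a (w b) u = pd b (w a) u)
  (c0 : c != 0).

Let der f a u : smooth_on U f -> U u -> derivable f u (delta_mx 0 a).
Proof. by move=> sf Uu; exact: smooth_derivable sf Uu. Qed.

(* Rotating the coframe by a primitive of [w] makes it closed. *)
Lemma nil_closed_coframe u0 : U u0 ->
  exists (B : set 'rV[R]_3) (y1 y2 y3 : 'rV[R]_3 -> R),
    [/\ open B, B u0, B `<=` U,
        [/\ smooth_on B y1, smooth_on B y2 & smooth_on B y3] &
        forall u a b, B u ->
          pd a y1 u * pd b y1 u + pd a y2 u * pd b y2 u =
            e1 a u * e1 b u + e2 a u * e2 b u /\
          t a u = c * y1 u * pd a y2 u + pd a y3 u].
Proof.
move=> Uu0.
have [B1 [phi [oB1 B1u0 B1U sphi dphi]]] := poincare_lemma oU Uu0 sw S4.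
have sB1 f : smooth_on U f -> smooth_on B1 f by exact: smooth_sub B1U.
have sco := smooth_cos oB1 sphi; have ssi := smooth_sin oB1 sphi.
pose E1 a u := cos (phi u) * e1 a u - sin (phi u) * e2 a u.
pose E2 a u := sin (phi u) * e1 a u + cos (phi u) * e2 a u.
have sE1 a : smooth_on B1 (E1 a).
  exact: smoothB oB1 (smoothM oB1 sco (sB1 _ (se1 a))) (smoothM oB1 ssi (sB1 _ (se2 a))).
have sE2 a : smooth_on B1 (E2 a).
  exact: smoothD oB1 (smoothM oB1 ssi (sB1 _ (se1 a))) (smoothM oB1 sco (sB1 _ (se2 a))).
have pco a u : B1 u -> pd a (fun v => cos (phi v)) u = - sin (phi u) * w a u.
  move=> Bu; rewrite -(dphi a u Bu); apply: pd_comp1.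
  exact: smooth_differentiable oB1 sphi Bu.
have psi a u : B1 u -> pd a (fun v => sin (phi v)) u = cos (phi u) * w a u.
  move=> Bu; rewrite -(dphi a u Bu); apply: pd_comp1.
  exact: smooth_differentiable oB1 sphi Bu.
have derB f a u : smooth_on B1 f -> B1 u -> derivable f u (delta_mx 0 a).
  by move=> sf Bu; exact: smooth_derivable sf Bu.
have pE1 a b u : B1 u -> pd a (E1 b) u = - sin (phi u) * w a u * e1 b u
    + cos (phi u) * pd a (e1 b) u - (cos (phi u) * w a u * e2 b u
    + sin (phi u) * pd a (e2 b) u).
  move=> Bu; have Uu := B1U _ Bu.
  have dc := derB _ a _ sco Bu; have ds := derB _ a _ ssi Bu.
  have d1 := der (a := a) (se1 b) Uu; have d2 := der (a := a) (se2 b) Uu.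
  rewrite /E1 (pdB (derivableM dc d1) (derivableM ds d2)) (pdM dc d1) (pdM ds d2).
  by rewrite pco // psi.
have pE2 a b u : B1 u -> pd a (E2 b) u = cos (phi u) * w a u * e1 b u
    + sin (phi u) * pd a (e1 b) u + (- sin (phi u) * w a u * e2 b u
    + cos (phi u) * pd a (e2 b) u).
  move=> Bu; have Uu := B1U _ Bu.
  have dc := derB _ a _ sco Bu; have ds := derB _ a _ ssi Bu.
  have d1 := der (a := a) (se1 b) Uu; have d2 := der (a := a) (se2 b) Uu.
  rewrite /E2 (pdD (derivableM ds d1) (derivableM dc d2)) (pdM ds d1) (pdM dc d2).
  by rewrite pco // psi.
have cE1 a b u : B1 u -> pd a (E1 b) u = pd b (E1 a) u.
  move=> Bu; rewrite !pE1 //; move: (S1 a b (B1U _ Bu)) (S2 a b (B1U _ Bu)).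
  move: (pd a (e1 b) u) (pd b (e1 a) u) (pd a (e2 b) u) (pd b (e2 a) u)
    => z1 z2 z3 z4 H1 H2.
  rewrite (_ : z1 = z2 + (w a u * e2 b u - w b u * e2 a u)); last by lra.
  by rewrite (_ : z3 = z4 + (w b u * e1 a u - w a u * e1 b u)); [ring|lra].
have cE2 a b u : B1 u -> pd a (E2 b) u = pd b (E2 a) u.
  move=> Bu; rewrite !pE2 //; move: (S1 a b (B1U _ Bu)) (S2 a b (B1U _ Bu)).
  move: (pd a (e1 b) u) (pd b (e1 a) u) (pd a (e2 b) u) (pd b (e2 a) u)
    => z1 z2 z3 z4 H1 H2.
  rewrite (_ : z1 = z2 + (w a u * e2 b u - w b u * e2 a u)); last by lra.
  by rewrite (_ : z3 = z4 + (w b u * e1 a u - w a u * e1 b u)); [ring|lra].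
have [B2 [y1 [oB2 B2u0 B2B sy1 dy1]]] := poincare_lemma oB1 B1u0 sE1 cE1.
have cE2' a b u : B2 u -> pd a (E2 b) u = pd b (E2 a) u by move=> /B2B; exact: cE2.
have [B3 [y2 [oB3 B3u0 B3B sy2 dy2]]] :=
  poincare_lemma oB2 B2u0 (fun a => smooth_sub B2B (sE2 a)) cE2'.
have B31 : B3 `<=` B1 by move=> u /B3B/B2B.
have B3U : B3 `<=` U by move=> u /B31/B1U.
(* Since [d y1 = E1] and [E2] is closed, [d (y1 E2) = E1 /\ E2], which equals [e1 /\ e2] because
   rotations preserve area; hence [T] is closed. *)
pose T a u := t a u - c * (y1 u * E2 a u).
have sy1' : smooth_on B3 y1 by exact: smooth_sub B3B sy1.
have sE2' a : smooth_on B3 (E2 a) by exact: smooth_sub B31 (sE2 a).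
have sT a : smooth_on B3 (T a).
  have := smoothZ c oB3 (smoothM oB3 sy1' (sE2' a)).
  exact: smoothB oB3 (smooth_sub B3U (st a)).
have pT a b u : B3 u -> pd a (T b) u = pd a (t b) u
    - c * (E1 a u * E2 b u + y1 u * pd a (E2 b) u).
  move=> Bu; have dt := der (a := a) (st b) (B3U _ Bu).
  have d1 : derivable y1 u (delta_mx 0 a) by exact: smooth_derivable sy1' Bu.
  have d2 : derivable (E2 b) u (delta_mx 0 a) by exact: smooth_derivable (sE2' b) Bu.
  have d12 := derivableM d1 d2.
  have d3 := derivableM (derivable_cst c u (delta_mx 0 a)) d12.
  by rewrite /T (pdB dt d3) (pdZ c d12) (pdM d1 d2) dy1 //; exact: B3B.
have cs u : cos (phi u) ^+ 2 + sin (phi u) ^+ 2 = 1 by exact: cos2Dsin2.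
have cT a b u : B3 u -> pd a (T b) u = pd b (T a) u.
  move=> Bu; rewrite !pT // (cE2 a b u (B31 _ Bu)).
  move: (S3 a b (B3U _ Bu)) (cs u); rewrite /E1 /E2.
  move: (pd b _ u) (pd b (t a) u) (pd a (t b) u) (cos _) (sin _) => z1 z2 z3 C S H1 H2.
  rewrite (_ : z3 = z2 + c * (e1 a u * e2 b u - e1 b u * e2 a u)); last by lra.
  rewrite -[e1 a u * _ - _]mul1r -H2; ring.
have [B4 [y3 [oB4 B4u0 B4B sy3 dy3]]] := poincare_lemma oB3 B3u0 sT cT.
have B42 : B4 `<=` B2 by move=> u /B4B/B3B.
exists B4, y1, y2, y3; split.
- exact: oB4.
- exact: B4u0.
- by move=> u /B4B/B3U.
- by split; [exact: smooth_sub B42 sy1|exact: smooth_sub B4B sy2|exact: sy3].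
move=> u a b Bu; have B2u := B42 _ Bu; have B3u := B4B _ Bu.
rewrite !dy1 // !dy2 // dy3 //; split; last by rewrite /T; ring.
move: (cs u); rewrite /E1 /E2; move: (cos _) (sin _) => C S H.
by rewrite -[RHS]mul1r -H; ring.
Qed.

End NilCoordinates.

(** * Cylinders *)

Section Gluing.
Context {R : realType}.

Lemma pull2_unit (n : nat) (f : 'rV[R]_n -> 'rV[R]_n) (B : 'rV[R]_n -> 'M[R]_n) u :
  pull2 f B u \in unitmx -> 'J f u \in unitmx.
Proof. by rewrite /pull2 !unitmx_mul => /andP[/andP[]]. Qed.

(** A map that pulls a metric back to a nondegenerate one has an invertible Jacobian, so the inverse
    function theorem upgrades a smooth metric-preserving map to a local isometry. *)
Lemma locally_isometric_at (n : nat) (M M' : atlas R n) (g : tensor2 M)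
    (g' : tensor2 M') (i : chart M) (j : chart M') (B : set 'rV[R]_n) u0
    (f : 'rV[R]_n -> 'rV[R]_n) :
  open B -> B u0 -> B `<=` dom i -> smooth_mx_on B f ->
  (forall u, B u -> dom j (f u)) ->
  (forall u, B u -> g i u = pull2 f (g' j) u) -> g i u0 \in unitmx ->
  exists (i' : chart M) (j' : chart M') (u : 'rV[R]_n) (W V : set 'rV[R]_n)
         (k k' : 'rV[R]_n -> 'rV[R]_n),
    [/\ par i' u = par i u0 /\ W u, open W /\ W `<=` dom i',
        open V /\ V `<=` dom j', smooth_mx_on W k /\ smooth_mx_on V k' &
        [/\ forall y, W y -> V (k y) /\ k' (k y) = y,
            forall z, V z -> W (k' z) /\ k (k' z) = z &
            forall y, W y -> g i' y = pull2 k (g' j') y]].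
Proof.
move=> oB Bu0 Bi sf fj gf ug.
have uJ : 'J f u0 \in unitmx by apply: (@pull2_unit _ _ (g' j)); rewrite -gf.
have [W [V [f' [[Wu0 oW WB] oV sf' Wf Vf']]]] := inverse_function oB sf Bu0 uJ.
exists i, j, u0, W, V, f, f'; split.
- by [].
- by split; [exact: oW|move=> u /WB/Bi].
- split; first exact: oV.
  by move=> z /Vf'[Wz <-]; apply/fj/WB.
- by split; [move=> a b; exact: smooth_sub WB (sf a b)|exact: sf'].
- split; [exact: Wf|exact: Vf'|by move=> u /WB/gf].
Qed.

Lemma pull2_entry (m n : nat) (f : 'rV[R]_m -> 'rV[R]_n) (B : 'rV[R]_n -> 'M[R]_n) u a b :
  pull2 f B u a b = \sum_k \sum_l 'J f u a k * B (f u) k l * 'J f u b l.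
Proof.
rewrite /pull2 mxE exchange_big; apply: eq_bigr => l _.
by rewrite mxE mulr_suml; apply: eq_bigr => k _; rewrite [_^T _ _]mxE.
Qed.

(** Dilating the coordinates by [c] and the metric by [(c ^+ 2)^-1] leaves the first two squares
    unchanged, while the contact form becomes [(c y0 c dy1 + c dy2) / c]: the constant [c] moves in
    front of [y0]. *)
Lemma nil_pull2 (B : set 'rV[R]_3) (c : R) (y : 'I_3 -> 'rV[R]_3 -> R) i u a b :
  open B -> (forall k, smooth_on B (y k)) -> B u -> c != 0 ->
  pull2 (fun v => \row_k (c * y k v)) (fun z => (c ^+ 2)^-1 *: nil_metric i z) u a b =
  pd a (y 0) u * pd b (y 0) u + pd a (y 1) u * pd b (y 1) u
  + (c * y 0 u * pd a (y 1) u + pd a (y 2%:R) u) *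
    (c * y 0 u * pd b (y 1) u + pd b (y 2%:R) u).
Proof.
move=> oB sy Bu c0; set f := fun v => _.
have sf : smooth_mx_on B f.
  move=> i' k; rewrite /f; under eq_fun do rewrite mxE.
  exact: smoothZ oB (sy k).
have JE a' k : 'J f u a' k = c * pd a' (y k) u.
  rewrite (jacobianE a' k (smooth_mx_differentiable oB sf Bu)) /f.
  under eq_fun do rewrite mxE.
  by rewrite pdZ //; exact: smooth_derivable (sy k) Bu.
rewrite pull2_entry; under eq_bigr => k _ do under eq_bigr => l _ do rewrite !JE.
rewrite !big_ord3 /nil_metric /tens /dy !mxE !big_ord1 !mxE /=.
move: (pd a (y 0) u) (pd b (y 0) u) (pd a (y 1) u) (pd b (y 1) u) (pd a (y 2%:R) u)
  (pd b (y 2%:R) u) => z1 z2 z3 z4 z5 z6.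
by field.
Qed.

Lemma pd_lsubmx_coord (n : nat) (w : 'rV[R]_(n + 1)) a b :
  pd a (fun v : 'rV[R]_(n + 1) => lsubmx v 0 b) w = (a == lshift 1 b)%:R.
Proof.
under eq_fun do rewrite mxE.
by rewrite [LHS]derive_coord mxE eqxx eq_sym.
Qed.

Lemma jacobian_lsubmx (n : nat) (w : 'rV[R]_(n + 1)) a b :
  'J (@lsubmx R 1 n 1) w a b = (a == lshift 1 b)%:R.
Proof.
by rewrite (jacobianE a b (differentiable_lsubmx w)) pd_lsubmx_coord.
Qed.

Lemma pull_proj_entry (N : atlas R 2) (J : set R) (B : tensor2 N) i (w : 'rV[R]_3)
    (a b : 'I_3) :
  pull_proj (J := J) B i w a b = nth 0 (nth [::]
    [:: [:: B i (lsubmx (w : 'rV_(2 + 1))) 0 0; B i (lsubmx (w : 'rV_(2 + 1))) 0 1; 0];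
        [:: B i (lsubmx (w : 'rV_(2 + 1))) 1 0; B i (lsubmx (w : 'rV_(2 + 1))) 1 1; 0];
        [:: 0; 0; 0]] a) b.
Proof.
rewrite /pull_proj pull2_entry !big_ord2 !jacobian_lsubmx.
move: (B i _) => M.
elim/ord3P: a; elim/ord3P: b => /=;
  by rewrite -?(inj_eq val_inj) /= !(mulr0, mul0r, mulr1, mul1r, addr0, add0r).
Qed.

Lemma pd_lift (U : set 'rV[R]_2) (k : 'rV[R]_2 -> R) (w : 'rV[R]_(2 + 1)) (a : 'I_3) :
  open U -> smooth_on U k -> U (lsubmx w) ->
  pd a (fun v : 'rV[R]_(2 + 1) => k (lsubmx v)) w =
  nth 0 [:: pd 0 k (lsubmx w); pd 1 k (lsubmx w); 0] a.
Proof.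
move=> oU sk Uw.
have dl b : differentiable (fun v : 'rV[R]_(2 + 1) => lsubmx v 0 b) w.
  by under eq_fun do rewrite mxE; exact: differentiable_coord.
have [_] := derive_comp_rV (delta_mx 0 a) dl (smooth_differentiable oU sk Uw).
rewrite -/(pd a _ _) => ->; rewrite big_ord2.
set d0 := (X in _ * X + _); set d1 := (X in _ + _ * X).
have -> : d0 = ((a : 'I_(2 + 1)) == lshift 1 0)%:R by exact: pd_lsubmx_coord.
have -> : d1 = ((a : 'I_(2 + 1)) == lshift 1 1)%:R by exact: pd_lsubmx_coord.
move=> {d0 d1 dl}; elim/ord3P: a => /=;
  by rewrite -?(inj_eq val_inj) /= !(mulr0, mulr1, addr0, add0r).
Qed.

Lemma smooth_lift (n : nat) (U : set 'rV[R]_n) (V : set 'rV[R]_(n + 1)) k :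
  open U -> open V -> (forall w, V w -> U (lsubmx w)) -> smooth_on U k ->
  smooth_on V (fun w : 'rV[R]_(n + 1) => k (lsubmx w)).
Proof.
move=> oU oV VU sk.
suff sl : smooth_mx_on V (@lsubmx R 1 n 1) by exact: smooth_comp oV oU sk VU sl.
move=> i b; rewrite ord1; under eq_fun do rewrite mxE.
exact: smooth_coord.
Qed.

Lemma open_prod_dom (n : nat) (N : atlas R n) (a b : R) (i : chart N) :
  open (dom i) -> open (dom (i : chart (prod_atlas N `]a, b[))).
Proof.
move=> oi.
have -> : dom (i : chart (prod_atlas N `]a, b[)) =
    (@lsubmx R 1 n 1 @^-1` dom i) `&`
    ((fun w : 'rV[R]_(n + 1) => rsubmx w 0 0) @^-1` `]a, b[%classic).
  by [].
apply: openI.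
  apply: open_comp oi => w _; apply: differentiable_continuous.
  exact: differentiable_lsubmx.
apply: open_comp => [w _|]; last exact: interval_open.
under eq_fun do rewrite mxE.
exact: coord_continuous.
Qed.

End Gluing.

(** * The ansatz with constant [rho] *)

Section OrientedFrame.
Context {R : realType}.

Lemma inner_delta (n : nat) (B : 'M[R]_n) a b :
  inner B (delta_mx 0 a) (delta_mx 0 b) = B a b.
Proof. by rewrite /inner -rowE trmx_delta -colE !mxE. Qed.

Lemma posdef_diag_gt0 (n : nat) (B : 'M[R]_n) a : posdef B -> 0 < B a a.
Proof.
move=> [_ pB]; rewrite -inner_delta; apply: pB.
apply/eqP => /matrixP/(_ 0 a); rewrite !mxE !eqxx => /eqP.
by rewrite oner_eq0.
Qed.

Lemma posdefZ (n : nat) (B : 'M[R]_n) (k : R) : 0 < k -> posdef B -> posdef (k *: B).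
Proof.
move=> k0 [sB pB]; split=> [|v /pB v0]; first by rewrite linearZ /= sB.
by rewrite /inner -scalemxAr -scalemxAl mxE mulr_gt0.
Qed.

(** Cholesky factorization, except that the last diagonal entry is [m / p] instead of a square root
    of its square: it thereby carries the sign of [m], that is, the orientation. *)
Lemma oriented_frame (U : set 'rV[R]_2) (H : 'rV[R]_2 -> 'M[R]_2) (m : 'rV[R]_2 -> R) :
  open U -> smooth_mx_on U H -> (forall u, U u -> posdef (H u)) ->
  smooth_on U m -> (forall u, U u -> m u ^+ 2 = \det (H u)) ->
  exists p q r : 'rV[R]_2 -> R,
    [/\ smooth_on U p, smooth_on U q, smooth_on U r &
     forall u, U u -> [/\ p u != 0, r u != 0, p u * r u = m u &
       H u = (mx22 (p u) (q u) 0 (r u))^T *m mx22 (p u) (q u) 0 (r u)]].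
Proof.
move=> oU sH pH sm mH.
have H0 u : U u -> 0 < H u 0 0 by move=> /pH/posdef_diag_gt0.
pose p u := Num.sqrt (H u 0 0).
have sp : smooth_on U p by exact: smooth_sqrt oU (sH 0 0) H0.
have p0 u : U u -> p u != 0 by move=> /H0 h; rewrite gt_eqF // sqrtr_gt0.
have pp u : U u -> p u ^+ 2 = H u 0 0 by move=> /H0/ltW; exact: sqr_sqrtr.
exists p, (fun u => H u 0 1 * (p u)^-1), (fun u => m u * (p u)^-1); split.
- exact: sp.
- exact: smoothM oU (sH 0 1) (smoothV oU sp p0).
- exact: smoothM oU sm (smoothV oU sp p0).
move=> u Uu; have pu := p0 u Uu; have ppu := pp u Uu; have [symH _] := pH u Uu.
have m0 : m u != 0.
  rewrite -sqrf_eq0 mH //; have := posdef_unit (pH u Uu).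
  by rewrite unitmxE unitfE.
split.
- exact: pu.
- by rewrite mulf_neq0 ?invr_eq0.
- by rewrite mulrC divfK.
have H10 : H u 1 0 = H u 0 1 by rewrite -[in LHS]symH mxE.
have := mH u Uu; rewrite det_mx22 H10 => E.
apply/matrixP; elim/ord2P; elim/ord2P; rewrite !mxE !big_ord2 !mxE /=.
- by rewrite mulr0 addr0 -expr2.
- by rewrite mul0r addr0 mulrC divfK.
- by rewrite mulr0 addr0 divfK.
have -> : H u 0 1 / p u * (H u 0 1 / p u) + m u / p u * (m u / p u) =
    (H u 0 1 ^+ 2 + m u ^+ 2) / p u ^+ 2 by field.
by rewrite E ppu; field; rewrite gt_eqF // H0.
Qed.

End OrientedFrame.

(** * Hessians and Laplacians of sums and constants *)

Section LaplacianRules.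
Context {R : realType} {n : nat}.
Implicit Types (g : 'rV[R]_n -> 'M[R]_n) (f k : 'rV[R]_n -> R) (U : set 'rV[R]_n).

Lemma hess_eq_on U g f k u : open U -> (forall v, U v -> f v = k v) -> U u ->
  hess g f u = hess g k u.
Proof.
move=> oU fk Uu; apply/matrixP => a b; rewrite !mxE.
have E c v : U v -> pd c f v = pd c k v by move=> Uv; exact: pd_eq_on oU fk Uv.
rewrite (pd_eq_on a oU (E b) Uu); congr (_ - _).
by apply: eq_bigr => c _; rewrite E.
Qed.

Lemma laplacian_eq_on U g f k u : open U -> (forall v, U v -> f v = k v) -> U u ->
  laplacian g f u = laplacian g k u.
Proof. by move=> oU fk Uu; rewrite /laplacian (hess_eq_on g oU fk Uu). Qed.

Lemma hess_cst g (c : R) u : hess g (fun=> c) u = 0.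
Proof.
apply/matrixP => a b; rewrite !mxE big1 => [|d _]; last by rewrite pd_cst mulr0.
have -> : pd b (fun=> c) = (fun=> 0) by apply/funext => v; exact: pd_cst.
by rewrite pd_cst subr0.
Qed.

Lemma laplacian_cst g (c : R) u : laplacian g (fun=> c) u = 0.
Proof. by rewrite /laplacian hess_cst mulmx0 mxtrace0. Qed.

Lemma laplacian_lin U g f k (c : R) u : open U -> smooth_on U f -> smooth_on U k ->
  U u -> laplacian g (fun v => c * f v + k v) u = c * laplacian g f u + laplacian g k u.
Proof.
move=> oU sf sk Uu.
have E a v : U v -> pd a (fun v => c * f v + k v) v = c * pd a f v + pd a k v.
  move=> Uv.
  have df : derivable f v (delta_mx 0 a) by exact: smooth_derivable sf Uv.
  have dk : derivable k v (delta_mx 0 a) by exact: smooth_derivable sk Uv.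
  by rewrite (pdD (derivableM (derivable_cst c v _) df) dk) (pdZ c df).
have -> : laplacian g (fun v => c * f v + k v) u =
    \tr (invmx (g u) *m (c *: hess g f u + hess g k u)).
  congr (\tr (_ *m _)); apply/matrixP => a b.
  rewrite !mxE (pd_eq_on a oU (E b) Uu).
  have dpf : derivable (pd b f) u (delta_mx 0 a).
    exact: smooth_derivable (smooth_pd b sf) Uu.
  have dpk : derivable (pd b k) u (delta_mx 0 a).
    exact: smooth_derivable (smooth_pd b sk) Uu.
  rewrite (pdD (derivableM (derivable_cst c u _) dpf) dpk) (pdZ c dpf).
  under eq_bigr => d _ do rewrite E // mulrDr mulrCA.
  rewrite big_split /= -mulr_sumr.
  move: (pd a _ u) (pd a (pd b k) u) (\sum_i _) (\sum_i _) => x y z t; ring.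
by rewrite mulmxDr -scalemxAr linearD linearZ.
Qed.

Lemma gradprod_cst U g f k (c : R) u : open U -> (forall v, U v -> f v = c) -> U u ->
  gradprod g f k u = 0.
Proof.
move=> oU f0 Uu; rewrite /gradprod /grad.
have -> : dif f u = 0.
  by apply/rowP => a; rewrite !mxE (pd_eq_on a oU f0 Uu) pd_cst.
by rewrite /inner !mul0mx mxE.
Qed.

End LaplacianRules.

(** * The base equations in terms of the conformal metric *)

Section Reduction.
Context {R : realType}.
Variables (N : atlas R 2) (h mu : tensor2 N) (A delta : R)
  (psi lambda rho nu : mpoint N -> R) (theta : covector_field (cylinder N delta)).
Hypothesis ans : ansatz h mu A psi lambda rho nu theta.
Hypothesis rho_cst : exists r : R, forall p : mpoint (cylinder N delta),
  carrier (cylinder N delta) p -> rho p.1 = r.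

Let carrier_par i u : dom i u -> carrier N (par i u).
Proof. by move=> iu; exists i, u. Qed.

(** Each point of the surface lies below a point of the cylinder, at parameter [0], so [rho] is
    constant on the surface as well. Over an empty surface nothing is known of the sign of [r],
    whence the disjunction. *)
Lemma rho_carrier : exists2 r : R, 0 < r \/ carrier N = set0 &
  forall x, carrier N x -> rho x = r.
Proof.
have [r Hr] := rho_cst; have [_ rho_gt0] := ansatz_rho ans.
have d0 := ansatz_delta ans.
have E x : carrier N x -> rho x = r.
  move=> [i [u [iu <-]]]; apply: (Hr (par i u, 0)).
  exists i, (row_mx u 0); split => /=; last first.
    by rewrite row_mxKl row_mxKr mxE.
  rewrite row_mxKl row_mxKr; split; first exact: iu.
  by rewrite mxE /= in_itv /= oppr_lt0 d0.
exists r; last exact: E.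
have [[x Nx]|nN] := pselect (exists x, carrier N x).
  by left; rewrite -(E x Nx) rho_gt0.
by right; apply/seteqP; split => // x Nx; case: nN; exists x.
Qed.

Lemma chart_open (i : chart N) : open (dom i).
Proof. by have [[oi _ _ _ _] _] := ansatz_surface ans; exact: oi. Qed.

Lemma chart_smooth_metric i : smooth_mx_on (dom i) (h i).
Proof. by have [_ [[sh _] _]] := ansatz_surface ans; exact: sh. Qed.

Lemma chart_posdef i u : dom i u -> posdef (h i u).
Proof. by have [_ [_ ph]] := ansatz_surface ans; exact: ph. Qed.

Lemma chart_lambda i : smooth_on (dom i) (loc lambda i).
Proof. by have [sl _] := ansatz_lambda ans; exact: sl. Qed.

Lemma chart_lambda_gt0 i u : dom i u -> 0 < loc lambda i u.
Proof. by move=> iu; have [_ l0] := ansatz_lambda ans; exact/l0/carrier_par. Qed.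

Lemma chart_nu_gt0 i u : dom i u -> 0 < loc nu i u.
Proof. by move=> iu; have [_ l0] := ansatz_nu ans; exact/l0/carrier_par. Qed.

Lemma chart_ln_nu i : smooth_on (dom i) (loc (fun x => ln (nu x)) i).
Proof.
have [sn _] := ansatz_nu ans.
have H := smooth_ln (@chart_open i) (sn i) (fun u => @chart_nu_gt0 i u).
exact: H.
Qed.

Definition conformal_metric : tensor2 N := fun i u =>
  (loc lambda i u ^+ 2)^-1 *: h i u.

Let conformal_metricE i u : dom i u ->
  conformal_metric i u = (loc lambda i u ^+ 2)^-1 *: h i u.
Proof. by []. Qed.

Let ln_rho i : exists c, forall u, dom i u -> loc (fun x => ln (rho x)) i u = c.
Proof.
have [r _ E] := rho_carrier; exists (ln r) => u /carrier_par/E.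
by rewrite /loc => ->.
Qed.

Lemma psi_constant : exists C, forall x, carrier N x -> psi x = C.
Proof.
have [B HB] := ansatz_2b (ansatz_equations ans).
exists (B - A) => x [i [u [iu <-]]].
have := HB i u iu; have [c Ec] := ln_rho i.
rewrite (gradprod_cst _ _ (@chart_open i) Ec iu).
rewrite (laplacian_eq_on _ (@chart_open i) Ec iu) laplacian_cst subrr add0r.
have l0 := lt0r_neq0 (chart_lambda_gt0 iu).
by rewrite mulrC divfK ?expf_neq0 // => <-; rewrite addrK.
Qed.

Lemma conformal_posdef i u : dom i u -> posdef (conformal_metric i u).
Proof.
move=> iu; apply: posdefZ (chart_posdef iu).
by rewrite invr_gt0 exprn_gt0 // chart_lambda_gt0.
Qed.

Lemma conformal_smooth i : smooth_mx_on (dom i) (conformal_metric i).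
Proof.
move=> k l; rewrite /conformal_metric.
under eq_fun do rewrite mxE expr2.
apply: smoothM (@chart_open i) _ (chart_smooth_metric k l).
apply: smoothV (@chart_open i) _ _.
  exact: smoothM (@chart_open i) (@chart_lambda i) (@chart_lambda i).
by move=> u iu; rewrite mulf_neq0 // lt0r_neq0 // chart_lambda_gt0.
Qed.

Lemma conformal_hessE i u : dom i u ->
  let f := loc (fun x => ln (nu x)) i in
  hess (conformal_metric i) f u =
  (2^-1 * laplacian (conformal_metric i) f u) *: conformal_metric i u.
Proof.
move=> iu f; have oi := @chart_open i.
have uh v : dom i v -> h i v \in unitmx by move=> iv; exact/posdef_unit/chart_posdef.
have symh v : dom i v -> (h i v)^T = h i v by move=> /chart_posdef[].
have [al Hal] := ansatz_u (ansatz_equations ans).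
apply: (conformal_hess_scalar oi (@chart_smooth_metric i) uh symh (@chart_lambda i)
  (@chart_lambda_gt0 i) (@conformal_metricE i) iu (al := al (par i u))).
have := Hal i u iu; have [c Ec] := ln_rho i.
have -> : dif (loc (fun x => ln (rho x)) i) u = 0.
  by apply/rowP => a; rewrite !mxE (pd_eq_on a oi Ec iu) pd_cst.
by rewrite /tens mulmx0 subr0.
Qed.

Lemma conformal_laplacianE i u : dom i u ->
  let f := loc (fun x => ln (nu x)) i in
  laplacian (conformal_metric i) f u = loc lambda i u ^+ 2 * laplacian (h i) f u.
Proof.
move=> iu f; have oi := @chart_open i.
have uh v : dom i v -> h i v \in unitmx by move=> iv; exact/posdef_unit/chart_posdef.
have symh v : dom i v -> (h i v)^T = h i v by move=> /chart_posdef[].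
exact: (conformal_laplacian _ oi (@chart_smooth_metric i) uh symh (@chart_lambda i)
  (@chart_lambda_gt0 i) (@conformal_metricE i) iu).
Qed.

Lemma laplacian_ln_nu C : 0 < C -> (forall x, carrier N x -> psi x = C) ->
  forall i u, dom i u ->
  laplacian (conformal_metric i) (loc (fun x => ln (nu x)) i) u = - (C + A).
Proof.
move=> C0 psiC i u iu; have oi := @chart_open i.
have pC v : dom i v -> loc psi i v = C by move=> /carrier_par/psiC.
have l0 := lt0r_neq0 (chart_lambda_gt0 iu).
have := ansatz_2a (ansatz_equations ans) iu; rewrite pC // => /(_ C0).
have [c Ec] := ln_rho i.
have Lpsi v : dom i v -> loc (fun x => ln (psi x)) i v = ln C.
  by move=> /pC; rewrite /loc => ->.
rewrite (gradprod_cst _ _ oi Ec iu) !(gradprod_cst _ _ oi Lpsi iu).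
have [r [r0|N0] Er] := rho_carrier; last first.
  by have := carrier_par iu; rewrite N0.
(* With [rho] and [psi] constant only [ln nu] survives differentiation; the factor [1] puts the
   constant in the shape expected by [laplacian_lin]. *)
have Eln v : dom i v -> loc (fun x => ln (rho x ^+ 2 * nu x * psi x `^ (- 2^-1))) i v =
    ln (r ^+ 2 * C `^ (- 2^-1)) * 1 + loc (fun x => ln (nu x)) i v.
  move=> iv; rewrite /loc Er; last exact: carrier_par.
  rewrite psiC; last exact: carrier_par.
  have n0 := chart_nu_gt0 iv; have Cp := powR_gt0 (- 2^-1) C0.
  by rewrite mulrAC mulr1 [LHS]lnM ?posrE ?mulr_gt0 ?exprn_gt0.
rewrite (laplacian_eq_on _ oi Eln iu).
rewrite (laplacian_lin _ _ oi (smooth_cst 1 oi) (@chart_ln_nu i) iu) laplacian_cst.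
rewrite conformal_laplacianE // => E.
move: E; move: (laplacian _ _ _) (ln _) => x y E.
have -> : x = - ((C + A) / loc lambda i u ^+ 2) by lra.
by field.
Qed.

(** [mu / lambda ^+ 2] is the area form of the conformal metric, as its square is
    [\det h / lambda ^+ 4]. Requiring [p * r] to equal it makes [e1 /\ e2] agree with the
    orientation that enters the equation of [theta]. *)
Lemma chart_frame i : exists p q r : 'rV[R]_2 -> R,
  [/\ smooth_on (dom i) p, smooth_on (dom i) q, smooth_on (dom i) r &
   forall u, dom i u -> [/\ p u != 0, r u != 0,
     p u * r u = mu i u 0 1 / loc lambda i u ^+ 2 &
     conformal_metric i u =
       (mx22 (p u) (q u) 0 (r u))^T *m mx22 (p u) (q u) 0 (r u)]].
Proof.
have oi := @chart_open i; have [[smu _] muE] := ansatz_volume ans.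
apply: (@oriented_frame _ _ _ (fun u => mu i u 0 1 / loc lambda i u ^+ 2) oi
  (@conformal_smooth i) (@conformal_posdef i)).
  under eq_fun do rewrite expr2.
  have sll := smoothM oi (@chart_lambda i) (@chart_lambda i).
  apply: (smoothM oi (smu i 0 1) (smoothV oi sll _)) => u iu.
  by rewrite mulf_neq0 // lt0r_neq0 // chart_lambda_gt0.
move=> u iu; have [_ mu2] := muE i u iu.
by rewrite expr_div_n mu2 /conformal_metric detZ exprVn mulrC.
Qed.

(** The conformal change is run backwards: [lambda] times the coframe of the conformal metric is a
    coframe of [h], which expresses [gauss h]. Its term in the Laplacian of [ln lambda] cancels the
    one that [ln (lambda ^+ 2 * nu)] contributes to [ansatz_1]. *)
Lemma frame_gauss_ansatz i p q r C :
  smooth_on (dom i) p -> smooth_on (dom i) q -> smooth_on (dom i) r ->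
  (forall u, dom i u -> [/\ p u != 0, r u != 0,
     p u * r u = mu i u 0 1 / loc lambda i u ^+ 2 &
     conformal_metric i u =
       (mx22 (p u) (q u) 0 (r u))^T *m mx22 (p u) (q u) 0 (r u)]) ->
  (forall x, carrier N x -> psi x = C) ->
  forall u, dom i u -> frame_gauss p q r u =
    C - A - 2^-1 * laplacian (conformal_metric i) (loc (fun x => ln (nu x)) i) u.
Proof.
move=> sp sq sr Hf psiC u iu; have oi := @chart_open i.
pose lam := loc lambda i; have slam := @chart_lambda i; have lam0 := @chart_lambda_gt0 i.
have ln0 v : dom i v -> lam v != 0 by move=> /lam0/lt0r_neq0.
have p0 v : dom i v -> p v != 0 by move=> /Hf[].
have r0 v : dom i v -> r v != 0 by move=> /Hf[].
have gE v : dom i v -> conformal_metric i v =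
  (mx22 (p v) (q v) 0 (r v))^T *m mx22 (p v) (q v) 0 (r v) by move=> /Hf[].
pose P v := lam v * p v; pose Q v := lam v * q v; pose S v := lam v * r v.
have sP := smoothM oi slam sp; have sQ := smoothM oi slam sq; have sS := smoothM oi slam sr.
have P0 v : dom i v -> P v != 0 by move=> iv; rewrite mulf_neq0 ?ln0 ?p0.
have S0 v : dom i v -> S v != 0 by move=> iv; rewrite mulf_neq0 ?ln0 ?r0.
have hE v : dom i v -> h i v =
    (mx22 (P v) (Q v) 0 (S v))^T *m mx22 (P v) (Q v) 0 (S v).
  move=> iv; have l0 := ln0 v iv.
  have -> : mx22 (P v) (Q v) 0 (S v) = lam v *: mx22 (p v) (q v) 0 (r v).
    by apply/matrixP; elim/ord2P; elim/ord2P; rewrite !mxE /= ?mulr0.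
  rewrite [X in X *m _]linearZ /= -scalemxAl -scalemxAr scalerA -gE // /conformal_metric.
  by rewrite scalerA -expr2 mulfV ?scale1r ?expf_neq0.
have sf := surface_space_form oi sP sQ sS P0 S0 hE iu.
have [symh _] := chart_posdef iu.
have G : gauss (h i) u = frame_gauss P Q S u.
  apply: (space_form_sectional sf symh); rewrite !inner_delta.
  have := posdef_unit (chart_posdef iu); rewrite unitmxE unitfE det_mx22.
  have -> : h i u 1 0 = h i u 0 1 by rewrite -[in LHS]symh mxE.
  by rewrite expr2.
have := ansatz_1 (ansatz_equations ans) iu; rewrite G.
rewrite (frame_gauss_conformal oi sp sq sr p0 r0 gE slam lam0 iu).
have [c Ec] := ln_rho i; rewrite (gradprod_cst _ _ oi Ec iu).
have sL : smooth_on (dom i) (fun v => ln (lam v)) by exact: smooth_ln oi slam lam0.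
have Eln v : dom i v -> loc (fun x => ln (lambda x ^+ 2 * nu x)) i v =
    2 * ln (lam v) + loc (fun x => ln (nu x)) i v.
  move=> iv; have n0 := chart_nu_gt0 iv; have l0 := lam0 v iv.
  rewrite /loc lnM ?posrE ?exprn_gt0 // lnXn ?posrE //.
  by rewrite /lam /loc mulr_natl.
rewrite (laplacian_eq_on _ oi Eln iu) (laplacian_lin _ _ oi sL (@chart_ln_nu i) iu).
have uh v : dom i v -> h i v \in unitmx by move=> iv; exact/posdef_unit/chart_posdef.
have symh' v : dom i v -> (h i v)^T = h i v by move=> /chart_posdef[].
rewrite (conformal_laplacian _ oi (@chart_smooth_metric i) uh symh' slam
  lam0 (@conformal_metricE i) iu) conformal_laplacianE //.
have -> : loc psi i u = C by exact/psiC/carrier_par.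
rewrite -/lam; move: (laplacian _ _ _) (laplacian _ _ _) (frame_gauss p q r u) => x y z E.
have := congr1 (fun t => lam u ^+ 2 * t) E; rewrite mulr0 => E'.
have {E'} : z + 2^-1 * (lam u ^+ 2 * x) + (A - C) = 0.
  by rewrite -E'; field; exact: ln0.
lra.
Qed.

End Reduction.

(** * Pulling back the product metric by the projection and a function *)

Section ProductIsometry.
Context {R : realType}.

Let o0 : (0 : 'I_(2 + 1)) = lshift 1 0. Proof. exact: val_inj. Qed.
Let o1 : (1 : 'I_(2 + 1)) = lshift 1 1. Proof. exact: val_inj. Qed.
Let o2 : (2%:R : 'I_(2 + 1)) = rshift 2 0. Proof. exact: val_inj. Qed.

Lemma row_mx3E (v : 'rV[R]_2) (x : 'rV[R]_1) (k : 'I_3) :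
  (row_mx v x : 'rV_(2 + 1)) 0 k = nth 0 [:: v 0 0; v 0 1; x 0 0] k.
Proof.
elim/ord3P: k => /=; [rewrite o0|rewrite o1|rewrite o2];
  by rewrite ?row_mxEl ?row_mxEr.
Qed.

Lemma lsubmx3E (w : 'rV[R]_3) : lsubmx (w : 'rV_(2 + 1)) = \row_k nth 0 [:: w 0 0; w 0 1] k.
Proof.
by apply/rowP; elim/ord2P; rewrite !mxE /= ?o0 ?o1.
Qed.

Lemma product_pull2 (N : atlas R 2) (h2 : tensor2 N) i (F : 'rV[R]_3 -> R)
    (B : set 'rV[R]_3) (w : 'rV[R]_3) :
  open B -> smooth_on B F -> B w ->
  pull2 (fun v : 'rV[R]_3 => row_mx (lsubmx (v : 'rV_(2 + 1))) (const_mx (F v)) : 'rV[R]_3)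
    (prod_line_metric h2 i) w =
  pull_proj (J := setT) h2 i w + tens (dif F w) (dif F w).
Proof.
move=> oB sF Bw; set f := fun v => _.
have fE v k : f v 0 k = nth 0 [:: v 0 0; v 0 1; F v] k.
  by rewrite /f row_mx3E lsubmx3E !mxE.
have sf : smooth_mx_on B f.
  move=> j k; rewrite ord1; under eq_fun do rewrite fE.
  by elim/ord3P: k => /=; [exact: smooth_coord|exact: smooth_coord|exact: sF].
have JE a k : 'J f w a k = nth 0 [:: (a == 0)%:R; (a == 1)%:R; pd a F w] k.
  rewrite (jacobianE a k (smooth_mx_differentiable oB sf Bw)).
  under eq_fun do rewrite fE.
  elim/ord3P: k => //=; by rewrite [LHS]derive_coord mxE eqxx eq_sym.
have lf : lsubmx (f w : 'rV_(2 + 1)) = lsubmx (w : 'rV_(2 + 1)) by rewrite row_mxKl.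
have dtE k : dt R 2 0 k = ((k : 'I_3) == 2%:R)%:R.
  by rewrite /dt row_mx3E; elim/ord3P: k; rewrite !mxE.
apply/matrixP => a b; rewrite pull2_entry.
have PE k l : prod_line_metric h2 i (f w) k l =
   nth 0 (nth [::] [:: [:: h2 i (lsubmx (w : 'rV_(2 + 1))) 0 0;
      h2 i (lsubmx (w : 'rV_(2 + 1))) 0 1; 0];
      [:: h2 i (lsubmx (w : 'rV_(2 + 1))) 1 0; h2 i (lsubmx (w : 'rV_(2 + 1))) 1 1; 0];
      [:: 0; 0; 0]] k) l + (k == 2%:R)%:R * (l == 2%:R)%:R.
  rewrite /prod_line_metric [LHS]mxE; congr (_ + _).
    by rewrite -lf; exact: pull_proj_entry.
  by rewrite /tens mxE big_ord1 [_^T _ _]mxE !dtE.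
under eq_bigr => k _ do under eq_bigr => l _ do rewrite !JE PE.
rewrite [RHS]mxE pull_proj_entry !big_ord3 /=.
rewrite /tens mxE big_ord1 [_^T _ _]mxE ![dif _ _ _ _]mxE.
move: (pd a F w) (pd b F w) (h2 i _) => x y M.
by elim/ord3P: a; elim/ord3P: b => /=; ring.
Qed.

End ProductIsometry.

(** * The coframe lifted to the cylinder and its structure equations *)

Section Cylinder.
Context {R : realType}.
Variables (N : atlas R 2) (h mu : tensor2 N) (A delta : R)
  (psi lambda rho nu : mpoint N -> R) (theta : covector_field (cylinder N delta)).
Hypothesis ans : ansatz h mu A psi lambda rho nu theta.
Hypothesis rho_cst : exists r : R, forall p : mpoint (cylinder N delta),
  carrier (cylinder N delta) p -> rho p.1 = r.
Variables (C : R) (i : chart N) (p q r : 'rV[R]_2 -> R).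
Hypothesis psiC : forall x, carrier N x -> psi x = C.
Hypotheses (sp : smooth_on (dom i) p) (sq : smooth_on (dom i) q)
  (sr : smooth_on (dom i) r)
  (pqr : forall u, dom i u -> [/\ p u != 0, r u != 0,
     p u * r u = mu i u 0 1 / loc lambda i u ^+ 2 &
     conformal_metric h lambda i u =
       (mx22 (p u) (q u) 0 (r u))^T *m mx22 (p u) (q u) 0 (r u)]).

Let D : set 'rV[R]_3 := dom (i : chart (cylinder N delta)).
Let pr (w : 'rV[R]_3) : 'rV[R]_2 := lsubmx (w : 'rV_(2 + 1)).

Definition lift_e1 (a : 'I_3) w := nth 0 [:: p (pr w); q (pr w); 0] a.
Definition lift_e2 (a : 'I_3) w := nth 0 [:: 0; r (pr w); 0] a.
Definition lift_conn (a : 'I_3) w :=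
  nth 0 [:: conn0 p q r (pr w); conn1 p q r (pr w); 0] a.
Definition lift_theta (a : 'I_3) (w : 'rV[R]_3) : R := theta i w 0 a.

Let oi : open (dom i). Proof. exact: chart_open ans i. Qed.

Lemma open_cylinder : open D. Proof. exact: open_prod_dom oi. Qed.

Lemma cylinder_dom w : D w -> dom i (pr w). Proof. by case. Qed.

Let p0 u : dom i u -> p u != 0. Proof. by move=> /pqr[]. Qed.
Let r0 u : dom i u -> r u != 0. Proof. by move=> /pqr[]. Qed.

Let lift_smooth k : smooth_on (dom i) k -> smooth_on D (fun w => k (pr w)).
Proof. by move=> sk; exact: smooth_lift oi open_cylinder cylinder_dom sk. Qed.

Let lift_pd k (a : 'I_3) w : smooth_on (dom i) k -> D w ->
  pd a (fun v => k (pr v)) w = nth 0 [:: pd 0 k (pr w); pd 1 k (pr w); 0] a.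
Proof. by move=> sk /cylinder_dom; exact: pd_lift oi sk. Qed.

Let s3 (f0 f1 f2 : 'rV[R]_3 -> R) (a : 'I_3) :
  (fun w => nth 0 [:: f0 w; f1 w; f2 w] a) = nth (fun=> 0) [:: f0; f1; f2] a.
Proof. by elim/ord3P: a. Qed.

Lemma smooth_lift_e1 a : smooth_on D (lift_e1 a).
Proof.
rewrite /lift_e1 (s3 _ _ (fun=> 0)); elim/ord3P: a => /=.
- exact: lift_smooth sp.
- exact: lift_smooth sq.
- exact: smooth_cst open_cylinder.
Qed.

Lemma smooth_lift_e2 a : smooth_on D (lift_e2 a).
Proof.
rewrite /lift_e2 (s3 (fun=> 0) _ (fun=> 0)); elim/ord3P: a => /=.
- exact: smooth_cst open_cylinder.
- exact: lift_smooth sr.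
- exact: smooth_cst open_cylinder.
Qed.

Lemma smooth_lift_conn a : smooth_on D (lift_conn a).
Proof.
rewrite /lift_conn (s3 _ _ (fun=> 0)); elim/ord3P: a => /=.
- exact: lift_smooth (smooth_conn0 oi sp sq sr r0).
- exact: lift_smooth (smooth_conn1 oi sp sq sr p0 r0).
- exact: smooth_cst open_cylinder.
Qed.

Lemma smooth_lift_theta a : smooth_on D (lift_theta a).
Proof. by have [[st _] _ _] := ansatz_theta ans; exact: st. Qed.

Lemma lift_structure1 a b w : D w -> pd a (lift_e1 b) w - pd b (lift_e1 a) w =
  lift_conn a w * lift_e2 b w - lift_conn b w * lift_e2 a w.
Proof.
move=> Dw; have iw := cylinder_dom Dw.
have e0 : conn0 p q r (pr w) * r (pr w) = pd 0 q (pr w) - pd 1 p (pr w).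
  by rewrite /conn0 divfK ?r0.
rewrite /lift_e1 !(s3 _ _ (fun=> 0)) /lift_e2 /lift_conn.
elim/ord3P: a; elim/ord3P: b => /=; rewrite ?(lift_pd _ sp Dw) ?(lift_pd _ sq Dw) ?pd_cst /=;
  rewrite ?e0; ring.
Qed.

Lemma lift_structure2 a b w : D w -> pd a (lift_e2 b) w - pd b (lift_e2 a) w =
  lift_conn b w * lift_e1 a w - lift_conn a w * lift_e1 b w.
Proof.
move=> Dw; have iw := cylinder_dom Dw.
have e1 : conn1 p q r (pr w) * p (pr w) =
    q (pr w) * conn0 p q r (pr w) + pd 0 r (pr w).
  by rewrite /conn1 divfK ?p0.
rewrite /lift_e2 !(s3 (fun=> 0) _ (fun=> 0)) /lift_e1 /lift_conn.
elim/ord3P: a; elim/ord3P: b => /=; rewrite ?(lift_pd _ sr Dw) ?pd_cst /=;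
  rewrite ?e1; ring.
Qed.

(** [d ln rho] vanishes, and [sigma * mu] is [Num.sqrt (2 * C)] times [mu / lambda ^+ 2], the area
    form [e1 /\ e2] of the conformal metric. *)
Lemma lift_structure3 a b w : D w -> pd a (lift_theta b) w - pd b (lift_theta a) w =
  Num.sqrt (2 * C) * (lift_e1 a w * lift_e2 b w - lift_e1 b w * lift_e2 a w).
Proof.
move=> Dw; have iw := cylinder_dom Dw.
have [_ _ ct] := ansatz_theta ans.
have [_ vmu] := ansatz_volume ans; have [amu _] := vmu i _ iw.
have := ct i w Dw; have [rr _ Hr] := rho_carrier ans rho_cst.
have -> : dif (loc (N := cylinder N delta) (fun p => ln (rho p.1)) i) w = 0.
  apply/rowP => k; rewrite !mxE.
  have E v : D v -> loc (N := cylinder N delta) (fun p => ln (rho p.1)) i v = ln rr.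
    by move=> /cylinder_dom iv; rewrite /loc /= Hr //; exists i, (pr v).
  by rewrite (pd_eq_on k open_cylinder E Dw) pd_cst.
have -> : form_wedge 0 (theta i w) = 0.
  by rewrite /form_wedge /tens trmx0 mul0mx mulmx0 subrr.
rewrite addr0 => /matrixP/(_ a b); rewrite [LHS]mxE => E.
rewrite -[LHS]/(pd a (fun y => theta i y 0 b) w - pd b (fun y => theta i y 0 a) w).
rewrite E pull_proj_entry -/(pr w) /loc /sigma psiC; last by exists i, (pr w).
have [_ _ prE _] := pqr iw.
have m x y : mu i (pr w) x y = - mu i (pr w) y x.
  by have := congr1 (fun X : 'M[R]_2 => X y x) amu; rewrite !mxE.
have m00 : mu i (pr w) 0 0 = 0 by have := m 0 0; lra.
have m11 : mu i (pr w) 1 1 = 0 by have := m 1 1; lra.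
have l0 := lt0r_neq0 (chart_lambda_gt0 ans iw).
have m01 : mu i (pr w) 0 1 = p (pr w) * r (pr w) * loc lambda i (pr w) ^+ 2.
  by rewrite prE divfK // expf_neq0.
rewrite /lift_e1 /lift_e2.
rewrite /loc in l0 m01; set l := lambda _ in l0 m01 *.
elim/ord3P: a E; elim/ord3P: b => _ /=; rewrite ?mxE ?m00 ?m11 ?(m 1 0) ?m01;
  move: (Num.sqrt _) => c; by field.
Qed.

Lemma lift_structure4 K a b w : (forall u, dom i u -> frame_gauss p q r u = K) -> D w ->
  pd a (lift_conn b) w - pd b (lift_conn a) w =
  - K * (lift_e1 a w * lift_e2 b w - lift_e1 b w * lift_e2 a w).
Proof.
move=> HK Dw; have iw := cylinder_dom Dw; have := HK _ iw; rewrite /frame_gauss => <-.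
have sc0 := smooth_conn0 oi sp sq sr r0; have sc1 := smooth_conn1 oi sp sq sr p0 r0.
rewrite /lift_conn !(s3 _ _ (fun=> 0)) /lift_e1 /lift_e2.
elim/ord3P: a; elim/ord3P: b => /=;
  rewrite ?(lift_pd _ sc0 Dw) ?(lift_pd _ sc1 Dw) ?pd_cst /=;
  move: (pd 0 (conn1 p q r) (pr w)) (pd 1 (conn0 p q r) (pr w))
    (pd 0 (conn0 p q r) (pr w)) (pd 1 (conn1 p q r) (pr w)) => x y z t;
  by field; rewrite ?p0 ?r0.
Qed.

Let frame := contact_frame lift_e1 lift_e2 lift_theta.

Lemma lift_theta2_neq0 w : D w -> lift_theta 2%:R w != 0.
Proof.
move=> Dw; have [_ vt _] := ansatz_theta ans.
pose v : 'rV[R]_(2 + 1) := row_mx 0 (const_mx 1).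
have vE k : v 0 k = nth 0 [:: 0; 0; 1] k.
  by rewrite /v row_mx3E; elim/ord3P: k; rewrite !mxE.
have := vt i w Dw v; rewrite row_mxKl => /(_ erefl).
have -> : (theta i w *m v^T) 0 0 = lift_theta 2%:R w.
  rewrite mxE big_ord3 ![v^T _ _]mxE !vE /= !mulr0 mulr1 !add0r //.
apply; apply/eqP => /rowP/(_ 2%:R); rewrite vE mxE /= => /eqP.
by rewrite oner_eq0.
Qed.

Lemma lift_frame_unit w : D w -> frame w \in unitmx.
Proof.
move=> Dw; have iw := cylinder_dom Dw; have t0 := lift_theta2_neq0 Dw.
have pw := p0 iw; have rw := r0 iw.
pose t a := lift_theta a w.
(* Inverse of the matrix with rows [(p, q, 0)], [(0, r, 0)], [(t 0, t 1, t 2)]; its last column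
   relies on [theta] not vanishing on the fibres. *)
pose X : 'M[R]_3 := \matrix_(k, l) nth 0 (nth [::]
  [:: [:: (p (pr w))^-1; - q (pr w) / (p (pr w) * r (pr w)); 0];
      [:: 0; (r (pr w))^-1; 0];
      [:: - t 0 / (p (pr w) * t 2%:R);
          (q (pr w) * t 0 / p (pr w) - t 1) / (r (pr w) * t 2%:R); (t 2%:R)^-1]] k) l.
have : frame w *m X = 1%:M.
  apply/matrixP => k l; rewrite mxE big_ord3 ![frame w _ _]mxE ![X _ _]mxE [RHS]mxE.
  rewrite /lift_e1 /lift_e2 -!/(t _) -/(t 2%:R) in t0 *.
  elim/ord3P: k; elim/ord3P: l => /=; by field; rewrite ?pw ?rw ?t0.
by move=> /mulmx1_unit[].
Qed.

Lemma lift_metric w : D w -> cylinder_metric h lambda theta i w = (frame w)^T *m frame w.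
Proof.
move=> Dw; have iw := cylinder_dom Dw; have [_ _ _ HE] := pqr iw.
apply/matrixP => a b; rewrite [RHS]mxE big_ord3 ![(frame w)^T _ _]mxE ![frame w _ _]mxE /=.
have zE (k : R) (M P : 'M[R]_3) : (k *: M + P) a b = k * M a b + P a b by rewrite !mxE.
rewrite /cylinder_metric zE pull_proj_entry -/(pr w).
rewrite [tens _ _ _ _]mxE big_ord1 [_^T _ _]mxE; congr (_ + _).
have HE' k l : (loc lambda i (pr w) ^+ 2)^-1 * h i (pr w) k l =
    conformal_metric h lambda i (pr w) k l by rewrite mxE.
have lE : loc (N := cylinder N delta) (fun p => lambda p.1) i w = loc lambda i (pr w) by [].
rewrite lE /lift_e1 /lift_e2.
elim/ord3P: a zE; elim/ord3P: b => _ /=; rewrite ?HE' ?HE ?mxE ?big_ord2 ?mxE /=; ring.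
Qed.

Lemma lift_metric_unit w : D w -> cylinder_metric h lambda theta i w \in unitmx.
Proof.
by move=> Dw; rewrite lift_metric // unitmx_mul unitmx_tr lift_frame_unit.
Qed.

End Cylinder.

(** * Products, constant curvature and Nil *)

Section Classification.
Context {R : realType}.
Variables (N : atlas R 2) (h mu : tensor2 N) (A delta : R)
  (psi lambda rho nu : mpoint N -> R) (theta : covector_field (cylinder N delta)).
Hypothesis ans : ansatz h mu A psi lambda rho nu theta.
Hypothesis rho_cst : exists r : R, forall p : mpoint (cylinder N delta),
  carrier (cylinder N delta) p -> rho p.1 = r.

Let H := conformal_metric h lambda.
Let g := cylinder_metric h lambda theta.

Lemma conformal_riemannian : is_riemannian H.
Proof.
have [mN [[sh th] ph]] := ansatz_surface ans.
split; first exact: mN.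
split; last by move=> i u /(conformal_posdef ans).
split; first by move=> i k l; exact: (conformal_smooth ans).
move=> i j W tau tr u Wu; have [_ _ _ /(_ u Wu)[_ pE]] := tr.
rewrite /H /conformal_metric (th i j W tau tr u Wu) /pull2 /loc pE.
by rewrite -scalemxAr -scalemxAl.
Qed.

(** On a surface the Ricci tensor is [K H], and the Lie derivative of [H] along [grad ln nu] is
    twice the Hessian, that is, the Laplacian of [ln nu] times [H]. The soliton equation is thus the
    scalar identity for [K] in [frame_gauss_ansatz] with [C = 0]. *)
Lemma conformal_gradient_soliton :
  (forall x, carrier N x -> psi x = 0) -> is_gradient_soliton H.
Proof.
move=> psi0; exists A, (fun x => ln (nu x)); split.
  by move=> i; exact: chart_ln_nu ans i.
move=> i u iu; have oi := chart_open ans (i := i).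
have [p [q [r [sp sq sr pqr]]]] := chart_frame ans i.
have p0 v : dom i v -> p v != 0 by move=> /pqr[].
have r0 v : dom i v -> r v != 0 by move=> /pqr[].
have HE v : dom i v -> H i v =
  (mx22 (p v) (q v) 0 (r v))^T *m mx22 (p v) (q v) 0 (r v) by move=> /pqr[].
have uH v : dom i v -> H i v \in unitmx.
  by move=> iv; exact/posdef_unit/(conformal_posdef ans).
have symH v : dom i v -> (H i v)^T = H i v by move=> /(conformal_posdef ans)[].
rewrite (lie_grad oi (conformal_smooth ans (i := i)) uH symH _ iu); last first.
  exact: chart_ln_nu ans i.
rewrite (space_form_ricci (surface_space_form oi sp sq sr p0 r0 HE iu)).
rewrite (conformal_hessE ans rho_cst iu) -/H.
rewrite (frame_gauss_ansatz ans rho_cst sp sq sr pqr psi0 iu) -/H.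
move: (laplacian _ _ _) (H i u) => x M; rewrite !scalerA -scalerDl.
by congr (_ *: _); field.
Qed.

Lemma locally_product : (forall x, carrier N x -> psi x = 0) ->
  locally_isometric g (M' := prod_atlas N setT) (prod_line_metric H).
Proof.
move=> psi0 x [i [w [iw <-]]].
have [p [q [r [_ _ _ pqr]]]] := chart_frame ans i.
have oD := open_cylinder ans (i := i).
have st a := smooth_lift_theta ans (i := i) a.
have ct a b v : dom (i : chart (cylinder N delta)) v ->
    pd a (lift_theta theta i b) v = pd b (lift_theta theta i a) v.
  move=> Dv; apply/eqP; rewrite -subr_eq0; apply/eqP.
  rewrite (lift_structure3 ans rho_cst psi0 pqr a b Dv).
  by rewrite mulr0 sqrtr0 mul0r.
have [B [F [oB Bw BD sF dF]]] := poincare_lemma oD iw st ct.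
pose f (v : 'rV[R]_3) : 'rV[R]_3 :=
  row_mx (lsubmx (v : 'rV_(2 + 1))) (const_mx (F v)).
apply: (@locally_isometric_at _ _ _ (prod_atlas N setT) g (prod_line_metric H) i i B w f
  oB Bw BD).
- move=> j k; rewrite ord1 /f; under eq_fun do rewrite row_mx3E lsubmx3E !mxE.
  by elim/ord3P: k => /=; [exact: smooth_coord|exact: smooth_coord|exact: sF].
- by move=> v /BD Dv; split; rewrite // row_mxKl; case: Dv.
- move=> v Bv; rewrite (product_pull2 _ _ oB sF Bv).
  have -> : dif F v = theta i v by apply/rowP => a; rewrite !mxE dF.
  congr (_ + _); rewrite /g /cylinder_metric /pull_proj /pull2.
  by rewrite /H /conformal_metric -scalemxAr -scalemxAl.
- exact: (lift_metric_unit ans pqr iw).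
Qed.

Variable C : R.
Hypotheses (C_gt0 : 0 < C) (psiC : forall x, carrier N x -> psi x = C).

Lemma frame_gaussE i p q r :
  smooth_on (dom i) p -> smooth_on (dom i) q -> smooth_on (dom i) r ->
  (forall u, dom i u -> [/\ p u != 0, r u != 0,
     p u * r u = mu i u 0 1 / loc lambda i u ^+ 2 &
     H i u = (mx22 (p u) (q u) 0 (r u))^T *m mx22 (p u) (q u) 0 (r u)]) ->
  forall u, dom i u -> frame_gauss p q r u = (3 * C - A) / 2.
Proof.
move=> sp sq sr pqr u iu.
rewrite (frame_gauss_ansatz ans rho_cst sp sq sr pqr psiC iu).
by rewrite (laplacian_ln_nu ans rho_cst C_gt0 psiC iu); field.
Qed.

(* The curvature of [H] annihilates the gradient of [ln nu], whose Hessian is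
   [- (C + A) / 2] times [H]. *)
Lemma ansatz_constant_relation : (exists x, carrier N x) -> A != 3 * C -> A = - C.
Proof.
move=> [x [i [u0 [iu0 _]]]] AC; have oi := chart_open ans (i := i).
have [p [q [r [sp sq sr pqr]]]] := chart_frame ans i.
have p0 v : dom i v -> p v != 0 by move=> /pqr[].
have r0 v : dom i v -> r v != 0 by move=> /pqr[].
have HE v : dom i v -> H i v =
  (mx22 (p v) (q v) 0 (r v))^T *m mx22 (p v) (q v) 0 (r v) by move=> /pqr[].
pose f := loc (fun x => ln (nu x)) i.
have sf : smooth_on (dom i) f by exact: chart_ln_nu ans i.
pose kappa := 2^-1 * - (C + A).
have Hf v : dom i v -> hess (H i) f v = kappa *: H i v.
  move=> iv; rewrite (conformal_hessE ans rho_cst iv) -/H.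
  by rewrite (laplacian_ln_nu ans rho_cst C_gt0 psiC iv).
have K0 v : dom i v -> frame_gauss p q r v != 0.
  move=> iv; rewrite (frame_gaussE sp sq sr pqr iv) mulf_neq0 ?invr_eq0 //.
  by rewrite subr_eq0 eq_sym.
have f0 v a : dom i v -> pd a f v = 0.
  move=> iv; have [E0 E1] := frame_gauss_hess_const oi sp sq sr p0 r0 HE sf Hf iv.
  have pv := p0 v iv; have rv := r0 v iv; have Kv := K0 v iv.
  have [c0 c1] : frame_coef0 p f v = 0 /\ frame_coef1 p q r f v = 0.
    by split; apply/eqP; [move/eqP: E0|move/eqP: E1]; rewrite mulf_eq0 (negPf Kv).
  have fx : pd 0 f v = 0.
    by move/eqP: c0; rewrite /frame_coef0 mulf_eq0 invr_eq0 (negPf pv) orbF => /eqP.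
  have fy : pd 1 f v = 0.
    move/eqP: c1; rewrite /frame_coef1 fx mulr0 subr0.
    by rewrite !mulf_eq0 invr_eq0 mulf_eq0 (negPf pv) (negPf rv) /= orbF => /eqP.
  by elim/ord2P: a.
(* The first derivatives of [ln nu] vanish throughout the chart, so its Hessian vanishes; as [H] has
   a positive diagonal entry, [kappa = 0]. *)
have := Hf u0 iu0; have -> : hess (H i) f u0 = 0.
  apply/matrixP => a b; rewrite !mxE big1 => [|c _]; last by rewrite f0 // mulr0.
  by rewrite (pd_eq_on a oi (fun v => @f0 v b) iu0) pd_cst subr0.
move=> /matrixP/(_ 0 0); rewrite [LHS]mxE [RHS]mxE => /esym/eqP.
have H00 := posdef_diag_gt0 0 (conformal_posdef ans iu0).
rewrite mulf_eq0 [X in _ || X]gt_eqF // orbF /kappa mulf_eq0 invr_eq0 pnatr_eq0 /=.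
by rewrite oppr_eq0 addrC addr_eq0 => /eqP.
Qed.

Let c := Num.sqrt (2 * C).

Let c2 : c ^+ 2 = 2 * C.
Proof. by rewrite sqr_sqrtr // mulr_ge0 // ltW. Qed.

Lemma constant_curvature_case : A = - C -> has_constant_curvature g.
Proof.
move=> AC; exists (c ^+ 2 / 4) => i u v w iu vw.
have [p [q [r [sp sq sr pqr]]]] := chart_frame ans i.
have oD := open_cylinder ans (i := i).
have K x : dom (i : chart N) x -> frame_gauss p q r x = c ^+ 2.
  by move=> ix; rewrite (frame_gaussE sp sq sr pqr ix) AC c2; field.
have uE x : dom (i : chart (cylinder N delta)) x ->
    contact_frame (lift_e1 p q) (lift_e2 r) (lift_theta theta i) x \in unitmx.
  by move=> Dx; exact: (lift_frame_unit ans (i := i) pqr Dx).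
have gE x : dom (i : chart (cylinder N delta)) x -> g i x =
    (contact_frame (lift_e1 p q) (lift_e2 r) (lift_theta theta i) x)^T *m
    contact_frame (lift_e1 p q) (lift_e2 r) (lift_theta theta i) x.
  by move=> Dx; rewrite /g (lift_metric theta (i := i) pqr Dx).
have sg := contact_space_form oD (smooth_lift_e1 ans sp sq (i := i))
  (smooth_lift_e2 ans sr (i := i)) (smooth_lift_theta ans (i := i))
  (smooth_lift_conn ans sp sq sr pqr)
  (fun a b x Dx => lift_structure1 ans sp sq pqr a b Dx)
  (fun a b x Dx => lift_structure2 ans sr pqr a b Dx)
  (fun a b x Dx => lift_structure3 ans rho_cst psiC pqr a b Dx)
  (fun a b x Dx => lift_structure4 ans sp sq sr pqr a b K Dx)
  uE gE erefl iu.
have pg : posdef (g i u) by rewrite gE //; exact/gram_posdef/uE.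
apply: (space_form_sectional sg); first by case: pg.
exact/lt0r_neq0/gram_gt0.
Qed.

Lemma nil_case : A = 3 * C -> locally_nil g.
Proof.
move=> AC; have c_gt0 : 0 < c by rewrite sqrtr_gt0 mulr_gt0.
(* This homothety factor makes up for the dilation by [c] of the coordinates [y k] below. *)
exists (c ^+ 2)^-1; split; first by rewrite invr_gt0 exprn_gt0.
move=> x [i [w0 [iw0 <-]]].
have [p [q [r [sp sq sr pqr]]]] := chart_frame ans i.
have oD := open_cylinder ans (i := i).
have K x' : dom (i : chart N) x' -> frame_gauss p q r x' = 0.
  by move=> ix; rewrite (frame_gaussE sp sq sr pqr ix) AC subrr mul0r.
have S4 a b v : dom (i : chart (cylinder N delta)) v ->
    pd a (lift_conn p q r b) v = pd b (lift_conn p q r a) v.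
  move=> Dv; apply/eqP; rewrite -subr_eq0; apply/eqP.
  by rewrite (lift_structure4 ans sp sq sr pqr a b K Dv) oppr0 mul0r.
have [B [y1 [y2 [y3 [oB Bw0 BD [sy1 sy2 sy3] yE]]]]] :=
  nil_closed_coframe oD (smooth_lift_e1 ans sp sq (i := i))
  (smooth_lift_e2 ans sr (i := i)) (smooth_lift_theta ans (i := i))
  (smooth_lift_conn ans sp sq sr pqr)
  (fun a b x Dx => lift_structure1 ans sp sq pqr a b Dx)
  (fun a b x Dx => lift_structure2 ans sr pqr a b Dx)
  (fun a b x Dx => lift_structure3 ans rho_cst psiC pqr a b Dx)
  S4 iw0.
pose y (k : 'I_3) := nth (fun=> 0) [:: y1; y2; y3] k.
have sy k : smooth_on B (y k).
  by rewrite /y; elim/ord3P: k => /=; [exact: sy1|exact: sy2|exact: sy3].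
apply: (@locally_isometric_at _ _ _ (euclid R 3) g _ i tt B w0
  (fun v => \row_k (c * y k v)) oB Bw0 BD).
- move=> j k; under eq_fun do rewrite mxE.
  exact: smoothZ oB (sy k).
- by [].
- move=> v Bv; apply/matrixP => a b.
  rewrite (nil_pull2 tt a b oB sy Bv) ?gt_eqF // /y /=.
  rewrite /g (lift_metric theta pqr (BD _ Bv)).
  have [Eab ta] := yE v a b Bv; have [_ tb] := yE v b a Bv.
  rewrite -ta -tb Eab mxE big_ord3 ![_^T _ _]mxE.
  by rewrite ![contact_frame _ _ _ _ _ _]mxE.
- exact: (lift_metric_unit ans pqr iw0).
Qed.

End Classification.

Theorem corollary1p2 (R : realType) (N : atlas R 2) (h mu : tensor2 N)
    (A delta : R) (psi lambda rho nu : mpoint N -> R)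
    (theta : covector_field (cylinder N delta)) :
  ansatz h mu A psi lambda rho nu theta ->
  is_ricci_soliton (cylinder_metric h lambda theta) A ->
  (exists r : R, forall p : mpoint (cylinder N delta),
     carrier (cylinder N delta) p -> rho p.1 = r) ->
  exists C : R,
    (forall x : mpoint N, carrier N x -> psi x = C) /\
    ((C = 0 /\
      exists (N2 : atlas R 2) (h2 : tensor2 N2),
        [/\ is_riemannian h2, is_gradient_soliton h2 &
            locally_isometric (cylinder_metric h lambda theta)
              (M' := prod_atlas N2 setT) (prod_line_metric h2)])
     \/
     (C <> 0 /\
      (has_constant_curvature (cylinder_metric h lambda theta) \/
       locally_nil (cylinder_metric h lambda theta)))).
Proof.
move=> ans _ rho_cst; have [C psiC] := psi_constant ans rho_cst.
exists C; split; first exact: psiC.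
have [C0|Cn0] := eqVneq C 0.
  left; split; first exact: C0.
  rewrite C0 in psiC; exists N, (conformal_metric h lambda); split.
  - exact: conformal_riemannian ans.
  - exact: conformal_gradient_soliton ans rho_cst psiC.
  - exact: locally_product ans rho_cst psiC.
right; split; first exact/eqP.
(* The sign of [C] is read off from [psi] at a point. Over an empty surface the cylinder is empty
   too, and any number, here [0], is vacuously its curvature. *)
have [[x Nx]|N0] := pselect (exists x, carrier N x); last first.
  by left; exists 0 => i u v w [iu _]; case: N0; pose u' : 'rV[R]_(2 + 1) := u;
    exists (par (i : chart N) (lsubmx u')), i, (lsubmx u').
have C_gt0 : 0 < C.
  by rewrite lt_neqAle eq_sym Cn0 -(psiC x Nx) (ansatz_psi ans).
have [AC|AC] := eqVneq A (3 * C).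
  by right; exact: (nil_case ans rho_cst C_gt0 psiC AC).
left; apply: (constant_curvature_case ans rho_cst C_gt0 psiC).
by apply: (ansatz_constant_relation ans rho_cst C_gt0 psiC) AC; exists x.
Qed.
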